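(* Consider the random wire model on $\mathcal G^{\rm b}_L$ with $\alpha=2$, $J_e\equiv J\ge0$ on all edges (including boundary edges), and $e^{-U(n)}=1/n!$. Then the limit \[\tilde m(d,J)=\lim_{L\to\infty}\mathbb E^{2,J}_{\mathcal G^{\rm b}_L}\Bigl[\frac{\tilde n_0}{n_0+1}\Bigr]\] exists, and: (a) $\tilde m(d,J)$ is nondecreasing in $d$ and in $J$; (b) $\tilde m(d,J)=0$ whenever $J<2^{-3/2}\log\bigl(1+\frac1{(2d)^2}\bigr)$, in any dimension $d$; (c) $\tilde m(d,J)=0$ for $d=1,2$ and all $J\ge0$; (d) for $d\ge3$ there is $J_{\rm c}(d)<\infty$ such that $\tilde m(d,J)>0$ for $J>J_{\rm c}(d)$ and $\tilde m(d,J)=0$ for $J<J_{\rm c}(d)$.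
   Context: Random wire model (finite graph): for $\mathcal G=(\mathcal V,\mathcal E)$ and $\boldsymbol m\in\mathbb N_0^{\mathcal E}$, $n_x(\boldsymbol m)=\frac12\sum_{e\ni x}m_e$; link configurations have $n_x\in\mathbb N_0$ at each $x$; a pairing configuration is a perfect matching at each site of the link-endpoints at that site; a wire configuration $\boldsymbol w=(\boldsymbol m,\boldsymbol\pi)$ decomposes into loops (follow links through pairings); $\lambda(\boldsymbol w)$ is the number of loops; weight $\alpha^{\lambda(\boldsymbol w)}\prod_e\frac{J_e^{m_e}}{m_e!}\exp\{-\sum_x U(n_x)\}$, normalised by the partition function. Graph with boundary: $\mathcal G^{\rm b}=(\mathcal V\cup\bar{\mathcal V},\mathcal E\cup\bar{\mathcal E})$ with $\bar{\mathcal E}\subset\mathcal V\times\bar{\mathcal V}$; links live on $\mathcal E\cup\bar{\mathcal E}$; the evenness constraint and pairings are imposed only at sites of $\mathcal V$ (none at $\bar{\mathcal V}$), and $n_x$ is defined for $x\in\mathcal V$ as half the number of link-endpoints at $x$. Besides closed loops there are open loops, which start and end with a link in $\bar{\mathcal E}$; $\lambda(\boldsymbol w)$ counts both closed and open loops, and the weight is $\alpha^{\lambda(\boldsymbol w)}\prod_{e\in\mathcal E\cup\bar{\mathcal E}}\frac{J_e^{m_e}}{m_e!}\exp\{-\sum_{x\in\mathcal V}U(n_x)\}$. Here $\Lambda_L=\{-L,\dots,L\}^d$, $\partial\Lambda_L=\{y\in\mathbb Z^d\setminus\Lambda_L:\exists x\in\Lambda_L,\|x-y\|=1\}$, $\mathcal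 G^{\rm b}_L$ has vertices $\Lambda_L$, boundary $\partial\Lambda_L$, edges all nearest-neighbour pairs within $\Lambda_L$ and between $\Lambda_L$ and $\partial\Lambda_L$. For $x\in\Lambda_L$, $\tilde n_x(\boldsymbol w)$ is half the number of link-endpoints at $x$ belonging to links of open loops, i.e. the number of pairs at $x$ belonging to open loops. *)

(* Defs.v *)
From Stdlib Require Import Reals ZArith.
From mathcomp Require Import ssreflect ssrfun ssrbool eqtype ssrnat seq path choice fintype finfun bigop finset fingraph.
Set Implicit Arguments. Unset Strict Implicit. Unset Printing Implicit Defensive.

(* T      : finite type containing all vertices (interior and boundary) *)
(* inner  : the interior vertex set V (evenness/pairings only there)   *)
(* Ed     : finite type of edges (E together with the boundary edges)  *)
(* inc e x: x is an endpoint of e (each edge has two distinct ends)    *)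
(* N      : truncation level: all m_e <= N (the series over link        *)
(*          configurations is the limit N -> oo of these finite sums;  *)
(*          all terms are nonnegative here).                           *)
Section RWM.
Variables (T : finType) (inner : pred T) (Ed : finType) (inc : Ed -> T -> bool).
Variable N : nat.

Definition cfg := {ffun Ed -> 'I_N.+1}.
(* a link is (e, k) with k < m_e ; a link endpoint (half-link) is (link, site) *)
Definition link := (Ed * 'I_N)%type.
Definition hlink := (link * T)%type.

Definition valid_link (m : cfg) (l : link) : bool := (l.2 : nat) < m l.1.

Definition nsite (m : cfg) (x : T) : nat := (\sum_(e | inc e x) (m e : nat))./2.

Definition even_cfg (m : cfg) : bool :=
  [forall x, inner x ==> ~~ odd (\sum_(e | inc e x) (m e : nat))].

Definition valid_hl (m : cfg) (h : hlink) : bool :=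
  [&& inc h.1.1 h.2, valid_link m h.1 & inner h.2].

(* pairing configuration: at every interior site, a perfect matching of the
   link endpoints there, encoded as a fixed-point-free involution on valid
   half-links preserving the site (and the identity elsewhere). *)
Definition is_pairing (m : cfg) (p : {ffun hlink -> hlink}) : bool :=
  [forall h, if valid_hl m h
             then [&& valid_hl m (p h), (p h).2 == h.2, p h != h & p (p h) == h]
             else p h == h].

(* two links are adjacent when an endpoint of one is paired with an endpoint
   of the other; loops = connected components of this graph on links *)
Definition lrel (p : {ffun hlink -> hlink}) : rel link :=
  fun l1 l2 => [exists x, ((p (l1, x)).1 == l2) || ((p (l2, x)).1 == l1)].

Definition nloops (m : cfg) (p : {ffun hlink -> hlink}) : nat :=
  n_comp (lrel p) (valid_link m).

Definition bdry_link (l : link) : bool := [exists y, inc l.1 y && ~~ inner y].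

Definition open_link (m : cfg) (p : {ffun hlink -> hlink}) (l : link) : bool :=
  [exists l', [&& valid_link m l', bdry_link l' & connect (lrel p) l l']].

Definition ntilde (m : cfg) (p : {ffun hlink -> hlink}) (x : T) : nat :=
  #|[pred h : hlink | [&& valid_hl m h, h.2 == x & open_link m p h.1]]|./2.

(* weight alpha^lambda prod_e J_e^{m_e}/m_e! prod_{x in V} e^{-U(n_x)} ;
   eU n stands for exp(-U(n)) *)
Definition weight (alpha : R) (J : Ed -> R) (eU : nat -> R)
    (m : cfg) (p : {ffun hlink -> hlink}) : R :=
  (pow alpha (nloops m p)
   * \big[Rmult/1%R]_(e : Ed) (pow (J e) (m e : nat) / INR (fact (m e)))
   * \big[Rmult/1%R]_(x | inner x) eU (nsite m x))%R.

Definition wsum (alpha : R) (J : Ed -> R) (eU : nat -> R)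
    (f : cfg -> {ffun hlink -> hlink} -> R) : R :=
  \big[Rplus/0%R]_(m : cfg | even_cfg m)
    \big[Rplus/0%R]_(p : {ffun hlink -> hlink} | is_pairing m p)
      (f m p * weight alpha J eU m p)%R.

End RWM.

(* The box graph G^b_L in Z^d.  Points of Z^d with all coordinates in   *)
(* [-L-1, L+1] are encoded as x : 'I_d -> 'I_(2L+3), with integer       *)
(* coordinate zc x i = x i - (L+1).  This region contains Lambda_L and  *)
(* its outer boundary; the remaining points lie on no edge.            *)
Definition Pt (d L : nat) := {ffun 'I_d -> 'I_(L.*2).+3}.

Definition zc (d L : nat) (x : Pt d L) (i : 'I_d) : Z :=
  (Z.of_nat (x i) - Z.of_nat L.+1)%Z.

Definition inner_box (d L : nat) : pred (Pt d L) :=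
  fun x => [forall i, (- Z.of_nat L <=? zc x i)%Z && (zc x i <=? Z.of_nat L)%Z].

Definition adj (d L : nat) (x y : Pt d L) : bool :=
  Z.eqb (\big[Z.add/0%Z]_(i < d) Z.abs (zc x i - zc y i)) 1%Z.

(* edges of G^b_L: nearest-neighbour pairs with at least one end in Lambda_L
   (the other end is then in Lambda_L or in the outer boundary) *)
Definition is_edge (d L : nat) (e : {set Pt d L}) : bool :=
  [exists x, exists y, [&& e == [set x; y], adj x y & inner_box x]].

Definition EdgeB (d L : nat) := {e : {set Pt d L} | is_edge e}.

Definition incB (d L : nat) (e : EdgeB d L) (x : Pt d L) : bool := x \in val e.

Definition origin (d L : nat) : Pt d L := [ffun => inord L.+1].

Definition box_sum (d L N : nat) (J : R)
    (f : cfg (EdgeB d L) N -> {ffun hlink (Pt d L) (EdgeB d L) N ->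
                                      hlink (Pt d L) (EdgeB d L) N} -> R) : R :=
  wsum (@inner_box d L) (@incB d L) 2%R (fun _ => J) (fun n => / INR (fact n))%R f.

Definition obs (d L N : nat) (m : cfg (EdgeB d L) N)
    (p : {ffun hlink (Pt d L) (EdgeB d L) N -> hlink (Pt d L) (EdgeB d L) N}) : R :=
  (INR (ntilde (@inner_box d L) (@incB d L) m p (origin d L))
   / (INR (nsite (@incB d L) m (origin d L)) + 1))%R.

Definition is_expect (d L : nat) (J : R) (E : R) : Prop :=
  exists Z A : R,
    Un_cv (fun N => @box_sum d L N J (fun _ _ => 1%R)) Z /\
    Un_cv (fun N => @box_sum d L N J (@obs d L N)) A /\
    (0 < Z)%R /\ E = (A / Z)%R.

(* Main.v *)
Require Import Defs.
From HB Require Import structures.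
From Stdlib Require Import Reals ZArith Lra Lia ClassicalEpsilon.
From mathcomp Require Import ssreflect ssrfun ssrbool eqtype ssrnat seq path choice fintype div prime finfun bigop finset fingraph.
From mathcomp Require Import ssralg zmodp zify.
Set Implicit Arguments. Unset Strict Implicit. Unset Printing Implicit Defensive.
Delimit Scope R_scope with R.
Delimit Scope ring_scope with ring.

(** The wire model at [alpha = 2], [exp (- U n) = 1 / n!] is the XY model with
coupling [2 J] per edge and boundary spins frozen at angle [0].  Indeed
[2 ^ (number of loops)] is [2 ^ (number of open loops)] times the number of
2-colorings of the links that are constant along loops and give the first color
to open loops; the number of pairings compatible with a coloring having [a] and
[b] link ends of the two colors at [x] is [(a-1)!! (b-1)!!], which up to a power
of [2] is [n_x!] times the average of [cos^a sin^b].  Summing over colorings gives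
[exp (2 J cos (theta_x - theta_y))] on each edge, and the observable becomes
[cos (2 theta_0)].  Instead of integrals, angles range over the [n+1]-th roots of
unity with [n+1] odd, and [n] tends to infinity after all estimates.

Ginibre's inequality (duplicate the spins and use that [(p, q) |-> (p - q, p + q)]
is bijective for [n+1] odd) makes [<cos 2 theta_0>] nondecreasing in [J] and [d] and
nonincreasing in [L], hence the limit and (a).  For (b), a Schwinger-Dyson
inequality iterated along paths gives [<cos 2 theta_0> <= (2 d J)^(L+1)].  For (c),
rotating the spins by a slowly varying angle that is [pi/2] at the origin and [0]
on the boundary costs an energy of order [1 / log L] in two dimensions.  For (d),
put independent random phases on the edges, each with density
proportional to [exp (J cos)]; by Ginibre the phases only decrease the modulus of
[<exp (2 i theta_0)>], and by gauge invariance the spin at the origin can be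
estimated from the phases along a random path to the boundary, with a quality
governed by the exponential moments of the number of edges common to two
independent paths.  In three dimensions there are random oriented paths for which
these are bounded uniformly in [L] (unpredictable paths). *)

(** * Pairings, loops and colorings *)

(** Roots of unity keep every average a finite sum. For a fixed truncation [N] of the link numbers,
    moments of cosine and sine over [n + 1] roots of unity equal those over the circle once [n]
    exceeds the degree, so the identity between wires and spins is exact, and the convergence of
    both sides follows from it without any integral. The power of 2 due to open loops is under
    control because their number depends on [m] only: an open loop misses exactly two interior ends.
    Since loops are connected components and are never listed as paths, one half of this is a
    dimension count over the field with two elements. For (d), plain oriented random walks in three
    dimensions would not do: two of them meet after [k] steps with probability of order [1 / k],
    whose sum diverges. Here the numbers of steps in two directions spread like [k ^ (2/3)] instead
    of [k ^ (1/2)], so that meetings have probability of order [k ^ (-4/3)], which is summable; the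
    third direction takes up the remaining time. The cases [d = 1] and [d > 3] follow from [d = 2]
    and [d = 3] by monotonicity in [d]. *)

Section PerfectMatchings.
Variables (H K : finType) (kappa : H -> K).
Implicit Types (A : {set H}) (p q : {ffun H -> H}).

(** Paired elements share the label [kappa]. In the application it is the site together with the
    color, which counts the pairings compatible with a coloring. *)
Definition fpairing A p : bool := [forall h, if h \in A
  then [&& p h \in A, kappa (p h) == kappa h, p h != h & p (p h) == h] else p h == h].

(* [(n-1)!!] for even [n] and [0] for odd [n]: the number of perfect matchings of
   [n] points. *)
Fixpoint dfact (n : nat) : nat := if n is n'.+1 then (if n' is n''.+1 then n' * dfact n'' else 0) else 1.

Lemma dfactSS n : dfact n.+2 = n.+1 * dfact n. Proof. by []. Qed.

Lemma fpairingP A p : reflect ((forall h, h \in A -> [/\ p h \in A, kappa (p h) = kappa h, p h != h & p (p h) = h])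
   /\ (forall h, h \notin A -> p h = h)) (fpairing A p).
Proof.
apply: (iffP forallP) => [h|[h1 h2] x].
  split=> x hx; have := h x; first by rewrite hx => /and4P[? /eqP ? ? /eqP ?].
  by rewrite (negbTE hx) => /eqP.
case: ifP => [hx|/negbT hx]; last by rewrite h2.
by have [-> -> -> ->] := h1 x hx; rewrite !eqxx.
Qed.

Definition pairswap (a b : H) (q : {ffun H -> H}) : {ffun H -> H} :=
  [ffun h => if h == a then b else if h == b then a else q h].

(** Removing the pair made of [a] and [b] is a bijection, with inverse [pairswap a b]. *)
Lemma card_fpairing_at A a b : a \in A -> b \in A -> kappa b = kappa a -> b != a ->
  #|[set p | fpairing A p & p a == b]| = #|[set q | fpairing (A :\: [set a; b]) q]|.
Proof.
move=> aA bA kab ba.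
have <- : [set pairswap a b q | q in [set q | fpairing (A :\: [set a; b]) q]] = [set p | fpairing A p & p a == b].
  apply/setP => p; rewrite inE; apply/imsetP/andP => [[q]|[/fpairingP[h1 h2] /eqP pab]].
    rewrite inE => /fpairingP[h1 h2] ->; split; last by rewrite ffunE eqxx.
    apply/fpairingP; split=> h hA; rewrite /pairswap !ffunE.
      case: (eqVneq h a) => [->|ha]; first by rewrite ?eqxx (negbTE ba) ?eqxx; split.
      case: (eqVneq h b) => [->|hb]; first by rewrite ?eqxx; split=> //; rewrite eq_sym.
      have hA' : h \in A :\: [set a; b] by rewrite !inE negb_or ha hb.
      have [q1 -> q3 q4] := h1 h hA'; move: (q1); rewrite !inE negb_or => /andP[/andP[qa qb] qA].
      by rewrite (negbTE qa) (negbTE qb).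
    have ha : h != a by apply: contraNneq hA => ->.
    have hb : h != b by apply: contraNneq hA => ->.
    by rewrite (negbTE ha) (negbTE hb) h2 // !inE (negbTE hA) andbF.
  have pba : p b = a by have [_ _ _] := h1 a aA; rewrite pab.
  exists [ffun h => if (h == a) || (h == b) then h else p h].
    rewrite inE; apply/fpairingP; split=> h; rewrite !inE negb_or.
      move=> /andP[/andP[ha hb] hA]; rewrite !ffunE (negbTE ha) (negbTE hb) /=.
      have [p1 p2 p3 p4] := h1 h hA.
      have pa : p h != a by apply: contraNneq hb => e; rewrite -p4 e pab.
      have pb : p h != b by apply: contraNneq ha => e; rewrite -p4 e pba.
      by rewrite (negbTE pa) (negbTE pb) p4 p1; split.
    rewrite ffunE; case: ifP => // /negbT; rewrite negb_or => /andP[-> ->] /= hA.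
    exact: (h2 h hA).
  apply/ffunP => h; rewrite !ffunE.
  by case: (eqVneq h a) => [->|ha]; last case: (eqVneq h b) => [->|hb].
rewrite card_in_imset // => q q'; rewrite !inE => /fpairingP[_ h2] /fpairingP[_ h2'] e.
apply/ffunP => h; have := congr1 (fun f : {ffun H -> H} => f h) e; rewrite !ffunE.
case: (eqVneq h a) => [->|ha]; first by rewrite h2 ?h2' // !inE eqxx.
by case: (eqVneq h b) => [->|hb] //; rewrite h2 ?h2' // !inE eqxx orbT.
Qed.

(** Induction on the size of [A]: the possible partners of [a] are the other elements of its class,
    and removing both shrinks that class by two. *)
Lemma card_fpairing A : #|[set p | fpairing A p]| = \prod_(k : K) dfact #|[set h in A | kappa h == k]|.
Proof.
elim: {A}_.+1 {-2}A (ltnSn #|A|) => // n IH A; rewrite ltnS => hn.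
have [->|/set0Pn[a aA]] := eqVneq A set0.
  rewrite big1 => [|k _]; last first.
    by rewrite (_ : [set h in set0 | _] = set0) ?cards0 //; apply/setP => h; rewrite !inE.
  rewrite -(cards1 [ffun h : H => h]); apply: eq_card => p; rewrite !inE.
  apply/fpairingP/eqP => [[_ h]|->].
    by apply/ffunP => x; rewrite ffunE h // inE.
  by split=> h; rewrite ?inE // ffunE.
pose B := [set b in A | (kappa b == kappa a) && (b != a)].
have -> : #|[set p | fpairing A p]| = \sum_(b in B) #|[set q | fpairing (A :\: [set a; b]) q]|.
  rewrite -sum1_card (partition_big (fun p : {ffun H -> H} => p a) (mem B)) /=; last first.
    move=> p; rewrite inE => /fpairingP[h _]; have [h1 h2 h3 _] := h a aA.
    by rewrite !inE h1 h2 eqxx h3.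
  apply: eq_bigr => b; rewrite inE => /and3P[bA /eqP kb ba].
  rewrite -(card_fpairing_at aA bA kb ba) -sum1_card.
  by apply: eq_bigl => p; rewrite !inE.
pose N k := #|[set h in A | kappa h == k]|.
have cardB : #|B| = (N (kappa a)).-1.
  rewrite /N [in RHS](cardsD1 a) inE aA eqxx /=; apply: eq_card => h; rewrite !inE.
  by case: (h == a); rewrite ?andbF ?andbT.
have hN : 0 < N (kappa a) by apply/card_gt0P; exists a; rewrite inE aA eqxx.
rewrite (eq_bigr (fun=> dfact (N (kappa a)).-2 * \prod_(k : K | k != kappa a) dfact (N k))); last first.
  move=> b; rewrite inE => /and3P[bA /eqP kb ba]; rewrite IH; last first.
    apply: leq_trans hn; apply/proper_card/properP; split; first exact: subsetDl.
    by exists a => //; rewrite !inE eqxx.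
  rewrite (bigD1 (kappa a)) //=; congr (dfact _ * _).
    rewrite /N [in RHS](cardsD1 a) [in RHS](cardsD1 b) !inE aA bA kb ba eqxx /=.
    by apply: eq_card => h; rewrite !inE negb_or; case: (h == a); case: (h == b); case: (h \in A).
  apply: eq_bigr => k ka; congr dfact; apply: eq_card => h; rewrite !inE.
  case: (eqVneq (kappa h) k) => hk; rewrite ?andbF // !andbT negb_or.
  have -> : h != a by apply: contraNneq ka => e; rewrite -hk e.
  by have -> : h != b by apply: contraNneq ka => e; rewrite -hk e kb.
rewrite sum_nat_const cardB mulnA [RHS](bigD1 (kappa a)) //= -/(N _); congr (_ * _).
by case: (N (kappa a)) hN => [//|[|n'] _]; rewrite ?mul0n.
Qed.
End PerfectMatchings.

(** Every orbit has two elements, and the order of [enum_rank] selects one of them; later this gives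
    one representative per pair of link ends. *)
Lemma card_involution (X : finType) (A : {set X}) (f : X -> X) :
  (forall x, x \in A -> [/\ f x \in A, f x != x & f (f x) = x]) ->
  #|A| = 2 * #|[set x in A | enum_rank x < enum_rank (f x)]|.
Proof.
move=> hf; set R := [set x in A | _].
have dj : A = R :|: [set f x | x in R].
  apply/setP => x; rewrite inE; apply/idP/orP => [xA|[|/imsetP[y]]]; last first.
  - by rewrite inE => /andP[/hf[? _ _] _] ->.
  - by rewrite inE => /andP[].
  have [fA fx ffx] := hf x xA.
  have : enum_rank x != enum_rank (f x) :> nat.
    by apply: contra fx => /eqP /ord_inj /enum_rank_inj <-.
  rewrite neq_ltn => /orP[h|h]; [left; by rewrite inE xA | right].
  by apply/imsetP; exists (f x) => //; rewrite inE fA ffx.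
rewrite {1}dj cardsU card_in_imset => [|x y]; last first.
  by rewrite !inE => /andP[/hf[_ _ e] _] /andP[/hf[_ _ e'] _] h; rewrite -e h e'.
rewrite (_ : R :&: _ = set0) ?cards0 ?subn0 ?mul2n ?addnn //.
apply/setP => x; rewrite !inE; apply/negP => /andP[/andP[_ h] /imsetP[y]].
rewrite inE => /andP[/hf[_ _ e] h'] xy; move: h; rewrite xy e ltnNge; by rewrite (ltnW h').
Qed.

(** * Colorings that are constant on components *)

Section ComponentColorings.
Variables (X : finType) (e : rel X) (S : pred X).
Hypothesis e_sym : symmetric e.
Hypothesis S_closed : closed e S.

(* Links outside [S] have the forced color [true]. *)
Definition comp_coloring (c : {ffun X -> bool}) : bool :=
  [forall x, forall y, (S x && e x y) ==> (c x == c y)] && [forall x, ~~ S x ==> c x].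

Lemma comp_coloringP (c : {ffun X -> bool}) : reflect ((forall x y, S x -> e x y -> c x = c y) /\ (forall x, ~~ S x -> c x))
  (comp_coloring c).
Proof.
apply: (iffP andP) => -[h1 h2]; split.
- by move=> x y Sx exy; have := forallP (forallP h1 x) y; rewrite Sx exy => /eqP.
- by move=> x Sx; have := forallP h2 x; rewrite Sx.
- by apply/forallP => x; apply/forallP => y; apply/implyP => /andP[Sx exy]; rewrite (h1 x y).
- by apply/forallP => x; apply/implyP; exact: h2.
Qed.

Lemma comp_coloring_connect (c : {ffun X -> bool}) x y : comp_coloring c -> S x -> connect e x y -> c x = c y.
Proof.
move=> /comp_coloringP[h _] Sx /connectP[s hs ->] {y}.
elim: s x Sx hs => //= y s IH x Sx /andP[exy hs].
by rewrite (h x y Sx exy) IH //; have := S_closed exy; rewrite /in_mem /= => <-.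
Qed.

(** The values at the component roots in [S] are free and determine the coloring: [f] restricts to
    these roots, [g] extends from them. *)
Lemma card_comp_coloring : #|[set c | comp_coloring c]| = 2 ^ n_comp e S.
Proof.
have cs : connect_sym e by exact: sym_connect_sym.
have Sroot x : S (root e x) = S x.
  by have := closed_connect S_closed (connect_root e x); rewrite /in_mem /= => ->.
pose D : pred X := [predI roots e & S].
rewrite /n_comp_mem -/D -card_bool -(card_pffun_on true D predT).
pose f (c : {ffun X -> bool}) : {ffun X -> bool} := [ffun x => if D x then c x else true].
pose g (d : {ffun X -> bool}) : {ffun X -> bool} := [ffun x => if S x then d (root e x) else true].
have fg : {in pffun_on true D predT, cancel g f}.
  move=> d /pffun_onP[/subsetP hd _]; apply/ffunP => x; rewrite !ffunE.
  case: ifP => [/andP[/= /eqP hr hS]|hD]; first by rewrite (_ : S x = true) ?hr.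
  by apply/esym/eqP; apply: contraFT hD => hx; apply: hd; rewrite inE.
have gf : {in [set c | comp_coloring c], cancel f g}.
  move=> c; rewrite inE => hc; apply/ffunP => x; rewrite !ffunE.
  case: (boolP (S x)) => hS; last by have /comp_coloringP[_ h] := hc; rewrite h.
  have -> : D (root e x) by apply/andP; split; [exact/eqP/root_root | rewrite /in_mem /= Sroot].
  by apply/esym/(comp_coloring_connect hc hS); exact: connect_root.
have fim : {in [set c | comp_coloring c], forall c, f c \in pffun_on true D predT}.
  move=> c _; apply/pffun_onP; split; last by move=> ? _.
  by apply/subsetP => x; rewrite inE ffunE; case: ifP => // _; rewrite eqxx.
have gim : {in pffun_on true D predT, forall d, g d \in [set c | comp_coloring c]}.
  move=> d _; rewrite inE; apply/comp_coloringP; split=> x.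
    move=> y Sx exy; rewrite !ffunE Sx; have := S_closed exy; rewrite /in_mem /= Sx => <-.
    by congr (d _); apply/(rootP cs); exact: connect1.
  by move=> /negbTE h; rewrite ffunE h.
apply/eqP; rewrite eqn_leq; apply/andP; split.
  rewrite -(card_in_imset (can_in_inj gf)); apply/subset_leq_card/subsetP => _ /imsetP[c hc ->].
  exact: fim.
rewrite -(card_in_image (can_in_inj fg)); apply/subset_leq_card/subsetP => _ /imageP[d hd ->].
exact: gim.
Qed.
End ComponentColorings.

(** * Open and closed loops of a fixed pairing *)

Section Loops.
Variables (T : finType) (inner : pred T) (Ed : finType) (inc : Ed -> T -> bool) (N : nat).
Variables (src tgt : Ed -> T).
Hypothesis incE : forall e x, inc e x = (x == src e) || (x == tgt e).
Hypothesis src_tgt : forall e, src e != tgt e.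
Hypothesis inner_src : forall e, inner (src e).

Notation link := (link Ed N).
Notation hlink := (hlink T Ed N).

Variables (m : cfg Ed N) (p : {ffun hlink -> hlink}).
Hypothesis hp : is_pairing inner inc m p.

Let V (l : link) := valid_link m l.
Let A (h : hlink) := valid_hl inner inc m h.
Let op (l : link) := open_link inner inc m p l.

Lemma pairing_in h : A h -> [/\ A (p h), (p h).2 = h.2, p h != h & p (p h) = h].
Proof. by move=> hA; have := forallP hp h; rewrite -/(A h) hA => /and4P[? /eqP ? ? /eqP ?]. Qed.

Lemma pairing_out h : ~~ A h -> p h = h.
Proof. by move=> hA; have := forallP hp h; rewrite -/(A h) (negbTE hA) => /eqP. Qed.

Lemma lrel_sym : symmetric (lrel p).
Proof. by move=> l l'; apply: eq_existsb => x; rewrite orbC. Qed.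

Lemma lrel_pair h : lrel p h.1 (p h).1.
Proof. by apply/existsP; exists h.2; rewrite -surjective_pairing eqxx. Qed.

Lemma lrelP l l' : lrel p l l' -> l = l' \/ exists h, [/\ A h, h.1 = l & (p h).1 = l'].
Proof.
case/existsP => x /orP[] /eqP h.
  case: (boolP (A (l, x))) => hA; first by right; exists (l, x).
  by left; move: h; rewrite pairing_out.
case: (boolP (A (l', x))) => hA; last by left; move: h; rewrite pairing_out.
have [h1 _ _ h4] := pairing_in hA.
by right; exists (p (l', x)); rewrite h4; split.
Qed.

Lemma valid_hl_valid h : A h -> V h.1. Proof. by case/and3P. Qed.

Lemma valid_closed : closed (lrel p) V.
Proof.
move=> l l' /lrelP[->//|[h [hA <- <-]]].
by have [hA' _ _ _] := pairing_in hA; rewrite /in_mem /= !valid_hl_valid.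
Qed.

Lemma open_link_connect l l' : connect (lrel p) l l' -> op l = op l'.
Proof.
have cs := sym_connect_sym lrel_sym.
by move=> hc; apply: eq_existsb => l''; rewrite (same_connect cs hc).
Qed.

Definition open_valid : pred link := fun l => V l && op l.
Definition closed_valid : pred link := fun l => V l && ~~ op l.

Lemma open_closed : closed (lrel p) open_valid.
Proof.
move=> l l' h; have := valid_closed h; rewrite /in_mem /= /open_valid => ->.
by rewrite (open_link_connect (connect1 h)).
Qed.

Lemma closed_closed : closed (lrel p) closed_valid.
Proof.
move=> l l' h; have := valid_closed h; rewrite /in_mem /= /closed_valid => ->.
by rewrite (open_link_connect (connect1 h)).
Qed.

Lemma nloops_split : nloops m p = n_comp (lrel p) open_valid + n_comp (lrel p) closed_valid.
Proof.
rewrite /nloops /n_comp_mem -[LHS](cardID op); congr (_ + _); apply: eq_card => l; rewrite !inE /= /in_mem /=.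
  by rewrite /open_valid andbA.
by rewrite /closed_valid andbCA (andbC (~~ _)).
Qed.

Definition compatible (c : {ffun link -> bool}) : bool := [forall h, A h ==> (c (p h).1 == c h.1)].
Definition boundary_true (c : {ffun link -> bool}) : bool :=
  [forall l, (V l ==> bdry_link inner inc l) ==> c l].

(** The color [true] propagates from a boundary link along its open loop, and [boundary_true] also
    forces it on links that are not present; only closed loops keep a free color. *)
Lemma good_coloring c : compatible c && boundary_true c = comp_coloring (lrel p) closed_valid c.
Proof.
apply/andP/comp_coloringP => [[/forallP h1 /forallP h2]|[h1 h2]].
  have hc l l' : lrel p l l' -> c l = c l'.
    by case/lrelP => [->//|[h [hA <- <-]]]; have := h1 h; rewrite hA => /eqP ->.
  split=> [l l' _ /hc //|l]; rewrite negb_and negbK => hl.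
  have hl' : V l ==> op l by rewrite implybE.
  case: (boolP (V l)) => hV; last by have := h2 l; rewrite (negbTE hV).
  move: hl'; rewrite hV /= => /existsP[l' /and3P[v' b' /connectP[s hs e]]].
  have -> : c l = c l'.
    by rewrite e; elim: s l hs {hl hV e} => //= y s IH x /andP[/hc -> /IH].
  by have := h2 l'; rewrite b' implybT.
split.
  apply/forallP => h; apply/implyP => hA.
  case: (boolP (closed_valid h.1)) => hcl; first by rewrite (h1 _ _ hcl (lrel_pair h)).
  have e := closed_closed (lrel_pair h); rewrite /in_mem /= in e.
  by rewrite !h2 // -e.
apply/forallP => l; apply/implyP => hl; apply: h2; rewrite negb_and negbK.
case: (boolP (V l)) hl => //= hV hb; apply/existsP; exists l.
by rewrite -/(V l) hV hb connect0.
Qed.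

Lemma card_good : #|[set c : {ffun link -> bool} | compatible c && boundary_true c]| = 2 ^ n_comp (lrel p) closed_valid.
Proof.
rewrite -(card_comp_coloring lrel_sym closed_closed); apply: eq_card => c.
by rewrite !inE good_coloring.
Qed.

Definition ends (l : link) : nat := (inner (tgt l.1)).+1.

Lemma sum_ends (B : pred link) : (forall l, B l -> V l) ->
  #|[set h : hlink | A h && B h.1]| = \sum_(l | B l) ends l.
Proof.
move=> hB; rewrite -sum1_card (partition_big (fun h : hlink => h.1) B) /=; last first.
  by move=> h; rewrite inE => /andP[].
apply: eq_bigr => l Bl; rewrite sum1_card.
pose E : {set T} := [set x | inc l.1 x && inner x].
rewrite (_ : #|_| = #|[set (l, x) | x in E]|); last first.
  apply: eq_card => -[l' x]; apply/idP/imsetP => [/andP[]|[y]].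
    rewrite inE => /andP[/and3P[h1 _ h3] _] /eqP /= e.
    by exists x; [rewrite inE -e h1 | rewrite e].
  rewrite inE => /andP[h1 h2] [-> ->]; apply/andP; split=> //=.
  by rewrite inE /A /valid_hl /= h1 h2 andbT -/(V l) hB.
rewrite card_imset => [|x y [//]]; rewrite /ends.
have -> : E = src l.1 |: (if inner (tgt l.1) then [set tgt l.1] else set0).
  apply/setP => x; rewrite !inE incE; case: (eqVneq x (src l.1)) => [->|hx] /=; first exact: inner_src.
  case: ifP => ht; rewrite ?inE; case: (eqVneq x (tgt l.1)) => [->|] //=.
rewrite cardsU1; case: ifP => _; first by rewrite inE src_tgt cards1.
by rewrite inE cards0.
Qed.

(** The pairing is an involution without fixed points on the interior ends of [B]; the condition on
    [enum_rank] keeps one end of each pair. *)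
Lemma even_ends (B : pred link) : (forall l, B l -> V l) -> closed (lrel p) B ->
  \sum_(l | B l) ends l = 2 * #|[set h : hlink in [set h | A h && B h.1] | enum_rank h < enum_rank (p h)]|.
Proof.
move=> hB clB; rewrite -sum_ends //; apply: card_involution => h; rewrite inE => /andP[hA hb].
have [h1 _ h3 h4] := pairing_in hA; rewrite inE h1 h3 h4; split=> //.
by have := clB _ _ (lrel_pair h); rewrite /in_mem /= => <-.
Qed.

Lemma ends_bdry l : ends l = 2 - bdry_link inner inc l.
Proof.
rewrite /ends /bdry_link; case: (boolP (inner (tgt l.1))) => h.
  have -> // : [exists y, inc l.1 y && ~~ inner y] = false.
  apply/negbTE/existsP => -[y]; rewrite incE.
  by move=> /andP[/orP[] /eqP ->]; rewrite ?inner_src ?h.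
have -> // : [exists y, inc l.1 y && ~~ inner y].
by apply/existsP; exists (tgt l.1); rewrite incE eqxx orbT h.
Qed.

Lemma closed_ends : \sum_(l | closed_valid l) ends l = 2 * #|closed_valid|.
Proof.
rewrite (eq_bigr (fun=> 2)) => [|l /andP[hV hop]]; first by rewrite sum_nat_const mulnC.
rewrite ends_bdry (_ : bdry_link _ _ _ = false) //; apply/negbTE/negP => hb.
by case/negP: hop; apply/existsP; exists l; rewrite -/(V l) hV hb connect0.
Qed.

(* An open component has a boundary end and, by pairing, an even number of interior
   ends, so it misses at least two of its ends. *)
Lemma open_ends_le : \sum_(l | open_valid l) ends l + 2 * n_comp (lrel p) open_valid <= 2 * #|open_valid|.
Proof.
have cs := sym_connect_sym lrel_sym.
have part (F : link -> nat) : \sum_(l | open_valid l) F l =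
    \sum_(r | [predI roots (lrel p) & open_valid] r) \sum_(l | open_valid l && (root (lrel p) l == r)) F l.
  rewrite (partition_big (root (lrel p)) [predI roots (lrel p) & open_valid]) //= => l hl.
  apply/andP; split; first exact/eqP/root_root.
  by have := closed_connect open_closed (connect_root (lrel p) l); rewrite /in_mem /= hl => <-.
rewrite part -[#|open_valid|]sum1_card [in X in _ <= 2 * X](part (fun=> 1)).
rewrite /n_comp_mem -sum1_card !big_distrr -big_split; apply: leq_sum => r /= /andP[/= hr hop].
set B : pred link := fun l => open_valid l && (root (lrel p) l == r).
have hBV l : B l -> V l by case/andP => /andP[].
have clB : closed (lrel p) B.
  move=> l l' h; have := open_closed h; rewrite /in_mem /= /B => ->.
  by rewrite (rootP cs (connect1 h)).
have hB := even_ends hBV clB; rewrite hB muln1 -mulnSr leq_pmul2l // -(ltn_pmul2l (ltn0Sn 1)) -hB.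
have [l0 [l0B hb]] : exists l0, B l0 /\ bdry_link inner inc l0.
  move: hop => /andP[_ /existsP[l' /and3P[v' b' hc]]]; exists l'; split=> //.
  have ho : op l' by rewrite -(open_link_connect hc); apply/existsP; exists l'; rewrite v' b' hc.
  by rewrite /B /open_valid /V v' ho /= -(rootP cs hc).
rewrite big_distrr /= (bigD1 l0) //= [X in _ < X](bigD1 l0) //= ends_bdry hb.
rewrite -addSn leq_add //; apply: leq_sum => l _.
by rewrite /ends muln1; case: (inner _).
Qed.

(* Rank-nullity over [F_2] for the map sending a coloring to its differences across
   the pairs: its kernel has dimension the number of components. *)
Lemma open_ends_ge : 2 * #|open_valid| <= \sum_(l | open_valid l) ends l + 2 * n_comp (lrel p) open_valid.
Proof.
have hoV l : open_valid l -> V l by case/andP.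
rewrite (even_ends hoV open_closed) -mulnDr leq_pmul2l //.
set R := [set h in _ | _].
rewrite -(leq_exp2l _ _ (ltnSn 1)) expnD.
rewrite -(card_comp_coloring lrel_sym open_closed); set Ker := [set c | _].
pose Phi (c : {ffun link -> bool}) : {ffun hlink -> bool} := [ffun h => (h \in R) && (c h.1 (+) c (p h).1)].
pose D0 : {set {ffun link -> bool}} := [set c | c \in pffun_on true open_valid predT].
have cardD0 : #|D0| = 2 ^ #|open_valid|.
  by rewrite cardsE card_pffun_on card_bool.
pose Y : {set {ffun hlink -> bool}} := [set y | y \in pffun_on false (mem R) predT].
have cardY : #|Y| = 2 ^ #|R| by rewrite cardsE card_pffun_on card_bool.
rewrite -cardD0 -cardY -sum_nat_const.
rewrite -sum1_card (partition_big Phi (mem Y)) /=; last first.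
  move=> c _; rewrite inE; apply/pffun_onP; split; last by move=> ? _.
  by apply/subsetP => h; rewrite inE ffunE; case: (h \in R).
apply: leq_sum => y _; rewrite sum1_card.
have [->|[c0]] : #|[pred c | (c \in D0) && (Phi c == y)]| = 0 \/ exists c0, (c0 \in D0) && (Phi c0 == y).
- case: (pickP [pred c | (c \in D0) && (Phi c == y)]) => [c0 h0|h0]; first by right; exists c0.
  by left; apply: eq_card0.
- by [].
move=> /andP[c0D /eqP c0y].
(* Two elements of a fiber of [Phi] differ by an element of the kernel, so a fiber is no larger than
   [Ker]; the negation gives the difference the forced color [true] off the open links. *)
pose tr (c : {ffun link -> bool}) : {ffun link -> bool} := [ffun l => ~~ (c l (+) c0 l)].
have tr_inj : injective tr.
  move=> c c' h; apply/ffunP => l; have := congr1 (fun f : {ffun link -> bool} => f l) h.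
  by rewrite !ffunE; case: (c l); case: (c' l); case: (c0 l).
rewrite -(card_image tr_inj); apply/subset_leq_card/subsetP => _ /imageP[c /andP[cD /eqP cy] ->].
rewrite inE; apply/comp_coloringP.
have off (d : {ffun link -> bool}) l : d \in D0 -> ~~ open_valid l -> d l.
  rewrite inE => /pffun_onP[/subsetP hd _] hl; apply: contraR hl => hdl.
  by apply: hd; rewrite inE; case: (d l) hdl.
split=> [l l' hl|l hl]; last by rewrite ffunE !off.
have onR h : h \in R -> tr c h.1 = tr c (p h).1.
  move=> hR; have := congr1 (fun f : {ffun hlink -> bool} => f h) (etrans cy (esym c0y)).
  rewrite !ffunE hR /=.
  by case: (c h.1); case: (c _); case: (c0 h.1); case: (c0 _).
case/lrelP => [->//|[h [hA h1 h2]]]; rewrite -h1 -h2.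
have [q1 _ q3 q4] := pairing_in hA.
have oh : open_valid h.1 by rewrite h1.
have oph : open_valid (p h).1 by have := open_closed (lrel_pair h); rewrite /in_mem /= oh => <-.
have : enum_rank h != enum_rank (p h) :> nat.
  by apply: contra q3 => /eqP /ord_inj /enum_rank_inj <-.
rewrite neq_ltn => /orP[hr|hr]; first by apply: onR; rewrite !inE hA oh.
by rewrite -{1}q4; apply/esym/onR; rewrite !inE q1 oph q4.
Qed.

(** Hence the number of open loops is a function of the link numbers alone, and its power of 2 can
    be taken out of the sum over pairings. *)
Lemma loops_identity : 2 * n_comp (lrel p) open_valid + #|[set h : hlink | A h]| = 2 * #|[pred l | V l]|.
Proof.
have hA : #|[set h : hlink | A h]| = \sum_(l | V l) ends l.
  rewrite -(sum_ends (B := V)) //; apply: eq_card => h; rewrite !inE.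
  by case: (boolP (A h)) => // /valid_hl_valid ->.
have h : \sum_(l | open_valid l) ends l + 2 * n_comp (lrel p) open_valid = 2 * #|open_valid|.
  by apply/eqP; rewrite eqn_leq open_ends_le open_ends_ge.
rewrite hA (bigID op) /= addnA (addnC (2 * _)) h closed_ends -mulnDr; congr (2 * _).
rewrite -[RHS](cardID op); congr (_ + _); apply: eq_card => l.
by rewrite !inE /= /in_mem /= /closed_valid; exact: andbC.
Qed.

End Loops.

(** * Finite sums and limits of reals *)

HB.instance Definition _ := Monoid.isComLaw.Build R 0%R Rplus
  (fun x y z => esym (Rplus_assoc x y z)) Rplus_comm Rplus_0_l.
HB.instance Definition _ := Monoid.isComLaw.Build R 1%R Rmult
  (fun x y z => esym (Rmult_assoc x y z)) Rmult_comm Rmult_1_l.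
HB.instance Definition _ := Monoid.isMulLaw.Build R 0%R Rmult Rmult_0_l Rmult_0_r.
HB.instance Definition _ := Monoid.isAddLaw.Build R Rmult Rplus
  Rmult_plus_distr_r Rmult_plus_distr_l.

HB.instance Definition _ := Monoid.isComLaw.Build Z 0%Z Z.add Z.add_assoc Z.add_comm Z.add_0_l.

Declare Scope bigR_scope.
Delimit Scope bigR_scope with bigR.
Notation "\sum_ ( i <- r | P ) F" := (\big[Rplus/0%R]_(i <- r | P%B) F%R) : bigR_scope.
Notation "\sum_ ( i <- r ) F" := (\big[Rplus/0%R]_(i <- r) F%R) : bigR_scope.
Notation "\sum_ ( i | P ) F" := (\big[Rplus/0%R]_(i | P%B) F%R) : bigR_scope.
Notation "\sum_ i F" := (\big[Rplus/0%R]_i F%R) : bigR_scope.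
Notation "\sum_ ( i : t | P ) F" := (\big[Rplus/0%R]_(i : t | P%B) F%R) (only parsing) : bigR_scope.
Notation "\sum_ ( i : t ) F" := (\big[Rplus/0%R]_(i : t) F%R) (only parsing) : bigR_scope.
Notation "\sum_ ( i < n ) F" := (\big[Rplus/0%R]_(i < n%N) F%R) : bigR_scope.
Notation "\prod_ ( i 'in' A ) F" := (\big[Rmult/1%R]_(i in A) F%R) : bigR_scope.
Notation "\sum_ ( m <= i < n ) F" := (\big[Rplus/0%R]_(m%N <= i < n%N) F%R) : bigR_scope.
Notation "\prod_ ( i <- r | P ) F" := (\big[Rmult/1%R]_(i <- r | P%B) F%R) : bigR_scope.
Notation "\prod_ ( i <- r ) F" := (\big[Rmult/1%R]_(i <- r) F%R) : bigR_scope.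
Notation "\prod_ ( i | P ) F" := (\big[Rmult/1%R]_(i | P%B) F%R) : bigR_scope.
Notation "\prod_ i F" := (\big[Rmult/1%R]_i F%R) : bigR_scope.
Notation "\prod_ ( i : t ) F" := (\big[Rmult/1%R]_(i : t) F%R) (only parsing) : bigR_scope.

Local Open Scope R_scope.
Local Open Scope bigR_scope.

Section RealBigops.
Context {I : Type}.
Implicit Types (r : seq I) (P : pred I) (F G : I -> R).

Lemma sumR_ge0 r P F : (forall i, P i -> 0 <= F i) -> 0 <= \sum_(i <- r | P i) F i.
Proof. by move=> h; elim/big_ind: _ => //; [lra | move=> x y; lra]. Qed.

Lemma sumR_le r P F G : (forall i, P i -> F i <= G i) ->
  \sum_(i <- r | P i) F i <= \sum_(i <- r | P i) G i.
Proof. by move=> h; elim/big_ind2: _ => //; [lra | move=> *; lra]. Qed.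

Lemma sumR_abs r P F : Rabs (\sum_(i <- r | P i) F i) <= \sum_(i <- r | P i) Rabs (F i).
Proof.
elim/big_ind2: _ => //; first by rewrite Rabs_R0; lra.
by move=> x1 x2 y1 y2 h1 h2; apply: (Rle_trans _ _ _ (Rabs_triang _ _)); lra.
by move=> *; lra.
Qed.

Lemma sumR_mull r P F x : x * (\sum_(i <- r | P i) F i) = \sum_(i <- r | P i) x * F i.
Proof. exact: big_distrr. Qed.

Lemma sumR_mulr r P F x : (\sum_(i <- r | P i) F i) * x = \sum_(i <- r | P i) F i * x.
Proof. exact: big_distrl. Qed.

Lemma sumR_opp r P F : - (\sum_(i <- r | P i) F i) = \sum_(i <- r | P i) - F i.
Proof. by elim/big_ind2: _ => //; [lra | move=> *; lra]. Qed.

Lemma sumR_sub r P F G : \sum_(i <- r | P i) (F i - G i) =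
  \sum_(i <- r | P i) F i - \sum_(i <- r | P i) G i.
Proof. by rewrite /Rminus sumR_opp big_split. Qed.

Lemma prodR_gt0 r P F : (forall i, P i -> 0 < F i) -> 0 < \prod_(i <- r | P i) F i.
Proof. by move=> h; elim/big_ind: _ => //; [lra | move=> x y; nra]. Qed.

Lemma prodR_ge0 r P F : (forall i, P i -> 0 <= F i) -> 0 <= \prod_(i <- r | P i) F i.
Proof. by move=> h; elim/big_ind: _ => //; [lra | move=> x y; nra]. Qed.

Lemma exp_sum r P F : exp (\sum_(i <- r | P i) F i) = \prod_(i <- r | P i) exp (F i).
Proof. by apply: (big_morph exp) => [x y|]; [exact: exp_plus | exact: exp_0]. Qed.

Lemma INR_sum r P (f : I -> nat) : INR (\sum_(i <- r | P i) f i)%N = \sum_(i <- r | P i) INR (f i).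
Proof. by apply: (big_morph INR) => // x y; rewrite plus_INR. Qed.

Lemma INR_prod r P (f : I -> nat) : INR (\prod_(i <- r | P i) f i)%N = \prod_(i <- r | P i) INR (f i).
Proof. by apply: (big_morph INR) => // x y; rewrite mult_INR. Qed.

Lemma pow_sum r P x (f : I -> nat) : x ^ (\sum_(i <- r | P i) f i)%N = \prod_(i <- r | P i) x ^ (f i).
Proof. by apply: (big_morph (pow x)) => // a b; exact: pow_add. Qed.

End RealBigops.

Lemma sumR_const (I : finType) (A : pred I) x : \sum_(i | A i) x = INR #|A| * x.
Proof.
rewrite big_const; elim: #|A| => [|m IH]; first by rewrite /=; lra.
by rewrite iterS IH S_INR; lra.
Qed.

Lemma prodR_const (I : finType) (A : pred I) x : \prod_(i | A i) x = x ^ #|A|.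
Proof. by rewrite big_const; elim: #|A| => [|m IH] //=; rewrite IH. Qed.

Lemma sumR_const_nat (m n : nat) (x : R) : \sum_(m <= i < n) x = INR (n - m)%N * x.
Proof.
rewrite big_const_nat; elim: (n - m)%N => [|k IH]; first by rewrite /=; lra.
by rewrite iterS IH S_INR; lra.
Qed.

Lemma INR_expn (m k : nat) : INR (m ^ k)%N = INR m ^ k.
Proof. by elim: k => [|k IH] //=; rewrite expnS mult_INR IH. Qed.

Lemma sumR_pos_witness (I : finType) (F : I -> R) i0 :
  (forall i, 0 <= F i) -> 0 < F i0 -> 0 < \sum_i F i.
Proof.
move=> h h0; rewrite (bigD1 i0) //=.
by have := @sumR_ge0 I (index_enum I) (fun i => i != i0) F (fun i _ => h i); lra.
Qed.

Lemma Un_cv_const (x : R) : Un_cv (fun=> x) x.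
Proof. by move=> e he; exists 0%N => m _; rewrite R_dist_eq. Qed.

Lemma Un_cv_sum (I : Type) (r : seq I) (P : pred I) (u : nat -> I -> R) (l : I -> R) :
  (forall i, P i -> Un_cv (fun N => u N i) (l i)) ->
  Un_cv (fun N => \sum_(i <- r | P i) u N i) (\sum_(i <- r | P i) l i).
Proof.
move=> h; elim: r => [|i r IH].
  apply: (Un_cv_ext (fun=> 0)) => [m|]; first by rewrite big_nil.
  by rewrite big_nil; exact: Un_cv_const.
rewrite big_cons; case: (boolP (P i)) => Pi.
  apply: (Un_cv_ext (fun N => u N i + \sum_(j <- r | P j) u N j)) => [m|].
    by rewrite big_cons Pi.
  by apply: CV_plus => //; exact: h.
by apply: Un_cv_ext IH => m; rewrite big_cons (negbTE Pi).
Qed.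

Lemma Un_cv_le (u v : nat -> R) (l m : R) :
  (forall n, u n <= v n) -> Un_cv u l -> Un_cv v m -> l <= m.
Proof.
move=> huv hu hv; case: (Rle_or_lt l m) => // hlt.
have he : 0 < (l - m) / 2 by lra.
have [N1 h1] := hu _ he; have [N2 h2] := hv _ he.
pose N := maxn N1 N2.
have := h1 N (leP (leq_maxl _ _)); have := h2 N (leP (leq_maxr _ _)).
rewrite /R_dist => /Rabs_def2 [? ?] /Rabs_def2 [? ?].
by have := huv N; lra.
Qed.

(** * Ginibre's inequality for clock spins *)

Section PositiveKernels.
Variable S : finType.
Implicit Types K : S -> S -> R.

(* Finite-rank positive semidefinite kernels: closed under sums and products, hence
   partial sums of the exponential preserve them. *)
Definition psd K :=
  exists s : seq (S -> R), forall p q, K p q = \sum_(g <- s) g p * g q.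

Lemma psd_ext K1 K2 : (forall p q, K1 p q = K2 p q) -> psd K1 -> psd K2.
Proof. by move=> h [s hs]; exists s => p q; rewrite -h. Qed.

Lemma psd_sq (g : S -> R) (c : R) : 0 <= c -> psd (fun p q => c * (g p * g q)).
Proof.
move=> hc; exists [:: fun p => sqrt c * g p] => p q; rewrite big_seq1.
by rewrite -{1}(sqrt_sqrt c hc); ring.
Qed.

Lemma psd_const (c : R) : 0 <= c -> psd (fun _ _ => c).
Proof. by move=> hc; apply: psd_ext (psd_sq (fun=> 1) hc) => p q; ring. Qed.

Lemma psd_add K1 K2 : psd K1 -> psd K2 -> psd (fun p q => K1 p q + K2 p q).
Proof. by move=> [s hs] [t ht]; exists (s ++ t) => p q; rewrite big_cat hs ht. Qed.

Lemma psd_mul K1 K2 : psd K1 -> psd K2 -> psd (fun p q => K1 p q * K2 p q).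
Proof.
move=> [s hs] [t ht]; exists [seq (fun p => g p * h p) | g <- s, h <- t] => p q.
rewrite hs ht big_allpairs_dep sumR_mulr; apply: eq_bigr => g _.
by rewrite sumR_mull; apply: eq_bigr => h _; ring.
Qed.

Lemma psd_sum (I : Type) (r : seq I) (P : pred I) (K : I -> S -> S -> R) :
  (forall i, P i -> psd (K i)) -> psd (fun p q => \sum_(i <- r | P i) K i p q).
Proof.
move=> h; elim: r => [|i r IH].
  by exists [::] => p q; rewrite !big_nil.
case: (boolP (P i)) => Pi.
  by apply: psd_ext (psd_add (h i Pi) IH) => p q; rewrite big_cons Pi.
by apply: psd_ext IH => p q; rewrite big_cons (negbTE Pi).
Qed.

Lemma psd_pow K m : psd K -> psd (fun p q => K p q ^ m).
Proof.
move=> h; elim: m => [|m IH]; first by apply: psd_const; lra.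
by apply: psd_ext (psd_mul h IH).
Qed.

Lemma psd_E1 K N : psd K -> psd (fun p q => E1 (K p q) N).
Proof.
move=> h; have term m : psd (fun p q => / INR (fact m) * K p q ^ m).
  apply: psd_mul (psd_const _) (psd_pow m h).
  by apply/Rlt_le/Rinv_0_lt_compat; exact: INR_fact_lt_0.
elim: N => [|N IH]; first by apply: psd_ext (term 0%N).
by apply: psd_ext (psd_add IH (term N.+1)).
Qed.

Lemma psd_ge0 K : psd K -> 0 <= \sum_p \sum_q K p q.
Proof.
move=> [s hs].
have -> : \sum_p \sum_q K p q = \sum_(g <- s) (\sum_p g p) * (\sum_p g p).
  rewrite (eq_bigr (fun p => \sum_(g <- s) \sum_q g p * g q)); last first.
    by move=> p _; rewrite exchange_big; apply: eq_bigr => q _; rewrite hs.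
  rewrite exchange_big; apply: eq_bigr => g _.
  by rewrite sumR_mulr; apply: eq_bigr => p _; rewrite sumR_mull.
by apply: sumR_ge0 => g _; nra.
Qed.

Lemma psd_mul_exp_ge0 K1 K0 :
  psd K1 -> psd K0 -> 0 <= \sum_p \sum_q K1 p q * exp (K0 p q).
Proof.
move=> h1 h0; apply: (@Un_cv_le (fun=> 0) (fun N => \sum_p \sum_q K1 p q * E1 (K0 p q) N)).
- by move=> N; apply: psd_ge0; apply: psd_mul => //; exact: psd_E1.
- exact: Un_cv_const.
- apply: Un_cv_sum => p _; apply: Un_cv_sum => q _.
  by apply: CV_mult; [exact: Un_cv_const | exact: E1_cvg].
Qed.

End PositiveKernels.

(** The group law of ['I_n.+1] matches the addition of angles only modulo [2 * PI]. *)
Definition eq2pi (a b : R) := exists z : Z, a = b + 2 * PI * IZR z.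

Lemma eq2pi_refl a : eq2pi a a. Proof. by exists 0%Z; rewrite Rmult_0_r Rplus_0_r. Qed.
Lemma eq2pi_sym a b : eq2pi a b -> eq2pi b a.
Proof. by move=> [z ->]; exists (- z)%Z; rewrite opp_IZR; ring. Qed.
Lemma eq2pi_trans b a c : eq2pi a b -> eq2pi b c -> eq2pi a c.
Proof. by move=> [z ->] [w ->]; exists (w + z)%Z; rewrite plus_IZR; ring. Qed.
Lemma eq2pi_add a b c d : eq2pi a b -> eq2pi c d -> eq2pi (a + c) (b + d).
Proof. by move=> [z ->] [w ->]; exists (z + w)%Z; rewrite plus_IZR; ring. Qed.
Lemma eq2pi_opp a b : eq2pi a b -> eq2pi (- a) (- b).
Proof. by move=> [z ->]; exists (- z)%Z; rewrite opp_IZR; ring. Qed.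
Lemma eq2pi_sub a b c d : eq2pi a b -> eq2pi c d -> eq2pi (a - c) (b - d).
Proof. by move=> h1 h2; apply: eq2pi_add => //; exact: eq2pi_opp. Qed.
Lemma eq2pi_mulz (z : Z) a b : eq2pi a b -> eq2pi (IZR z * a) (IZR z * b).
Proof. by move=> [w ->]; exists (z * w)%Z; rewrite mult_IZR; ring. Qed.

Lemma cos_eq2pi a b : eq2pi a b -> cos a = cos b.
Proof.
have pos (x : R) (m : nat) : cos (x + 2 * PI * INR m) = cos x.
  by rewrite -(cos_period x m); congr cos; ring.
have hp p : IZR (Z.pos p) = INR (Pos.to_nat p) by rewrite INR_IZR_INZ positive_nat_Z.
move=> [z ->]; case: z => [|p|p].
- by congr cos; ring.
- by rewrite (hp p) pos.
- rewrite -[LHS](pos _ (Pos.to_nat p)) -(hp p); congr cos.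
  by rewrite (_ : Z.neg p = - Z.pos p)%Z ?opp_IZR; first ring.
Qed.

Lemma sin_eq2pi a b : eq2pi a b -> sin a = sin b.
Proof.
move=> h; rewrite -!cos_shift; apply: cos_eq2pi.
by apply: eq2pi_sub => //; exact: eq2pi_refl.
Qed.

Section Clock.
Variable n : nat.
Implicit Types k l : 'I_n.+1.

Definition ang1 k : R := 2 * PI * INR k / INR n.+1.

Lemma ang10 : ang1 0%ring = 0. Proof. by rewrite /ang1 /= /Rdiv; ring. Qed.

Lemma INR_nS_neq0 (m : nat) : INR m.+1 <> 0. Proof. exact: not_0_INR. Qed.

Lemma ang1_mod (m : nat) : eq2pi (2 * PI * INR (m %% n.+1)%N / INR n.+1) (2 * PI * INR m / INR n.+1).
Proof.
apply: eq2pi_sym; exists (Z.of_nat (m %/ n.+1)).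
rewrite -INR_IZR_INZ {1}(divn_eq m n.+1) plus_INR mult_INR.
by field; exact: INR_nS_neq0.
Qed.

Lemma ang1D k l : eq2pi (ang1 (k + l)%ring) (ang1 k + ang1 l).
Proof.
apply: (eq2pi_trans (ang1_mod (k + l)%N)).
by rewrite plus_INR /ang1; exists 0%Z; field; exact: INR_nS_neq0.
Qed.

Lemma ang1N k : eq2pi (ang1 (- k)%ring) (- ang1 k).
Proof.
have := ang1D k (- k)%ring; rewrite GRing.subrr ang10 => h.
have := eq2pi_sub (eq2pi_sym h) (eq2pi_refl (ang1 k)).
by case=> z hz; exists z; lra.
Qed.

Lemma ang1B k l : eq2pi (ang1 (k - l)%ring) (ang1 k - ang1 l).
Proof.
apply: (eq2pi_trans (ang1D k (- l)%ring)).
by apply: eq2pi_add; [exact: eq2pi_refl | exact: ang1N].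
Qed.

End Clock.

Section Configurations.
Variables (V : finType) (n : nat).
Notation conf := {ffun V -> 'I_n.+1}.
Implicit Types (D : pred V) (k l : conf) (z : V -> Z) (a : V -> R).

(* Spins outside [D] are frozen at angle [0]. *)
Definition ang D k : V -> R := fun x => if D x then ang1 (k x) else 0.

Definition dot z a : R := \sum_x IZR (z x) * a x.

Lemma angD D k l x : eq2pi (ang D (k + l)%ring x) (ang D k x + ang D l x).
Proof.
rewrite /ang; case: (D x); first by rewrite ffunE; exact: ang1D.
by exists 0%Z; ring.
Qed.

Lemma angB D k l x : eq2pi (ang D (k - l)%ring x) (ang D k x - ang D l x).
Proof.
rewrite /ang; case: (D x); first by rewrite !ffunE; exact: ang1B.
by exists 0%Z; ring.
Qed.

Lemma dot_eq2pi z a (b : V -> R) : (forall x, eq2pi (a x) (b x)) -> eq2pi (dot z a) (dot z b).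
Proof.
move=> h; rewrite /dot; elim/big_ind2: _ => [|*|x _].
- exact: eq2pi_refl.
- exact: eq2pi_add.
- exact: eq2pi_mulz.
Qed.

Lemma dot_add z a b : dot z (fun x => a x + b x) = dot z a + dot z b.
Proof. by rewrite /dot -big_split; apply: eq_bigr => x _ /=; ring. Qed.

Lemma dot_sub z a b : dot z (fun x => a x - b x) = dot z a - dot z b.
Proof. by rewrite /dot -sumR_sub; apply: eq_bigr => x _ /=; ring. Qed.

Lemma dot_angD D z k l : eq2pi (dot z (ang D (k + l)%ring)) (dot z (ang D k) + dot z (ang D l)).
Proof. by rewrite -dot_add; apply: dot_eq2pi => x; exact: angD. Qed.

Lemma dot_angB D z k l : eq2pi (dot z (ang D (k - l)%ring)) (dot z (ang D k) - dot z (ang D l)).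
Proof. by rewrite -dot_sub; apply: dot_eq2pi => x; exact: angB. Qed.

Hypothesis odd_n : odd n.+1.

Lemma conf_double_inj k l : (k + k = l + l)%ring -> k = l.
Proof.
move=> h; apply/ffunP => x; have := congr1 (fun f : conf => f x) h; rewrite !ffunE => hx.
(* As [n + 1] is odd, [(n + 2) / 2] is an inverse of 2 modulo [n + 1]. *)
have key (u : 'I_n.+1) : u = ((u + u) *+ (n.+2)./2)%ring.
  rewrite -GRing.mulr2n -GRing.mulrnA mul2n halfK (_ : odd n.+2 = false) ?subn0; last by rewrite oddS odd_n.
  rewrite GRing.mulrS (_ : (u *+ n.+1 = 0)%ring) ?GRing.addr0 //.
  by rewrite Zp_mulrn; apply/val_inj; rewrite /= modnMl.
by rewrite (key (k x)) hx -key.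
Qed.

Lemma sum_pairs_rotate (F : conf -> conf -> R) :
  \sum_(k : conf) \sum_(l : conf) F k l =
  \sum_(p : conf) \sum_(q : conf) F (p - q)%ring (p + q)%ring.
Proof.
rewrite !pair_bigA /=.
rewrite (reindex (fun u : conf * conf => ((u.1 - u.2)%ring, (u.1 + u.2)%ring))) //=.
apply/onW_bij/injF_bij => -[p q] [p' q'] /= [h1 h2].
have hp : p = p'.
  apply: conf_double_inj.
  have : (p - q + (p + q) = p' - q' + (p' + q'))%ring by rewrite h1 h2.
  by rewrite ![(_ - _ + (_ + _))%ring]GRing.addrACA !GRing.addNr !GRing.addr0.
by rewrite hp in h2 *; move/GRing.addrI: h2 => ->.
Qed.

Section Core.
Variables (D : pred V) (I : finType) (P : pred I) (z : I -> V -> Z) (b b' c : I -> R).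
Hypothesis hb : forall i, P i -> Rabs (b' i) <= b i.

(** With [P] and [Q] the two dot products, [cos (P - Q) - cos (P + Q + t) = 2 sin (P + t/2) sin (Q +
    t/2)], a kernel of rank one; [psd_plus] is the same with cosines. *)
Lemma psd_diff w t : psd (fun p q : conf =>
  cos (dot w (ang D (p - q)%ring)) - cos (dot w (ang D (p + q)%ring) + t)).
Proof.
have h2 : 0 <= 2 by lra.
apply: psd_ext (psd_sq (fun p : conf => sin (dot w (ang D p) + t / 2)) h2) => p q.
rewrite (cos_eq2pi (dot_angB D w p q)).
rewrite (cos_eq2pi (eq2pi_add (dot_angD D w p q) (eq2pi_refl t))).
rewrite (_ : dot w (ang D p) - _ = (dot w (ang D p) + t / 2) - (dot w (ang D q) + t / 2)); last lra.
rewrite (_ : dot w (ang D p) + dot w (ang D q) + t = (dot w (ang D p) + t / 2) + (dot w (ang D q) + t / 2)); last lra.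
by move: (dot w _ + _) (dot w _ + _) => u v; rewrite cos_minus cos_plus; ring.
Qed.

Lemma psd_plus w t : psd (fun p q : conf =>
  cos (dot w (ang D (p - q)%ring)) + cos (dot w (ang D (p + q)%ring) + t)).
Proof.
have h2 : 0 <= 2 by lra.
apply: psd_ext (psd_sq (fun p : conf => cos (dot w (ang D p) + t / 2)) h2) => p q.
rewrite (cos_eq2pi (dot_angB D w p q)).
rewrite (cos_eq2pi (eq2pi_add (dot_angD D w p q) (eq2pi_refl t))).
rewrite (_ : dot w (ang D p) - _ = (dot w (ang D p) + t / 2) - (dot w (ang D q) + t / 2)); last lra.
rewrite (_ : dot w (ang D p) + dot w (ang D q) + t = (dot w (ang D p) + t / 2) + (dot w (ang D q) + t / 2)); last lra.
by move: (dot w _ + _) (dot w _ + _) => u v; rewrite cos_minus cos_plus; ring.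
Qed.

(** After the rotation, a term [b cos X + b' cos Y] of the exponent is [(b + b') / 2] times
    [cos X + cos Y] plus [(b - b') / 2] times [cos X - cos Y]. Both coefficients are nonnegative
    because [Rabs b' <= b]. *)
Lemma ginibre_core (z0 : V -> Z) (c0 : R) :
  0 <= \sum_(k : conf) \sum_(l : conf) (cos (dot z0 (ang D k)) - cos (dot z0 (ang D l) + c0)) *
     exp (\sum_(i | P i) (b i * cos (dot (z i) (ang D k)) + b' i * cos (dot (z i) (ang D l) + c i))).
Proof.
rewrite sum_pairs_rotate; apply: psd_mul_exp_ge0; first exact: psd_diff.
apply: psd_sum => i Pi.
have [h1 h2] := Rabs_def2 _ _ (Rle_lt_trans _ _ _ (hb Pi) (Rlt_plus_1 (b i))).
have := hb Pi; have := Rle_abs (b' i); have := Rle_abs (- b' i); rewrite Rabs_Ropp => ? ? ?.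
have hs : 0 <= (b i + b' i) / 2 by lra.
have hd : 0 <= (b i - b' i) / 2 by lra.
apply: psd_ext (psd_add (psd_mul (psd_const _ hs) (psd_plus (z i) (c i)))
                        (psd_mul (psd_const _ hd) (psd_diff (z i) (c i)))) => p q /=.
by field.
Qed.

End Core.
End Configurations.

(** * Gibbs means with frozen spins and edge phases *)

Section Means.
Variables (V : finType) (n : nat).
Notation conf := {ffun V -> 'I_n.+1}.
Implicit Types (D : pred V) (k l : conf) (z : V -> Z) (a : V -> R) (b c : V * V -> R) (f : (V -> R) -> R).

Definition energy D b c a : R :=
  \sum_(e : V * V | D e.1 || D e.2) b e * cos (a e.1 - a e.2 + c e).

Definition wt D b c k : R := exp (energy D b c (ang D k)).

Definition pfun D b c : R := \sum_(k : conf) wt D b c k.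

Definition mean D b c f : R := (\sum_(k : conf) f (ang D k) * wt D b c k) / pfun D b c.

Lemma wt_gt0 D b c k : 0 < wt D b c k. Proof. exact: exp_pos. Qed.

Lemma pfun_gt0 D b c : 0 < pfun D b c.
Proof. by apply: (sumR_pos_witness (i0 := [ffun=> ord0])) => [k|]; [exact/Rlt_le/wt_gt0 | exact: wt_gt0]. Qed.

Lemma mean_pfun D b c f : \sum_(k : conf) f (ang D k) * wt D b c k = mean D b c f * pfun D b c.
Proof. by rewrite /mean; field; apply: Rgt_not_eq; exact: pfun_gt0. Qed.

Lemma mean_le D b c f g : (forall k, f (ang D k) <= g (ang D k)) -> mean D b c f <= mean D b c g.
Proof.
move=> h; apply: Rmult_le_compat_r; first exact/Rlt_le/Rinv_0_lt_compat/pfun_gt0.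
by apply: sumR_le => k _; apply: Rmult_le_compat_r (h k); exact/Rlt_le/wt_gt0.
Qed.

Lemma mean_const D b c x : mean D b c (fun=> x) = x.
Proof. by rewrite /mean -sumR_mull /Rdiv Rmult_assoc Rinv_r ?Rmult_1_r //; apply: Rgt_not_eq; exact: pfun_gt0. Qed.

Lemma mean_ext D b c f g : (forall k, f (ang D k) = g (ang D k)) -> mean D b c f = mean D b c g.
Proof. by move=> h; congr (_ / _); apply: eq_bigr => k _; rewrite h. Qed.

Definition edgev (e : V * V) : V -> Z := fun x => ((if x == e.1 then 1 else 0) - (if x == e.2 then 1 else 0))%Z.

Definition pointv (x : V) : V -> Z := fun y => if y == x then 1%Z else 0%Z.

Lemma dot_pointv x a : dot (pointv x) a = a x.
Proof.
rewrite /dot (bigD1 x) //= /pointv eqxx big1 => [|y /negbTE ->]; ring.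
Qed.

Lemma dot_lin z1 z2 (u v : Z) a : dot (fun x => u * z1 x + v * z2 x)%Z a = IZR u * dot z1 a + IZR v * dot z2 a.
Proof.
rewrite /dot !sumR_mull -big_split; apply: eq_bigr => x _ /=.
by rewrite plus_IZR !mult_IZR; ring.
Qed.

Lemma dot_edgev e a : dot (edgev e) a = a e.1 - a e.2.
Proof.
have -> : dot (edgev e) a = dot (fun x => 1 * pointv e.1 x + (-1) * pointv e.2 x)%Z a.
  by apply: eq_bigr => x _; congr (IZR _ * _); rewrite /edgev /pointv; do 2!case: eqP.
by rewrite dot_lin !dot_pointv; lra.
Qed.

Definition glue D k l : conf := [ffun x => if D x then k x else l x].

(* Redistributes the values of [k] and [l] on [D], so that two models with different
   free sets can be compared on the same configurations. *)
Lemma sum_glue D (F : conf -> R) :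
  INR #|{: conf}| * \sum_(k : conf) F k = \sum_(l : conf) \sum_(k : conf) F (glue D k l).
Proof.
rewrite -sumR_const pair_bigA exchange_big pair_bigA /=.
rewrite (reindex (fun u : conf * conf => (glue D u.1 u.2, glue D u.2 u.1))) /=.
  by rewrite [RHS]big_mkcond /= [LHS](reindex (fun u : conf * conf => (u.2, u.1))) /=;
    [apply: eq_bigr => -[] | exists (fun u => (u.2, u.1)) => -[]].
exists (fun u : conf * conf => (glue D u.1 u.2, glue D u.2 u.1)) => -[k l] _ /=;
  by congr (_, _); apply/ffunP => x; rewrite !ffunE; case: (D x).
Qed.

(** Once the values of the second copy outside [D] are fixed, they act on the spins of [D] as the
    extra phases [eta], and edges that avoid [D] contribute the constant [rest]; [ginibre_core] then
    applies to each choice of these values. This compares couplings, free sets and phases at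
    once. *)
Lemma ginibre D D' b b' c z (c0 : R) : odd n.+1 ->
  (forall e, 0 <= b' e <= b e) -> {subset D <= D'} ->
  mean D' b' c (fun a => cos (dot z a + c0)) <= mean D b (fun=> 0) (fun a => cos (dot z a)).
Proof.
move=> on hb hD.
have Zp := pfun_gt0 D b (fun=> 0); have Zp' := pfun_gt0 D' b' c.
set N := INR #|{: conf}|; have Np : 0 < N.
  by apply: lt_0_INR; apply/ltP/card_gt0P; exists [ffun=> ord0].
suff h : 0 <= N * (\sum_(l : conf) \sum_(k : conf)
    (cos (dot z (ang D k)) - cos (dot z (ang D' l) + c0)) * (wt D b (fun=> 0) k * wt D' b' c l)).
  have := mean_pfun D b (fun=> 0) (fun a => cos (dot z a)).
  have := mean_pfun D' b' c (fun a => cos (dot z a + c0)).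
  move: (mean D b _ _) (mean D' b' _ _) => M M' e' e.
  have hs : \sum_(l : conf) \sum_(k : conf)
      (cos (dot z (ang D k)) - cos (dot z (ang D' l) + c0)) * (wt D b (fun=> 0) k * wt D' b' c l)
      = (M - M') * (pfun D b (fun=> 0) * pfun D' b' c).
    rewrite (eq_bigr (fun l => (M * pfun D b (fun=> 0)) * wt D' b' c l -
        cos (dot z (ang D' l) + c0) * wt D' b' c l * pfun D b (fun=> 0))); last first.
      move=> l _; rewrite -e /pfun sumR_mulr sumR_mull -sumR_sub.
      by apply: eq_bigr => k _; ring.
    by rewrite sumR_sub -sumR_mull -/(pfun _ _ _) -sumR_mulr e'; ring.
  rewrite hs in h; case: (Rle_or_lt M' M) => // hlt.
  have : 0 < pfun D b (fun=> 0) * pfun D' b' c by nra.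
  by move=> hp; exfalso; have : 0 < (M' - M) * (pfun D b (fun=> 0) * pfun D' b' c) * N;
    [apply: Rmult_lt_0_compat => //; apply: Rmult_lt_0_compat => //; lra | lra].
rewrite (sum_glue D); apply: sumR_ge0 => l _.
pose eta x := if D x then 0 else ang D' l x.
have hang k x : ang D' (glue D k l) x = ang D k x + eta x.
  rewrite /ang /eta ffunE /ang; case: (boolP (D x)) => hx; last by rewrite Rplus_0_l.
  by have -> : D' x by [exact: hD]; rewrite Rplus_0_r.
pose rest := \sum_(e : V * V | (D' e.1 || D' e.2) && ~~ (D e.1 || D e.2)) b' e * cos (eta e.1 - eta e.2 + c e).
have hen k : energy D' b' c (ang D' (glue D k l)) =
    (\sum_(e : V * V | D e.1 || D e.2) b' e * cos (dot (edgev e) (ang D k) + (eta e.1 - eta e.2 + c e))) + rest.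
  rewrite /energy (bigID (fun e : V * V => D e.1 || D e.2)) /=; congr (_ + _).
    rewrite (eq_bigl (fun e : V * V => D e.1 || D e.2)) => [|e].
      by apply: eq_bigr => e _; rewrite !hang dot_edgev; congr (_ * cos _); ring.
    by apply/andb_idl => /orP[] h; apply/orP; [left | right]; exact: hD.
  apply: eq_bigr => e /andP[_]; rewrite negb_or => /andP[/negbTE h1 /negbTE h2].
  by rewrite !hang /ang h1 h2; congr (_ * cos _); ring.
have := @ginibre_core V n on D _ (fun e : V * V => D e.1 || D e.2) edgev b b'
  (fun e => eta e.1 - eta e.2 + c e) _ z (dot z eta + c0).
have hab e : D e.1 || D e.2 -> Rabs (b' e) <= b e.
  by move=> _; have [h0 h1] := hb e; rewrite Rabs_pos_eq.
move=> /(_ hab) h.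
apply: (Rle_trans _ (exp rest * 0)); first lra.
apply: (Rle_trans _ _ _ (Rmult_le_compat_l _ _ _ (Rlt_le _ _ (exp_pos rest)) h)).
rewrite exchange_big sumR_mull; apply: Req_le; apply: eq_bigr => k _.
rewrite sumR_mull; apply: eq_bigr => k' _.
rewrite /wt hen !exp_plus.
rewrite (_ : dot z (ang D' (glue D k l)) = dot z (ang D k) + dot z eta); last first.
  by rewrite -dot_add; apply: eq_bigr => x _; rewrite hang.
have -> : energy D b (fun=> 0) (ang D k') =
    \sum_(e : V * V | D e.1 || D e.2) b e * cos (dot (edgev e) (ang D k')).
  by apply: eq_bigr => e _; rewrite dot_edgev Rplus_0_r.
by rewrite big_split /= exp_plus (Rplus_assoc (dot z _)); ring.
Qed.

Lemma mean_opp D b c f : mean D b c (fun a => - f a) = - mean D b c f.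
Proof.
rewrite /mean (eq_bigr (fun k => - (f (ang D k) * wt D b c k))) => [|k _]; last ring.
by rewrite -sumR_opp /Rdiv Ropp_mult_distr_l.
Qed.

Lemma mean_add D b c f g : mean D b c (fun a => f a + g a) = mean D b c f + mean D b c g.
Proof.
rewrite /mean -Rmult_plus_distr_r -big_split; congr (_ / _).
by apply: eq_bigr => k _ /=; ring.
Qed.

Lemma mean_scal D b c x f : mean D b c (fun a => x * f a) = x * mean D b c f.
Proof.
rewrite /mean /Rdiv -Rmult_assoc sumR_mull; congr (_ * _).
by apply: eq_bigr => k _ /=; ring.
Qed.

Lemma mean_sum (I : Type) (r : seq I) (P : pred I) D b c (f : I -> (V -> R) -> R) :
  mean D b c (fun a => \sum_(i <- r | P i) f i a) = \sum_(i <- r | P i) mean D b c (f i).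
Proof.
elim: r => [|i r IH]; first by rewrite big_nil -[RHS](mean_const D b c); apply: mean_ext => k; rewrite big_nil.
rewrite big_cons; case: (boolP (P i)) => Pi.
  by rewrite -IH -mean_add; apply: mean_ext => k; rewrite big_cons Pi.
by rewrite -IH; apply: mean_ext => k; rewrite big_cons (negbTE Pi).
Qed.

(** Comparing the model with itself under the phase [PI] gives [- m <= m] for the mean [m]. *)
Lemma griffiths D b z : odd n.+1 -> (forall e, 0 <= b e) ->
  0 <= mean D b (fun=> 0) (fun a => cos (dot z a)).
Proof.
move=> on hb.
have := @ginibre D D b b (fun=> 0) z PI on (fun e => conj (hb e) (Rle_refl _)) (fun x h => h).
rewrite (@mean_ext _ _ _ _ (fun a => - cos (dot z a))) => [|k]; last by rewrite neg_cos.
by rewrite mean_opp; lra.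
Qed.

Lemma polar (x y : R) : x * x + y * y = 1 -> exists t, x = cos t /\ y = sin t.
Proof.
move=> h; have hx : -1 <= x <= 1 by nra.
have hc := cos_acos x hx.
have hs : Rsqr (sin (acos x)) = Rsqr y by have := sin2_cos2 (acos x); rewrite hc /Rsqr; lra.
case: (Rsqr_eq _ _ hs) => h'; first by exists (acos x).
by exists (- acos x); rewrite cos_neg sin_neg; lra.
Qed.

(* Apply [ginibre] after a global phase that aligns [A + i B] with the real axis. *)
Lemma ginibre_modulus D D' b b' c z : odd n.+1 ->
  (forall e, 0 <= b' e <= b e) -> {subset D <= D'} ->
  let A := mean D' b' c (fun a => cos (dot z a)) in
  let B := mean D' b' c (fun a => sin (dot z a)) in
  A * A + B * B <= mean D b (fun=> 0) (fun a => cos (dot z a)) ^ 2.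
Proof.
move=> on hb hD A B; set M := mean D b _ _.
have hM : 0 <= M by apply: griffiths on _ => e; have := hb e; lra.
have key t : cos t * A + sin t * B <= M.
  have := ginibre c z (- t) on hb hD; rewrite -/M.
  rewrite (@mean_ext _ _ _ _ (fun a => cos t * cos (dot z a) + sin t * sin (dot z a))).
    by rewrite mean_add !mean_scal.
  by move=> k; rewrite cos_plus cos_neg sin_neg; ring.
set s := sqrt (A * A + B * B).
have hs : s * s = A * A + B * B by apply: sqrt_sqrt; nra.
have s0 : 0 <= s by exact: sqrt_pos.
case: (Req_dec s 0) => hs0; first by nra.
have [|t [e1 e2]] := @polar (A / s) (B / s).
  rewrite (_ : _ + _ = (A * A + B * B) / (s * s)); last by field.
  by rewrite hs; field; rewrite -hs; nra.
have := key t; rewrite -e1 -e2 (_ : _ + _ = s); last first.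
  by apply: (Rmult_eq_reg_r s) => //; rewrite hs; field.
by rewrite -hs; nra.
Qed.

Lemma mean_abs_le1 D b c f : (forall a, -1 <= f a <= 1) -> -1 <= mean D b c f <= 1.
Proof.
move=> h; split.
  by rewrite -{1}(mean_const D b c (-1)); apply: mean_le => k; have := h (ang D k); lra.
by rewrite -[X in _ <= X](mean_const D b c 1); apply: mean_le => k; have := h (ang D k); lra.
Qed.

Definition twicev (o : V) : V -> Z := fun y => (2 * pointv o y)%Z.

Lemma dot_twicev o a : dot (twicev o) a = 2 * a o.
Proof.
rewrite -dot_pointv /dot sumR_mull; apply: eq_bigr => x _.
by rewrite /twicev mult_IZR; ring.
Qed.

Lemma mean_cos2 D b c o : mean D b c (fun a => cos (2 * a o)) = mean D b c (fun a => cos (dot (twicev o) a)).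
Proof. by apply: mean_ext => k; rewrite dot_twicev. Qed.

Lemma mean_cos2_mono D D' b b' o : odd n.+1 ->
  (forall e, 0 <= b' e <= b e) -> {subset D <= D'} ->
  mean D' b' (fun=> 0) (fun a => cos (2 * a o)) <= mean D b (fun=> 0) (fun a => cos (2 * a o)).
Proof.
move=> on hb hD; rewrite !mean_cos2.
rewrite (@mean_ext _ _ _ _ (fun a => cos (dot (twicev o) a + 0))) => [|k]; last by rewrite Rplus_0_r.
exact: ginibre.
Qed.

End Means.

(** * Invariance of means under embeddings of graphs *)

Section Transfer.
Variables (V W : finType) (n : nat) (io : V -> W) (D : pred V) (E : pred W).
Variables (b : V * V -> R) (b' : W * W -> R).
Hypothesis io_inj : injective io.
Hypothesis io_dom : forall x, E (io x) = D x.
Hypothesis io_edge : forall e, b' (io e.1, io e.2) = b e.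
Hypothesis io_out : forall e, E e.1 || E e.2 -> b' e <> 0 -> (e.1 \in codom io) && (e.2 \in codom io).

Lemma sum_comp_inj (F : {ffun V -> 'I_n.+1} -> R) :
  \sum_(k : {ffun W -> 'I_n.+1}) F [ffun x => k (io x)] =
  INR (n.+1 ^ #|[predC codom io]|) * \sum_(k : {ffun V -> 'I_n.+1}) F k.
Proof.
rewrite (partition_big (fun k : {ffun W -> 'I_n.+1} => [ffun x => k (io x)]) predT) //=.
rewrite sumR_mull; apply: eq_bigr => k _.
rewrite (eq_bigr (fun=> F k)) => [|l /eqP -> //].
rewrite sumR_const; congr (INR _ * _).
pose G (w : W) : pred 'I_n.+1 :=
  fun u => if [pick x | io x == w] is Some x then u == k x else true.
rewrite (_ : #|_| = #|family G|).
  rewrite card_family foldrE big_map big_enum /=.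
  rewrite (bigID (fun w => w \in codom io)) /= big1 => [|w /codomP[x ->]].
    rewrite mul1n (eq_bigr (fun=> n.+1)) => [|w hw]; first by rewrite prod_nat_const.
    rewrite /G; case: pickP => [x /eqP hx|_]; first by rewrite -hx codom_f in hw.
    by rewrite -[RHS]card_ord; apply: eq_card.
  rewrite /G; case: pickP => [y /eqP /io_inj ->|/(_ x)]; last by rewrite eqxx.
  by rewrite -(card1 (k x)); apply: eq_card.
apply: eq_card => l; rewrite !inE; apply/eqP/familyP => [h w|h].
  by rewrite /G unfold_in -h; case: pickP => // x /eqP <-; rewrite ffunE.
apply/ffunP => x; rewrite ffunE; have := h (io x); rewrite /G unfold_in.
by case: pickP => [y /eqP /io_inj -> /eqP|/(_ x)]; last rewrite eqxx.
Qed.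

(** Spins outside the image of [io] interact with nothing that matters, so summing over them gives
    the same power of [n.+1] in numerator and denominator. *)
Lemma mean_transfer (f : (V -> R) -> R) (g : (W -> R) -> R) :
  (forall a, g a = f (fun x => a (io x))) ->
  (forall a1 a2, (forall x, a1 x = a2 x) -> f a1 = f a2) ->
  mean n E b' (fun=> 0) g = mean n D b (fun=> 0) f.
Proof.
move=> hgf fext.
have hang (k : {ffun W -> 'I_n.+1}) x : ang E k (io x) = ang D [ffun x => k (io x)] x.
  by rewrite /ang io_dom ffunE.
have hen (a : W -> R) : energy E b' (fun=> 0) a = energy D b (fun=> 0) (fun x => a (io x)).
  rewrite /energy (bigID (fun e : W * W => (e.1 \in codom io) && (e.2 \in codom io))) /=.
  rewrite [X in _ + X]big1 => [|e /andP[h1 h2]]; last first.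
    by case: (Req_dec (b' e) 0) => [->|/(io_out h1)]; [ring | rewrite (negbTE h2)].
  rewrite Rplus_0_r.
  pose h (e : V * V) := (io e.1, io e.2).
  have hinj : injective h by move=> [x y] [x' y'] [/io_inj -> /io_inj ->].
  rewrite (reindex_omap h (fun e => [pick u | h u == e])); last first.
    move=> [w1 w2] /= /andP[_ /andP[/codomP[x ->] /codomP[y ->]]].
    by case: pickP => [u /eqP /= <-|/(_ (x, y))]; last rewrite eqxx.
  apply: eq_big => [e|e _]; last by rewrite /h /= io_edge.
  rewrite /h /= !io_dom !codom_f andbT; case: (_ || _) => //=.
  case: pickP => [u /eqP hu|/(_ e)]; last by rewrite eqxx.
  by rewrite (hinj u e hu) eqxx.
rewrite /mean /pfun.
have hw (k : {ffun W -> 'I_n.+1}) : wt E b' (fun=> 0) k = wt D b (fun=> 0) [ffun x => k (io x)].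
  rewrite /wt hen; congr exp; apply: eq_bigr => e _; by rewrite !hang.
have -> : \sum_(k : {ffun W -> 'I_n.+1}) g (ang E k) * wt E b' (fun=> 0) k =
    INR (n.+1 ^ #|[predC codom io]|) *
      \sum_(k : {ffun V -> 'I_n.+1}) f (ang D k) * wt D b (fun=> 0) k.
  rewrite -sum_comp_inj; apply: eq_bigr => k _.
  by rewrite hgf hw (fext _ (ang D [ffun x => k (io x)])).
rewrite (eq_bigr _ (fun k _ => hw k)) (sum_comp_inj (wt D b (fun=> 0))).
field; split.
  by apply: Rgt_not_eq; exact: pfun_gt0.
by apply: not_0_INR; apply/eqP; rewrite -lt0n expn_gt0.
Qed.
End Transfer.

(** * Schwinger-Dyson inequalities and spin rotations *)

Lemma abs_sin_le (u : R) : Rabs (sin u) <= Rabs u.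
Proof.
have pos v : 0 <= v -> Rabs (sin v) <= v.
  move=> hv; case: (Req_dec v 0) => [->|hv0]; first by rewrite sin_0 Rabs_R0; lra.
  have h1 : sin v < v by apply: sin_lt_x; lra.
  case: (Rle_or_lt v 1) => h; last by have := SIN_bound v => ?; apply: Rabs_le; lra.
  have ? : 0 <= sin v by apply: sin_ge_0 => //; have := PI2_1; lra.
  by rewrite Rabs_pos_eq //; lra.
case: (Rle_or_lt 0 u) => h; first by rewrite (Rabs_pos_eq u) //; exact: pos.
by rewrite -(Rabs_Ropp u) -(Rabs_Ropp (sin u)) -sin_neg (Rabs_pos_eq (- u)); [apply: pos; lra | lra].
Qed.

Lemma cos_ge_quadratic (u : R) : 1 - u ^ 2 / 2 <= cos u <= 1.
Proof.
split; last by have := COS_bound u; lra.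
rewrite {2}(_ : u = 2 * (u / 2)); last by field.
rewrite cos_2a_sin.
have := abs_sin_le (u / 2); have := Rabs_pos (sin (u / 2)).
have e1 := Rsqr_abs (sin (u / 2)); have e2 := Rsqr_abs (u / 2).
rewrite /Rsqr in e1 e2; nra.
Qed.

Lemma between_abs (u v : R) : Rmin 0 u <= v <= Rmax 0 u -> Rabs v <= Rabs u.
Proof.
case: (Rle_or_lt 0 u) => h.
  by rewrite Rmin_left // Rmax_right // => ?; rewrite !Rabs_pos_eq; lra.
by rewrite Rmin_right ?Rmax_left => [||]; try lra; move=> ?; rewrite !Rabs_left1; lra.
Qed.

Lemma exp_le (u v : R) : u <= v -> exp u <= exp v.
Proof. by move=> h; case: (Rle_lt_or_eq_dec _ _ h) => [?|->]; [exact/Rlt_le/exp_increasing | lra]. Qed.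

Lemma cos_expand (t u : R) : Rabs (cos (t + u) - cos t + u * sin t) <= 2 * u ^ 2.
Proof.
have h1 : Rabs (cos u - 1) <= u ^ 2.
  by have := cos_ge_quadratic u => ?; apply: Rabs_le; nra.
have h2 : Rabs (sin u - u) <= u ^ 2.
  have [v [hv1 hv2]] := MVT_abs (fun x => sin x - x) (fun x => cos x - 1) 0 u
    (fun c _ => derivable_pt_lim_minus _ _ _ _ _ (derivable_pt_lim_sin c) (derivable_pt_lim_id c)).
  have {hv1} : Rabs (sin u - u) = Rabs (cos v - 1) * Rabs u.
    by rewrite sin_0 !Rminus_0_r in hv1.
  move=> ->.
  have hvu := between_abs hv2.
  have : Rabs (cos v - 1) <= Rabs v.
    have -> : cos v - 1 = -2 * (sin (v / 2) * sin (v / 2)).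
      by rewrite {1}(_ : v = 2 * (v / 2)) ?cos_2a_sin; field.
    rewrite Rabs_mult Rabs_left; last lra.
    rewrite Rabs_mult.
    have := abs_sin_le (v / 2); rewrite /Rdiv (Rabs_mult v) (Rabs_pos_eq (/ 2)); last lra.
    have : Rabs (sin (v * / 2)) <= 1 by have := SIN_bound (v * / 2) => ?; apply: Rabs_le; lra.
    by have := Rabs_pos (sin (v * / 2)); nra.
  have e2 := Rsqr_abs u; rewrite /Rsqr in e2.
  by have := Rabs_pos u; have := Rabs_pos (cos v - 1); nra.
rewrite cos_plus (_ : _ + _ = cos t * (cos u - 1) + - sin t * (sin u - u)); last ring.
apply: (Rle_trans _ _ _ (Rabs_triang _ _)).
rewrite !Rabs_mult Rabs_Ropp.
have ? : Rabs (sin t) <= 1 by have := SIN_bound t => ?; apply: Rabs_le; lra.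
have ? : Rabs (cos t) <= 1 by have := COS_bound t => ?; apply: Rabs_le; lra.
have := Rabs_pos (cos t); have := Rabs_pos (sin t).
by have := Rabs_pos (cos u - 1); have := Rabs_pos (sin u - u); nra.
Qed.

Lemma exp_expand (u : R) : Rabs (exp u - 1 - u) <= u ^ 2 * exp (Rabs u).
Proof.
have mvt w : exists v, Rabs (exp w - 1) = exp v * Rabs w /\ Rabs v <= Rabs w /\ exp v <= exp (Rabs w).
  have [v [h1 h2]] := MVT_abs exp exp 0 w (fun c _ => derivable_pt_lim_exp c).
  exists v; rewrite exp_0 Rminus_0_r (Rabs_pos_eq (exp v)) in h1; last exact/Rlt_le/exp_pos.
  have hv := between_abs h2; do 2!split => //.
  by apply: exp_le; have := Rle_abs v; lra.
have [v [h1 h2]] := MVT_abs (fun x => exp x - x) (fun x => exp x - 1) 0 u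
    (fun c _ => derivable_pt_lim_minus _ _ _ _ _ (derivable_pt_lim_exp c) (derivable_pt_lim_id c)).
have {h1} -> : Rabs (exp u - 1 - u) = Rabs (exp v - 1) * Rabs u.
  by rewrite exp_0 !Rminus_0_r in h1; rewrite -h1; congr Rabs; ring.
have hvu := between_abs h2.
have [y [-> [_ hy]]] := mvt v.
have hexp := exp_le hvu.
have e2 := Rsqr_abs u; rewrite /Rsqr in e2.
have -> : u ^ 2 = Rabs u * Rabs u by rewrite -e2; ring.
have := Rabs_pos u; have := Rabs_pos v; have := exp_pos y => ? ? ?.
apply: (Rle_trans _ (exp (Rabs u) * Rabs u * Rabs u)); last lra.
apply: Rmult_le_compat_r => //; apply: Rmult_le_compat => //; lra.
Qed.

(* Uniform second-order expansion at 0 of a family of functions; the single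
   constant makes the estimates uniform in the index, in particular in the
   number of states of the clock. *)
Section Expandable.
Variable X : Type.
Implicit Types (F G : X -> R -> R).

Definition expandable F (F1 : X -> R) := exists2 C, 0 <= C & forall x h, 0 <= h <= 1 ->
  [/\ Rabs (F x 0) <= C, Rabs (F1 x) <= C & Rabs (F x h - F x 0 - h * F1 x) <= C * h ^ 2].

Lemma expandable_const (c : R) : expandable (fun _ _ => c) (fun=> 0).
Proof.
exists (Rabs c); first exact: Rabs_pos.
move=> x h hh; rewrite !Rabs_R0; split; [lra | exact: Rabs_pos |].
by rewrite (_ : _ - _ = 0) ?Rabs_R0; [have := Rabs_pos c; nra | ring].
Qed.

Lemma expandable_add F (F1 : X -> R) G (G1 : X -> R) : expandable F F1 -> expandable G G1 ->
  expandable (fun x h => F x h + G x h) (fun x => F1 x + G1 x).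
Proof.
move=> [C C0 hC] [E E0 hE]; exists (C + E); first lra.
move=> x h hh; have [a1 a2 a3] := hC x h hh; have [b1 b2 b3] := hE x h hh; split.
- by apply: (Rle_trans _ _ _ (Rabs_triang _ _)); lra.
- by apply: (Rle_trans _ _ _ (Rabs_triang _ _)); lra.
- rewrite (_ : _ - _ = (F x h - F x 0 - h * F1 x) + (G x h - G x 0 - h * G1 x)); last ring.
  by apply: (Rle_trans _ _ _ (Rabs_triang _ _)); lra.
Qed.

Lemma expandable_mul F (F1 : X -> R) G (G1 : X -> R) : expandable F F1 -> expandable G G1 ->
  expandable (fun x h => F x h * G x h) (fun x => F1 x * G x 0 + F x 0 * G1 x).
Proof.
move=> [C C0 hC] [E E0 hE]; exists (6 * (C + 1) * (E + 1)); first nra.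
move=> x h hh; have [a1 a2 a3] := hC x h hh; have [b1 b2 b3] := hE x h hh.
have p := Rabs_pos.
have hb u v : Rabs u <= C -> Rabs v <= E -> Rabs (u * v) <= C * E.
  by move=> hu hv; rewrite Rabs_mult; apply: Rmult_le_compat => //; exact: p.
have CE : 0 <= C * E by nra.
have hK : C * E + C * E <= 6 * (C + 1) * (E + 1) by nra.
split.
- by have := hb _ _ a1 b1; lra.
- apply: (Rle_trans _ _ _ (Rabs_triang _ _)).
  by have := hb _ _ a2 b1; have := hb _ _ a1 b2; lra.
set r := F x h - F x 0 - h * F1 x in a3; set s := G x h - G x 0 - h * G1 x in b3.
have -> : F x h * G x h - F x 0 * G x 0 - h * (F1 x * G x 0 + F x 0 * G1 x) =
   F x h * s + r * (G x 0 + h * G1 x) + h ^ 2 * (F1 x * G1 x) by rewrite /r /s; ring.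
have hF : Rabs (F x h) <= 3 * C.
  rewrite (_ : F x h = r + F x 0 + h * F1 x); last by rewrite /r; ring.
  apply: (Rle_trans _ _ _ (Rabs_triang _ _)).
  apply: (Rle_trans _ _ _ (Rplus_le_compat_r _ _ _ (Rabs_triang _ _))).
  have h2 : C * h ^ 2 <= C * 1 by apply: Rmult_le_compat_l => //; nra.
  by rewrite Rabs_mult (Rabs_pos_eq h); [have := p (F1 x); nra | lra].
have hG : Rabs (G x 0 + h * G1 x) <= 2 * E.
  apply: (Rle_trans _ _ _ (Rabs_triang _ _)).
  by rewrite Rabs_mult (Rabs_pos_eq h); [have := p (G1 x); nra | lra].
apply: (Rle_trans _ _ _ (Rabs_triang _ _)).
apply: (Rle_trans _ _ _ (Rplus_le_compat_r _ _ _ (Rabs_triang _ _))).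
rewrite (Rabs_mult (F x h)) (Rabs_mult r) (Rabs_mult (h ^ 2)) (Rabs_mult (F1 x)) (Rabs_pos_eq (h ^ 2)); last nra.
have h20 : 0 <= h ^ 2 by nra.
have t1 : Rabs (F x h) * Rabs s <= 3 * C * (E * h ^ 2) by apply: Rmult_le_compat => //; exact: p.
have t2 : Rabs r * Rabs (G x 0 + h * G1 x) <= C * h ^ 2 * (2 * E) by apply: Rmult_le_compat => //; exact: p.
have t3 : Rabs (F1 x) * Rabs (G1 x) <= C * E by apply: Rmult_le_compat => //; exact: p.
have t4 : h ^ 2 * (Rabs (F1 x) * Rabs (G1 x)) <= h ^ 2 * (C * E) by apply: Rmult_le_compat_l.
have : 0 <= C * h ^ 2 by nra.
have : 0 <= E * h ^ 2 by nra.
by nra.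
Qed.

Lemma expandable_sum (I : Type) (r : seq I) (P : pred I) (F : I -> X -> R -> R) (F1 : I -> X -> R) :
  (forall i, P i -> expandable (F i) (F1 i)) ->
  expandable (fun x h => \sum_(i <- r | P i) F i x h) (fun x => \sum_(i <- r | P i) F1 i x).
Proof.
move=> hF; elim: r => [|i r [C C0 hC]].
  have [C C0 hC] := expandable_const 0; exists C => // x h /hC; rewrite !big_nil; exact.
case: (boolP (P i)) => Pi.
  have [E E0 hE] := expandable_add (hF i Pi) (ex_intro2 _ _ C C0 hC).
  by exists E => // x h /(hE x h); rewrite !big_cons Pi.
by exists C => // x h /(hC x h); rewrite !big_cons (negbTE Pi).
Qed.

Lemma expandable_cos (t : X -> R) (m : R) :
  expandable (fun x h => cos (t x + m * h)) (fun x => - m * sin (t x)).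
Proof.
exists (1 + Rabs m + 2 * m ^ 2); first by have := Rabs_pos m; nra.
move=> x h hh; rewrite Rmult_0_r Rplus_0_r.
have hs : Rabs (sin (t x)) <= 1 by have := SIN_bound (t x) => ?; apply: Rabs_le; lra.
have hc : Rabs (cos (t x)) <= 1 by have := COS_bound (t x) => ?; apply: Rabs_le; lra.
have := Rabs_pos m => hm; have := Rabs_pos (sin (t x)) => ?; split; first nra.
  by rewrite Rabs_mult Rabs_Ropp; nra.
rewrite (_ : _ - _ = cos (t x + m * h) - cos (t x) + m * h * sin (t x)); last ring.
by apply: (Rle_trans _ _ _ (cos_expand _ _)); nra.
Qed.

Lemma expandable_sin (t : X -> R) (m : R) :
  expandable (fun x h => sin (t x + m * h)) (fun x => m * cos (t x)).
Proof.
have [C C0 hC] := expandable_cos (fun x => t x - PI / 2) m.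
have hs u : cos (u - PI / 2) = sin u.
  by rewrite -(cos_neg (u - _)) -cos_shift; congr cos; ring.
have hs' u : sin (u - PI / 2) = - cos u.
  by rewrite -(Ropp_involutive (sin _)) -sin_neg (_ : - (u - PI / 2) = PI / 2 - u) ?sin_shift //; ring.
exists C => // x h /(hC x h); rewrite hs'.
have e v : t x - PI / 2 + v = t x + v - PI / 2 by ring.
by rewrite !e !hs (_ : - m * - cos (t x) = m * cos (t x)) //; ring.
Qed.

Lemma expandable_exp F (F1 : X -> R) : expandable F F1 ->
  expandable (fun x h => exp (F x h)) (fun x => exp (F x 0) * F1 x).
Proof.
move=> [C C0 hC]; set K := exp C * (1 + C + (2 * C) ^ 2 * exp (2 * C)).
have eC := exp_pos C; have e2C := exp_pos (2 * C).
have t0 : 0 <= C * C * exp (2 * C) by apply: Rmult_le_pos; nra.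
have K1 : exp C <= K by rewrite /K; nra.
have K2 : exp C * C <= K by rewrite /K; nra.
exists K; first lra.
move=> x h hh; have [a1 a2 a3] := hC x h hh.
have hF0 : exp (F x 0) <= exp C by apply: exp_le; have := Rle_abs (F x 0); lra.
have F0p := exp_pos (F x 0); have F1p := Rabs_pos (F1 x).
rewrite Rabs_mult !(Rabs_pos_eq (exp (F x 0))); try lra.
split; [lra | by apply: Rle_trans K2; apply: Rmult_le_compat; lra |].
set r := F x h - F x 0 - h * F1 x in a3; set d := h * F1 x + r.
have hd : Rabs d <= 2 * C * h.
  apply: (Rle_trans _ _ _ (Rabs_triang _ _)).
  have h2 : C * h ^ 2 <= C * h by apply: Rmult_le_compat_l => //; nra.
  by rewrite Rabs_mult (Rabs_pos_eq h); [nra | lra].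
have -> : exp (F x h) - exp (F x 0) - h * (exp (F x 0) * F1 x) = exp (F x 0) * ((exp d - 1 - d) + r).
  by rewrite (_ : F x h = F x 0 + d) ?exp_plus /d /r; ring.
rewrite Rabs_mult (Rabs_pos_eq (exp (F x 0))); last lra.
have hx : Rabs (exp d - 1 - d) <= (2 * C) ^ 2 * h ^ 2 * exp (2 * C).
  apply: (Rle_trans _ _ _ (exp_expand d)); apply: Rmult_le_compat; [nra | exact/Rlt_le/exp_pos | |].
    by have e2 := Rsqr_abs d; rewrite /Rsqr in e2; have := Rabs_pos d; nra.
  by apply: exp_le; nra.
apply: (Rle_trans _ (exp C * (((2 * C) ^ 2 * exp (2 * C) + C) * h ^ 2))).
  apply: Rmult_le_compat => //; [lra | exact: Rabs_pos |].
  by apply: (Rle_trans _ _ _ (Rabs_triang _ _)); lra.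
by rewrite -Rmult_assoc; apply: Rmult_le_compat_r; [nra | rewrite /K; nra].
Qed.

End Expandable.

(** * Approximate integration by parts for clock spins *)

Section SchwingerDyson.
Variables (V : finType) (D : pred V) (b : V * V -> R).

(** The weight per configuration is bounded below uniformly in [n], so an error of order [h ^ 2] per
    configuration keeps that order after division by the partition function. *)
Lemma pfun_lower n :
  INR #|{: {ffun V -> 'I_n.+1}}| * exp (- \sum_(e : V * V) Rabs (b e)) <= pfun n D b (fun=> 0).
Proof.
rewrite -sumR_const; apply: sumR_le => k _; apply: exp_le.
apply: (Rle_trans _ (- \sum_(e : V * V | D e.1 || D e.2) Rabs (b e))).
  apply: Ropp_le_contravar.
  rewrite [X in _ <= X](bigID (fun e : V * V => D e.1 || D e.2)) /= -[X in X <= _]Rplus_0_r.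
  by apply: Rplus_le_compat_l; apply: sumR_ge0 => e _; exact: Rabs_pos.
rewrite sumR_opp; apply: sumR_le => e _.
have := COS_bound (ang D k e.1 - ang D k e.2 + 0); rewrite /Rabs; case: Rcase_abs; nra.
Qed.

Variables (z : V -> Z) (x : V).
Hypothesis Dx : D x.

(* The derivative of [sin (dot z a)] times the Gibbs weight in the angle [a x]. *)
Definition sd_obs (a : V -> R) : R := IZR (z x) * cos (dot z a) -
  sin (dot z a) * \sum_(e : V * V | D e.1 || D e.2) b e * (IZR (edgev e x) * sin (a e.1 - a e.2)).

(** Configurations for all [n] form one index type, so that a single constant of [expandable] serves
    every [n]. *)
Let X := {n : nat & {ffun V -> 'I_n.+1}}.
Let A (u : X) : V -> R := ang D (projT2 u).
Let Phi (u : X) (h : R) : R := sin (dot z (A u) + IZR (z x) * h) *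
  exp (\sum_(e : V * V | D e.1 || D e.2) b e * cos (dot (edgev e) (A u) + IZR (edgev e x) * h)).

Let Phi0 n (k : {ffun V -> 'I_n.+1}) :
  Phi (existT _ n k) 0 = sin (dot z (ang D k)) * wt D b (fun=> 0) k.
Proof.
rewrite /Phi Rmult_0_r Rplus_0_r /A /=; congr (_ * exp _); apply: eq_bigr => e _.
by rewrite Rmult_0_r Rplus_0_r dot_edgev Rplus_0_r.
Qed.

Let expandable_Phi : expandable Phi (fun u : X => sd_obs (A u) * wt D b (fun=> 0) (projT2 u)).
Proof.
have [C C0 hC] := expandable_mul (expandable_sin (fun u => dot z (A u)) (IZR (z x)))
  (expandable_exp (expandable_sum (index_enum (V * V)%type) (P := fun e => D e.1 || D e.2)
    (fun e _ => expandable_mul (expandable_const X (b e))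
       (expandable_cos (fun u => dot (edgev e) (A u)) (IZR (edgev e x)))))).
exists C => // u h /(hC u h) [h1 h2 h3].
have e1 : sd_obs (A u) * wt D b (fun=> 0) (projT2 u) =
  IZR (z x) * cos (dot z (A u)) *
       exp (\sum_(e : V * V | D e.1 || D e.2) b e * cos (dot (edgev e) (A u) + IZR (edgev e x) * 0)) +
       sin (dot z (A u) + IZR (z x) * 0) *
       (exp (\sum_(e : V * V | D e.1 || D e.2) b e * cos (dot (edgev e) (A u) + IZR (edgev e x) * 0)) *
        \sum_(e : V * V | D e.1 || D e.2)
           (0 * cos (dot (edgev e) (A u) + IZR (edgev e x) * 0) +
            b e * (- IZR (edgev e x) * sin (dot (edgev e) (A u))))).
  have -> : exp (\sum_(e : V * V | D e.1 || D e.2) b e * cos (dot (edgev e) (A u) + IZR (edgev e x) * 0))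
     = wt D b (fun=> 0) (projT2 u).
    by congr exp; apply: eq_bigr => e _; rewrite Rmult_0_r Rplus_0_r dot_edgev Rplus_0_r.
  have -> : \sum_(e : V * V | D e.1 || D e.2)
           (0 * cos (dot (edgev e) (A u) + IZR (edgev e x) * 0) +
            b e * (- IZR (edgev e x) * sin (dot (edgev e) (A u)))) =
      - \sum_(e : V * V | D e.1 || D e.2) b e * (IZR (edgev e x) * sin (A u e.1 - A u e.2)).
    by rewrite sumR_opp; apply: eq_bigr => e _; rewrite dot_edgev; ring.
  by rewrite Rmult_0_r Rplus_0_r /sd_obs; ring.
by split; rewrite ?e1.
Qed.

Let shift_Phi n : (0 < n)%N ->
  \sum_(k : {ffun V -> 'I_n.+1}) Phi (existT _ n k) (2 * PI / INR n.+1) =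
  \sum_(k : {ffun V -> 'I_n.+1}) Phi (existT _ n k) 0.
Proof.
move=> n0; pose d : {ffun V -> 'I_n.+1} := [ffun y => if y == x then inord 1 else 0%ring].
rewrite [RHS](reindex (fun k : {ffun V -> 'I_n.+1} => (k + d)%ring)) /=; last first.
  by exists (fun k : {ffun V -> 'I_n.+1} => (k - d)%ring) => k _; [exact: GRing.addrK | exact: GRing.subrK].
apply: eq_bigr => k _; rewrite Phi0 /Phi /A /=.
have hd (w : V -> Z) : eq2pi (dot w (ang D (k + d)%ring)) (dot w (ang D k) + IZR (w x) * (2 * PI / INR n.+1)).
  apply: (eq2pi_trans (dot_angD D w k d)); apply: eq2pi_add; first exact: eq2pi_refl.
  rewrite /dot (bigD1 x) //= big1 => [|y hy].
    rewrite /ang Dx /d ffunE eqxx Rplus_0_r /ang1 inordK // INR_1 Rmult_1_r; exact: eq2pi_refl.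
  by rewrite /ang /d ffunE (negbTE hy) ang10; case: (D y); ring.
rewrite (sin_eq2pi (hd z)) /wt; congr (_ * exp _); apply: eq_bigr => e _.
rewrite Rplus_0_r -[_ - _](dot_edgev e (ang D (k + d)%ring)).
by rewrite (cos_eq2pi (hd (edgev e))).
Qed.

(* Shifting the spin [x] by one step [2 pi / (n+1)] permutes the configurations, so
   the first-order variation vanishes up to [O(1/n)]. *)
Lemma schwinger_dyson : exists2 C, 0 <= C & forall n, (7 < n.+1)%N ->
  Rabs (mean n D b (fun=> 0) sd_obs) <= C / INR n.+1.
Proof.
have [C C0 hC] := expandable_Phi.
set B := \sum_(e : V * V) Rabs (b e).
have PI0 := PI_RGT_0; have eB0 := exp_pos B.
exists (C * (2 * PI) * exp B); first by apply: Rmult_le_pos; [apply: Rmult_le_pos => // |]; lra.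
move=> n hn; set h := 2 * PI / INR n.+1.
have n0 : 0 < INR n.+1 by apply: lt_0_INR; apply/ltP.

have h0 : 0 < h by apply: Rdiv_lt_0_compat => //; lra.
(* The assumption [7 < n.+1] serves here: [2 * PI <= 8] brings the step [h] into the range of
   [expandable]. *)
have h1 : h <= 1.
  apply: (Rmult_le_reg_r (INR n.+1)) => //; rewrite Rmult_1_l /h.
  rewrite (_ : 2 * PI / _ * _ = 2 * PI); last by field; lra.
  have : INR 8 <= INR n.+1 by apply: le_INR; apply/leP.
  rewrite (_ : INR 8 = 8); last by rewrite /=; ring.
  by have := PI_4; lra.
set O := \sum_(k : {ffun V -> 'I_n.+1}) sd_obs (ang D k) * wt D b (fun=> 0) k.
set N := INR #|{: {ffun V -> 'I_n.+1}}|.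
have Np : 0 < N by apply: lt_0_INR; apply/ltP/card_gt0P; exists [ffun=> ord0].
have hO : Rabs (h * O) <= N * (C * h ^ 2).
  rewrite -Rabs_Ropp (_ : - (h * O) = \sum_(k : {ffun V -> 'I_n.+1})
     (Phi (existT _ n k) h - Phi (existT _ n k) 0 - h * (sd_obs (ang D k) * wt D b (fun=> 0) k))).
    apply: (Rle_trans _ _ _ (sumR_abs _ _ _)); rewrite -sumR_const; apply: sumR_le => k _.
    by have [] := hC (existT _ n k) h (conj (Rlt_le _ _ h0) h1).
  rewrite !sumR_sub shift_Phi; last by case: (n) hn.
  by rewrite /O sumR_mull; move: (\sum_k Phi _ 0) => u; lra.
have hZ := pfun_lower n; rewrite -/B -/N in hZ.
have Zp := pfun_gt0 n D b (fun=> 0).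
have eB := exp_pos B; have hEB : exp (- B) * exp B = 1 by rewrite -exp_plus Rplus_opp_l exp_0.
rewrite /mean -/O Rabs_mult (Rabs_pos_eq (/ _)); last exact/Rlt_le/Rinv_0_lt_compat.
apply: (Rmult_le_reg_r (pfun n D b (fun=> 0))) => //.
rewrite Rmult_assoc Rinv_l ?Rmult_1_r; last lra.
have hO' : Rabs O <= N * C * h.
  rewrite Rabs_mult (Rabs_pos_eq h) in hO; last lra.
  by apply: (Rmult_le_reg_l h) => //; lra.
apply: (Rle_trans _ _ _ hO').
have -> : C * (2 * PI) * exp B / INR n.+1 * pfun n D b (fun=> 0) = C * h * (exp B * pfun n D b (fun=> 0)).
  by rewrite /h; field; lra.
rewrite (Rmult_comm N) Rmult_assoc (Rmult_comm N) -(Rmult_assoc C); apply: Rmult_le_compat_l; first nra.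
by nra.
Qed.
End SchwingerDyson.

(** * Decay at high temperature *)

Section HighTemperature.
Variables (V : finType) (D : pred V) (b : V * V -> R) (o : V).
Hypothesis b_ge0 : forall e, 0 <= b e.
Hypothesis b_sym : forall x y, b (x, y) = b (y, x).

Lemma sum_incident (F : V * V -> R) x : D x ->
  \sum_(e : V * V | D e.1 || D e.2) F e * IZR (edgev e x) = \sum_y F (x, y) - \sum_y F (y, x).
Proof.
move=> Dx; rewrite big_mkcond /=.
rewrite (eq_bigr (fun e => F e * (if x == e.1 then 1 else 0) - F e * (if x == e.2 then 1 else 0))); last first.
  move=> e _; rewrite /edgev minus_IZR.
  case: (D e.1 || D e.2) / boolP => [_|]; first by case: ifP; case: ifP; lra.
  rewrite negb_or => /andP[h1 h2].
  have /negbTE -> : x != e.1 by apply: contraNneq h1 => <-.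
  have /negbTE -> : x != e.2 by apply: contraNneq h2 => <-.
  by lra.
have part (G : V * V -> R) : \sum_(e : V * V) G e * (if x == e.1 then 1 else 0) = \sum_y G (x, y).
  rewrite (eq_bigr (fun e => G (e.1, e.2) * (if x == e.1 then 1 else 0))) => [|[u v] _ //].
  rewrite -(pair_bigA _ (fun u v => G (u, v) * (if x == u then 1 else 0))) (bigD1 x) //=.
  rewrite [X in _ + X]big1 ?Rplus_0_r => [|u hu].
    by apply: eq_bigr => v _; rewrite eqxx Rmult_1_r.
  by rewrite big1 // => v _; rewrite eq_sym (negbTE hu) Rmult_0_r.
rewrite sumR_sub part; congr (_ - _).
rewrite (reindex (fun e : V * V => (e.2, e.1))) /=; last first.
  by exists (fun e : V * V => (e.2, e.1)) => -[].
exact: (part (fun u => F (u.2, u.1))).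
Qed.

(** One of the two unit charges of [2 a_o] is moved to [x]: at [x = o] this is the wanted
    observable, and a Schwinger-Dyson step passes the charge at [x] on to its neighbours. *)
Definition sumv (x : V) : V -> Z := fun y => (1 * pointv o y + 1 * pointv x y)%Z.

Lemma dot_sumv x a : dot (sumv x) a = a o + a x.
Proof. by rewrite dot_lin !dot_pointv; lra. Qed.

(** Both orientations of an edge give [2 b sin (z a) sin (a x - a y)], which is [b (P y - Q y)]: in
    [P y] the charge has moved from [x] to [y], and the mean of [Q y] is nonnegative by [griffiths]
    and is dropped. The coefficient [z x] on the left is at least 1. *)
Lemma sd_pair x : D x -> exists2 C, 0 <= C & forall n, odd n.+1 -> (7 < n.+1)%N ->
  mean n D b (fun=> 0) (fun a => cos (a o + a x)) <=
  \sum_y b (x, y) * mean n D b (fun=> 0) (fun a => cos (a o + a y)) + C / INR n.+1.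
Proof.
move=> Dx; have [C C0 hC] := schwinger_dyson b (sumv x) Dx; exists C => // n on n7.
have {hC} := hC n n7; have pos w := griffiths D w on b_ge0.
pose P y (a : V -> R) := cos (dot (sumv y) a).
pose Q y (a : V -> R) := cos (dot (fun u => 1 * sumv x u + 1 * edgev (x, y) u)%Z a).
have hz : 1 <= IZR (sumv x x).
  by apply: IZR_le; rewrite /sumv /pointv eqxx; case: eqP.
rewrite (@mean_ext _ _ _ _ _ _ (fun a => IZR (sumv x x) * P x a +
   \sum_y (- b (x, y)) * P y a + \sum_y b (x, y) * Q y a)).
  rewrite !mean_add !mean_sum mean_scal.
  rewrite (eq_bigr (fun y => - (b (x, y) * mean n D b (fun=> 0) (P y)))); last first.
    by move=> y _; rewrite mean_scal; ring.
  have posQ : 0 <= \sum_y mean n D b (fun=> 0) (fun a => b (x, y) * Q y a).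
    by apply: sumR_ge0 => y _; rewrite mean_scal; apply: Rmult_le_pos => //; exact: pos.
  have e y : mean n D b (fun=> 0) (fun a => cos (a o + a y)) = mean n D b (fun=> 0) (P y).
    by apply: mean_ext => k; rewrite /P dot_sumv.
  rewrite e (eq_bigr _ (fun y _ => congr1 (Rmult (b (x, y))) (e y))) -sumR_opp.
  have hP : 0 <= mean n D b (fun=> 0) (P x) by exact: pos.
  by move/(Rle_trans _ _ _ (Rle_abs _)); nra.
move=> k; move: (ang D k) => a; rewrite /sd_obs Rplus_assoc; apply: (f_equal2 Rplus) => //.
rewrite (eq_bigr (fun e => b e * sin (a e.1 - a e.2) * IZR (edgev e x))) => [|e _]; last ring.
rewrite sum_incident // -sumR_sub sumR_mull sumR_opp -big_split /=; apply: eq_bigr => y _.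
rewrite /P /Q dot_lin dot_edgev !dot_sumv /= (b_sym y x) -(Ropp_minus_distr (a x) (a y)) sin_neg.
rewrite (_ : a o + a y = (a o + a x) - (a x - a y)); last ring.
rewrite (_ : 1 * (a o + a x) + 1 * (a x - a y) = (a o + a x) + (a x - a y)); last ring.
by rewrite cos_plus cos_minus; ring.
Qed.

Variables (r : V -> nat) (theta : R).
Hypothesis r_out : forall x, ~~ D x -> r x = 0%N.
Hypothesis r_step : forall x y, b (x, y) <> 0 -> (r x <= (r y).+1)%N.
Hypothesis theta01 : 0 <= theta <= 1.
Hypothesis b_sum : forall x, D x -> \sum_y b (x, y) <= theta.

Lemma high_temperature_decay : exists2 C, 0 <= C & forall n, odd n.+1 -> (7 < n.+1)%N ->
  mean n D b (fun=> 0) (fun a => cos (2 * a o)) <= theta ^ (r o) + C / INR n.+1.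
Proof.
have [c c0 hc] : exists2 c : V -> R, (forall x, 0 <= c x) & forall x, D x ->
    forall n, odd n.+1 -> (7 < n.+1)%N -> mean n D b (fun=> 0) (fun a => cos (a o + a x)) <=
      \sum_y b (x, y) * mean n D b (fun=> 0) (fun a => cos (a o + a y)) + c x / INR n.+1.
  pose Q x u := D x -> forall n, odd n.+1 -> (7 < n.+1)%N ->
    mean n D b (fun=> 0) (fun a => cos (a o + a x)) <=
    \sum_y b (x, y) * mean n D b (fun=> 0) (fun a => cos (a o + a y)) + u / INR n.+1.
  apply: (@fin_all_exists2 V (fun=> R) (fun _ u => 0 <= u) Q) => x; rewrite /Q.
  by case: (boolP (D x)) => [/sd_pair [C C0 hC]|_]; [exists C | exists 0 => //; lra].
set C := \sum_x c x.
have hC x : c x <= C.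
  rewrite /C (bigD1 x) //= -[X in X <= _]Rplus_0_r; apply: Rplus_le_compat_l.
  by apply: sumR_ge0.
have C0 : 0 <= C by apply: sumR_ge0.
exists (INR (r o) * C); first by apply: Rmult_le_pos => //; exact: pos_INR.
move=> n on n7; have n0 : 0 < INR n.+1 by apply: lt_0_INR; apply/ltP.
set eps := C / INR n.+1; have e0 : 0 <= eps by apply: Rmult_le_pos => //; exact/Rlt_le/Rinv_0_lt_compat.
have key m : forall x, (m <= r x)%N ->
    mean n D b (fun=> 0) (fun a => cos (a o + a x)) <= theta ^ m + INR m * eps.
  elim: m => [|m IH] x hx.
    by rewrite /= Rmult_0_l Rplus_0_r; apply: (proj2 (mean_abs_le1 _ _ _ _ _)) => a; exact: COS_bound.
  have Dx : D x by apply: contraLR hx => /r_out ->.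
  have hB : 0 <= theta ^ m + INR m * eps.
    by apply: Rplus_le_le_0_compat; [apply: pow_le; lra | apply: Rmult_le_pos => //; exact: pos_INR].
  apply: (Rle_trans _ _ _ (hc x Dx n on n7)).
  apply: (Rle_trans _ ((\sum_y b (x, y)) * (theta ^ m + INR m * eps) + eps)).
    apply: Rplus_le_compat; last by apply: Rmult_le_compat_r (hC x); exact/Rlt_le/Rinv_0_lt_compat.
    rewrite sumR_mulr; apply: sumR_le => y _.
    case: (Req_dec (b (x, y)) 0) => [->|hb]; first lra.
    by apply: Rmult_le_compat_l => //; apply: IH; rewrite -ltnS; apply: leq_trans hx (r_step hb).
  have := Rmult_le_compat_r _ _ _ hB (b_sum Dx).
  rewrite S_INR /=; have : theta * (INR m * eps) <= 1 * (INR m * eps).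
    by apply: Rmult_le_compat_r; [apply: Rmult_le_pos => //; exact: pos_INR | lra].
  by lra.
have := key _ _ (leqnn (r o)).
rewrite (@mean_ext _ _ _ _ _ _ (fun a => cos (2 * a o))) => [h|k]; last by congr cos; ring.
by apply: Rle_trans h _; rewrite /eps; apply: Req_le; field; lra.
Qed.
End HighTemperature.

(** * Cost of rotating the spins *)

Section MerminWagner.
Variables (V : finType) (D : pred V) (b : V * V -> R) (o : V).
Hypothesis b_ge0 : forall e, 0 <= b e.

Section Rotation.
Variables (n : nat) (phi : {ffun V -> 'I_n.+1}).
Let B := ang D phi.
Let E := \sum_(e : V * V | D e.1 || D e.2) b e * (1 - cos (B e.1 - B e.2)).

Lemma abs_cos_sub (u v : R) : Rabs (cos u - cos v) <= Rabs (u - v).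
Proof.
have [y [-> _]] := MVT_abs cos (fun x => - sin x) v u (fun c _ => derivable_pt_lim_cos c).
rewrite Rabs_Ropp; have : Rabs (sin y) <= 1 by have := SIN_bound y => ?; apply: Rabs_le; lra.
by have := Rabs_pos (u - v); nra.
Qed.

(** On an edge with spin difference [p] and rotation difference [q], the two energies add up to
    [2 b cos p cos q], which is at least [2 b (cos p - (1 - cos q))] since
    [(1 - cos p) (1 - cos q) >= 0]. The arithmetic mean of the weights then dominates their
    geometric mean. *)
Lemma rotated_weights k :
  exp (- E) * wt D b (fun=> 0) k <= (wt D b (fun=> 0) (k + phi)%ring + wt D b (fun=> 0) (k - phi)%ring) / 2.
Proof.
have hE : 2 * (energy D b (fun=> 0) (ang D k) - E) <=
   energy D b (fun=> 0) (ang D (k + phi)%ring) + energy D b (fun=> 0) (ang D (k - phi)%ring).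
  rewrite /energy /E -sumR_sub sumR_mull -big_split; apply: sumR_le => e _ /=.
  have hp : eq2pi (ang D (k + phi)%ring e.1 - ang D (k + phi)%ring e.2 + 0) ((ang D k e.1 - ang D k e.2) + (B e.1 - B e.2)).
    apply: (@eq2pi_trans ((ang D k e.1 + B e.1) - (ang D k e.2 + B e.2))); last by exists 0%Z; ring.
    by rewrite Rplus_0_r; apply: eq2pi_sub; exact: angD.
  have hm : eq2pi (ang D (k - phi)%ring e.1 - ang D (k - phi)%ring e.2 + 0) ((ang D k e.1 - ang D k e.2) - (B e.1 - B e.2)).
    apply: (@eq2pi_trans ((ang D k e.1 - B e.1) - (ang D k e.2 - B e.2))); last by exists 0%Z; ring.
    by rewrite Rplus_0_r; apply: eq2pi_sub; exact: angB.
  rewrite (cos_eq2pi hp) (cos_eq2pi hm) Rplus_0_r; have := b_ge0 e.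
  move: (ang D k e.1 - _) (B e.1 - _) => p q hb; rewrite cos_plus cos_minus.
  have : 0 <= b e * ((1 - cos p) * (1 - cos q)); last by lra.
  by have := COS_bound p; have := COS_bound q => ? ?; apply: Rmult_le_pos => //; nra.
rewrite /wt -exp_plus; move: hE.
move: (energy D b _ (ang D (k + _)%ring)) (energy D b _ (ang D (k - _)%ring)) => u v hE.
apply: (Rle_trans _ (exp ((u + v) / 2))); first by apply: exp_le; lra.
have hu : exp u = exp (u / 2) * exp (u / 2) by rewrite -exp_plus; congr exp; field.
have hv : exp v = exp (v / 2) * exp (v / 2) by rewrite -exp_plus; congr exp; field.
rewrite (_ : (u + v) / 2 = u / 2 + v / 2) ?exp_plus ?hu ?hv; last by field.
by have := Rle_0_sqr (exp (u / 2) - exp (v / 2)); rewrite /Rsqr; lra.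
Qed.

(* For [B o = pi / 2], rotating by [phi] or [- phi] changes the sign of [cos (2 a o)]. *)
Lemma rotation_bound : let M := mean n D b (fun=> 0) (fun a => cos (2 * a o)) in
  2 * M <= E * (1 + M) + 2 * Rabs (B o - PI / 2).
Proof.
move=> M; set eps := 2 * Rabs _.
have Zp := pfun_gt0 n D b (fun=> 0); set Z := pfun n D b (fun=> 0) in Zp.
pose c (k : {ffun V -> 'I_n.+1}) := cos (2 * ang D k o).
pose w (k : {ffun V -> 'I_n.+1}) := wt D b (fun=> 0) k.
have hM : \sum_(k : {ffun V -> 'I_n.+1}) c k * w k = M * Z by rewrite -(mean_pfun n D b).
have hneg u : Rabs (cos (u + PI) + cos u) = 0 by rewrite neg_cos Rplus_opp_l Rabs_R0.
have hcp k : c (k + phi)%ring <= - c k + eps.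
  rewrite /c (_ : cos (2 * ang D (k + phi)%ring o) = cos (2 * ang D k o + 2 * B o)); last first.
    apply: cos_eq2pi; have := eq2pi_mulz 2 (angD D k phi o).
    by rewrite Rmult_plus_distr_l.
  have := abs_cos_sub (2 * ang D k o + 2 * B o) (2 * ang D k o + PI); rewrite neg_cos.
  rewrite (_ : _ - (2 * ang D k o + PI) = 2 * (B o - PI / 2)); last by field.
  rewrite Rabs_mult (Rabs_pos_eq 2); last lra.
  by rewrite -/eps => h; have := Rle_trans _ _ _ (Rle_abs _) h; lra.
have hcm k : c (k - phi)%ring <= - c k + eps.
  rewrite /c (_ : cos (2 * ang D (k - phi)%ring o) = cos (2 * B o - 2 * ang D k o)); last first.
    rewrite -[RHS]cos_neg Ropp_minus_distr; apply: cos_eq2pi; have := eq2pi_mulz 2 (angB D k phi o).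
    by rewrite Rmult_minus_distr_l.
  have := abs_cos_sub (2 * B o - 2 * ang D k o) (- (2 * ang D k o) + PI); rewrite neg_cos cos_neg.
  rewrite (_ : _ - (- (2 * ang D k o) + PI) = 2 * (B o - PI / 2)); last by field.
  rewrite Rabs_mult (Rabs_pos_eq 2); last lra.
  by rewrite -/eps => h; have := Rle_trans _ _ _ (Rle_abs _) h; lra.
have shp (F : {ffun V -> 'I_n.+1} -> R) : \sum_(k : {ffun V -> 'I_n.+1}) F (k + phi)%ring = \sum_(k : {ffun V -> 'I_n.+1}) F k.
  rewrite [RHS](reindex (fun k : {ffun V -> 'I_n.+1} => (k + phi)%ring)) //=.
  by exists (fun k : {ffun V -> 'I_n.+1} => (k - phi)%ring) => k _; [exact: GRing.addrK | exact: GRing.subrK].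
have shm (F : {ffun V -> 'I_n.+1} -> R) : \sum_(k : {ffun V -> 'I_n.+1}) F (k - phi)%ring = \sum_(k : {ffun V -> 'I_n.+1}) F k.
  rewrite [RHS](reindex (fun k : {ffun V -> 'I_n.+1} => (k - phi)%ring)) //=.
  by exists (fun k : {ffun V -> 'I_n.+1} => (k + phi)%ring) => k _; [exact: GRing.subrK | exact: GRing.addrK].
pose W k := (w (k + phi)%ring + w (k - phi)%ring) / 2.
have hW : \sum_(k : {ffun V -> 'I_n.+1}) W k = Z.
  rewrite /W /Rdiv -sumR_mulr big_split /= (shp w) (shm w) (_ : \sum_(k : {ffun V -> 'I_n.+1}) w k = Z) //; lra.
have h1 : M * Z <= \sum_(k : {ffun V -> 'I_n.+1}) (- c k + eps) * W k.
  have wp k : 0 <= w k by exact/Rlt_le/wt_gt0.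
  have e : M * Z = (\sum_(k : {ffun V -> 'I_n.+1}) (c (k + phi)%ring * w (k + phi)%ring +
      c (k - phi)%ring * w (k - phi)%ring)) / 2.
    by rewrite big_split /= (shp (fun k => c k * w k)) (shm (fun k => c k * w k)) hM; field.
  rewrite e /Rdiv sumR_mulr; apply: sumR_le => k _; rewrite /W.
  have := Rmult_le_compat_r _ _ _ (wp (k + phi)%ring) (hcp k).
  have := Rmult_le_compat_r _ _ _ (wp (k - phi)%ring) (hcm k).
  move: (w (k + phi)%ring) (w (k - phi)%ring) (c (k + phi)%ring) (c (k - phi)%ring) => x1 x2 y1 y2; lra.
(* The nonnegative test function [1 + c] allows a pointwise comparison of weights; adding [h1]
   eliminates the unknown sum of [c k * W k]. *)
have h2 : exp (- E) * (\sum_(k : {ffun V -> 'I_n.+1}) (1 + c k) * w k) <= \sum_(k : {ffun V -> 'I_n.+1}) (1 + c k) * W k.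
  rewrite sumR_mull; apply: sumR_le => k _.
  have := rotated_weights k; rewrite -/(w _) -/(w _) -/(w _) -/(W k) => h.
  have hc : 0 <= 1 + c k by have := COS_bound (2 * ang D k o); rewrite /c; lra.
  by have := Rmult_le_compat_l _ _ _ hc h; lra.
have e1 : \sum_(k : {ffun V -> 'I_n.+1}) (1 + c k) * w k = Z + M * Z.
  by rewrite -hM /Z /pfun -big_split; apply: eq_bigr => k _ /=; rewrite /w; ring.
have e2 : \sum_(k : {ffun V -> 'I_n.+1}) (- c k + eps) * W k + \sum_(k : {ffun V -> 'I_n.+1}) (1 + c k) * W k = (1 + eps) * Z.
  by rewrite -hW sumR_mull -big_split; apply: eq_bigr => k _ /=; ring.
have hexp := exp_ineq1_le (- E).
have M1 : -1 <= M <= 1 by apply: mean_abs_le1 => a; exact: COS_bound.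
have h3 : (1 - E) * (1 + M) * Z <= exp (- E) * (Z + M * Z).
  rewrite (_ : Z + M * Z = (1 + M) * Z); last ring.
  rewrite Rmult_assoc; apply: Rmult_le_compat_r; last lra.
  by apply: Rmult_le_pos; lra.
apply: (Rmult_le_reg_r Z) => //.
rewrite e1 in h2; lra.
Qed.
End Rotation.

(** A real profile [f] is rounded down to clock angles, which moves each angle by at most one step
    of size [O(1/n)]. *)
Lemma mermin_wagner_bound (f : V -> R) :
  (forall x, ~~ D x -> f x = 0) -> (forall x, 0 <= f x <= PI / 2) -> f o = PI / 2 ->
  exists2 C, 0 <= C & forall n, mean n D b (fun=> 0) (fun a => cos (2 * a o)) <=
    \sum_(e : V * V | D e.1 || D e.2) b e * ((f e.1 - f e.2) ^ 2 / 2) + C / INR n.+1.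
Proof.
move=> f0 fb fo; set S := \sum_(e : V * V | _) _; set T := \sum_(e : V * V | D e.1 || D e.2) b e.
have PI0 := PI_RGT_0.
have T0 : 0 <= T by apply: sumR_ge0.
exists (T * (4 * PI) + 2 * PI); first by apply: Rplus_le_le_0_compat; [apply: Rmult_le_pos |]; lra.
move=> n; have n0 : 0 < INR n.+1 by apply: lt_0_INR; apply/ltP.
set h := 2 * PI / INR n.+1.
have h0 : 0 < h by apply: Rdiv_lt_0_compat => //; lra.
have [phi hphi] : exists phi : {ffun V -> 'I_n.+1}, forall x, f x - h <= ang1 (phi x) <= f x.
  have [g hg] : exists g : V -> 'I_n.+1, forall x, f x - h <= ang1 (g x) <= f x.
    apply: (@fin_all_exists V (fun=> 'I_n.+1) (fun x u => f x - h <= ang1 u <= f x)) => x.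
    have [a1 a2] := archimed (f x / h); have fx := fb x.
    have q0 : 0 <= f x / h by apply: Rmult_le_pos; [lra | exact/Rlt_le/Rinv_0_lt_compat].
    pose m := Z.to_nat (up (f x / h) - 1).
    have hu : (0 <= up (f x / h) - 1)%Z.
      have : (0 < up (f x / h))%Z by apply: lt_IZR; lra.
      by lia.
    have hm : INR m = IZR (up (f x / h)) - 1.
      by rewrite INR_IZR_INZ Z2Nat.id // minus_IZR.
    have eh : f x = f x / h * h by field; lra.
    have hmn : (m < n.+1)%N.
      apply/ltP/INR_lt; rewrite hm; apply: (Rmult_lt_reg_r h) => //.
      rewrite (_ : INR n.+1 * h = 2 * PI); last by rewrite /h; field; lra.
      by apply: (Rle_lt_trans _ (f x)); [rewrite {2}eh; apply: Rmult_le_compat_r; lra | lra].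
    exists (inord m); rewrite /ang1 inordK // (_ : 2 * PI * INR m / INR n.+1 = INR m * h); last by rewrite /h; field; lra.
    rewrite hm; split; first by rewrite {1}eh; nra.
    by rewrite {2}eh; apply: Rmult_le_compat_r; lra.
  by exists [ffun x => g x] => x; rewrite ffunE.
have := rotation_bound phi; set M := mean n _ _ _ _; rewrite /=.
have M1 : -1 <= M <= 1 by apply: mean_abs_le1 => a; exact: COS_bound.
set E := \sum_(e : V * V | _) _.
have hang x : f x - h <= ang D phi x <= f x.
  rewrite /ang; case: (boolP (D x)) => Dx; first exact: hphi.
  by rewrite f0 //; lra.
have hB : Rabs (ang D phi o - PI / 2) <= h by rewrite -fo; have := hang o => ?; apply: Rabs_le; lra.
have hE : E <= S + T * (2 * h).
  rewrite /S /T sumR_mulr -big_split; apply: sumR_le => e _ /=.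
  rewrite -Rmult_plus_distr_l; apply: Rmult_le_compat_l; first exact: b_ge0.
  have := abs_cos_sub (ang D phi e.1 - ang D phi e.2) (f e.1 - f e.2).
  have : Rabs (ang D phi e.1 - ang D phi e.2 - (f e.1 - f e.2)) <= h.
    by have := hang e.1; have := hang e.2 => ? ?; apply: Rabs_le; lra.
  have := cos_ge_quadratic (f e.1 - f e.2).
  move=> ? hx hy; have := Rle_trans _ _ _ hy hx; rewrite Rabs_minus_sym => hz.
  by have := Rle_trans _ _ _ (Rle_abs _) hz; lra.
have E0 : 0 <= E.
  apply: sumR_ge0 => e _; apply: Rmult_le_pos => //.
  by have := COS_bound (ang D phi e.1 - ang D phi e.2); lra.
have -> : (T * (4 * PI) + 2 * PI) / INR n.+1 = T * (2 * h) + h by rewrite /h; field; lra.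
(* Since [M <= 1], the rotation bound reads [M <= E + h]. *)
by nra.
Qed.
End MerminWagner.

(** * The clock model on the box *)

Lemma double_coq (m : nat) : m.*2 = (2 * m)%coq_nat.
Proof. by rewrite -mul2n multE. Qed.

Section BoxGeometry.
Variables (d L : nat).
Implicit Types x y : Pt d L.

(** Two truncated differences make an absolute value in [nat], so that [sum_nat_eq1] singles out the
    coordinate that changes. *)
Lemma adj_sum x y : adj x y = ((\sum_(i < d) ((x i - y i) + (y i - x i)))%N == 1%N).
Proof.
rewrite /adj; set s := (\sum_(i < d) _)%N.
have -> : \big[Z.add/0%Z]_(i < d) Z.abs (zc x i - zc y i) = Z.of_nat s.
  rewrite /s; elim/big_ind2: _ => // [a a' b b' -> ->|i _]; first by rewrite Nat2Z.inj_add.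
  by rewrite /zc -!plusE -!minusE; lia.
by apply/Z.eqb_spec/eqP => [h|->] //; lia.
Qed.

Lemma adjC x y : adj x y = adj y x.
Proof. by rewrite !adj_sum; congr (_ == _); apply: eq_bigr => i _; rewrite addnC. Qed.

Lemma adjP x y : reflect (exists i : 'I_d, ((x i).+1 = y i :> nat \/ (y i).+1 = x i :> nat) /\
    forall j, j != i -> x j = y j) (adj x y).
Proof.
rewrite adj_sum; apply: (iffP (sum_nat_eq1 _ _)) => -[i]; [case=> _ h1 h2 | case=> h1 h2].
  exists i; split; first by move: h1; rewrite -!plusE -!minusE; lia.
  by move=> j ji; apply/val_inj; have := h2 j ji isT; rewrite /= -!plusE -!minusE; lia.
exists i; split=> // [|j ji _]; first by rewrite -!plusE -!minusE; lia.
by rewrite (h2 j ji) subnn.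
Qed.

Lemma innerP x : reflect (forall i, (0 < x i < L.*2.+2)%N) (inner_box x).
Proof.
have hL := double_coq L; apply: (iffP forallP) => h i; have := h i; rewrite /zc.
  by move=> /andP[/Z.leb_le h1 /Z.leb_le h2]; apply/andP; split; apply/ltP; lia.
move=> /andP[/ltP h1 /ltP h2].
by apply/andP; split; apply/Z.leb_le; lia.
Qed.

Lemma card_adj x : (#|[pred y | adj x y]| <= 2 * d)%N.
Proof.
pose nb (u : 'I_d * bool) : Pt d L :=
  [ffun j => if j == u.1 then inord (if u.2 then (x j).+1 else (x j).-1) else x j].
have <- : #|{: 'I_d * bool}| = (2 * d)%N by rewrite card_prod card_ord card_bool mulnC.
apply: leq_trans (leq_image_card nb _); apply/subset_leq_card/subsetP => y; rewrite inE => /adjP[i [h1 h2]].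
case: h1 => h1; [pose u := (i, true) | pose u := (i, false)]; apply/imageP; exists u => //;
  apply/ffunP => j; rewrite ffunE /=; case: eqP => [->|/eqP ji]; rewrite ?(h2 j ji) //; apply/val_inj => /=.
- by rewrite h1 inordK ?ltn_ord.
- by rewrite -h1 inordK ?ltn_ord.
Qed.

End BoxGeometry.

Section BoxModel.
Variables (n d L : nat) (J : R).

(* Each edge is counted in both orientations, so its coupling is [2 J]. *)
Definition boxb (e : Pt d L * Pt d L) : R := if adj e.1 e.2 then J else 0.

Definition clock_magnetization : R := mean n (@inner_box d L) boxb (fun=> 0) (fun a => cos (2 * a (origin d L))).

Lemma boxb_ge0 e : 0 <= J -> 0 <= boxb e.
Proof. by rewrite /boxb; case: ifP; lra. Qed.

Lemma clock_magnetization_ge0 : odd n.+1 -> 0 <= J -> 0 <= clock_magnetization.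
Proof. by move=> on hJ; rewrite /clock_magnetization mean_cos2; apply: griffiths => // e; exact: boxb_ge0. Qed.

Lemma clock_magnetization_le1 : clock_magnetization <= 1.
Proof. by apply: (proj2 (mean_abs_le1 _ _ _ _ _)) => a; exact: COS_bound. Qed.

End BoxModel.

Lemma clock_magnetization_monoJ n d L J J' : odd n.+1 -> 0 <= J <= J' -> clock_magnetization n d L J <= clock_magnetization n d L J'.
Proof.
move=> on hJ; apply: mean_cos2_mono => // e.
by rewrite /boxb; case: ifP; lra.
Qed.

(** The smaller box is the larger one with all spins outside a central region [D] frozen, and
    freezing spins increases the mean. *)
Lemma clock_magnetization_anti n d L L' J : odd n.+1 -> 0 <= J -> (L <= L')%N -> clock_magnetization n d L' J <= clock_magnetization n d L J.
Proof.
move=> on hJ hL.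
have dL := double_coq L; have dL' := double_coq L'.
pose io (x : Pt d L) : Pt d L' := [ffun i => inord (x i + (L' - L))%N].
have ioE x i : io x i = (x i + (L' - L))%N :> nat.
  rewrite ffunE inordK //; have := ltn_ord (x i).
  by move/leP; move/leP: hL => ? ?; apply/leP; rewrite -!plusE -!minusE; lia.
have zio x i : zc (io x) i = zc x i.
  by rewrite /zc ioE; move/leP: hL => ?; rewrite -!plusE -!minusE; lia.
pose D (x : Pt d L') := [forall i, (- Z.of_nat L <=? zc x i)%Z && (zc x i <=? Z.of_nat L)%Z].
have io_inj : injective io.
  move=> x y h; apply/ffunP => i; apply/val_inj/eqP; rewrite -(eqn_add2r (L' - L)) -!ioE h; exact: eqxx.
have io_dom x : D (io x) = inner_box x by apply: eq_forallb => i; rewrite zio.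
have io_edge (e : Pt d L * Pt d L) : @boxb d L' J (io e.1, io e.2) = boxb J e.
  by rewrite /boxb /adj /=; congr (if (_ =? _)%Z then _ else _); apply: eq_bigr => i _; rewrite !zio.
have in_codom (x : Pt d L') : (forall i, (- Z.of_nat L.+1 <= zc x i <= Z.of_nat L.+1)%Z) -> x \in codom io.
  move=> h; apply/codomP; exists [ffun i => inord (x i - (L' - L))%N].
  apply/ffunP => i; apply/val_inj => /=; have := h i; rewrite ioE ffunE /zc => hi.
  move/leP: hL => hL0; have := ltn_ord (x i) => /leP hx.
  rewrite inordK; first by rewrite -!plusE -!minusE; lia.
  by apply/leP; rewrite -!minusE; lia.
have io_out (e : Pt d L' * Pt d L') : D e.1 || D e.2 -> @boxb d L' J e <> 0 ->
    (e.1 \in codom io) && (e.2 \in codom io).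
  case: e => x y /= h; rewrite /boxb /=; case: ifP => // /adjP[i [h1 h2]] _.
  have near j : (Z.abs (zc x j - zc y j) <= 1)%Z.
    by rewrite /zc; case: (eqVneq j i) => [->|/h2 ->]; lia.
  move: h => /orP[] /forallP h; apply/andP; split; apply: in_codom => j; have := h j;
    have := near j => hn /andP[/Z.leb_le ? /Z.leb_le ?]; lia.
rewrite [X in _ <= X]/clock_magnetization -(@mean_transfer _ _ n io (@inner_box d L) D (boxb J) (@boxb d L' J)
  io_inj io_dom io_edge io_out (fun a => cos (2 * a (origin d L))) (fun a => cos (2 * a (origin d L')))).
- apply: mean_cos2_mono => // [e|x /forallP h]; first by have := @boxb_ge0 d L' J e hJ; lra.
  apply/forallP => i; have := h i => /andP[/Z.leb_le ? /Z.leb_le ?]; move/leP: hL => ?.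
  by apply/andP; split; apply/Z.leb_le; lia.
- move=> a; congr (cos (2 * a _)); apply/ffunP => i; apply/val_inj => /=.
  rewrite ioE !ffunE !inordK; move/leP: hL => ?; rewrite -?plusE -?minusE; try lia;
    by apply/leP; lia.
- by move=> a1 a2 ->.
Qed.

(** The box of dimension [d] is the hyperplane slice through the origin; [b'] keeps the couplings
    inside the slice and removes the others, which decreases the mean. *)
Lemma clock_magnetization_monod n d L J : odd n.+1 -> 0 <= J -> clock_magnetization n d L J <= clock_magnetization n d.+1 L J.
Proof.
move=> on hJ.
pose io (x : Pt d L) : Pt d.+1 L := [ffun i => if unlift ord0 i is Some j then x j else inord L.+1].
have io0 x : io x ord0 = inord L.+1 by rewrite ffunE unlift_none.
have ioS x j : io x (lift ord0 j) = x j by rewrite ffunE liftK.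
have dL := double_coq L.
have hLL : (L.+1 < L.*2.+3)%N by apply/leP; lia.
pose b' (e : Pt d.+1 L * Pt d.+1 L) : R :=
  if (e.1 ord0 == inord L.+1) && (e.2 ord0 == inord L.+1) then boxb J e else 0.
have io_inj : injective io by move=> x y h; apply/ffunP => i; rewrite -!ioS h.
have io_dom x : inner_box (io x) = inner_box x.
  apply/innerP/innerP => h i; first by rewrite -ioS.
  case: (unliftP ord0 i) => [j ->|->]; first by rewrite ioS.
  by rewrite io0 inordK //; apply/andP; split => //; apply/ltP; lia.
have io_edge e : b' (io e.1, io e.2) = boxb J e.
  rewrite /b' /= !io0 eqxx /boxb /= !adj_sum big_ord_recl !io0 !subnn !add0n.
  by congr (if _ == _ then _ else _); apply: eq_bigr => i _; rewrite !ioS.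
have in_codom (x : Pt d.+1 L) : x ord0 == inord L.+1 -> x \in codom io.
  move=> /eqP h; apply/codomP; exists [ffun j => x (lift ord0 j)].
  by apply/ffunP => i; case: (unliftP ord0 i) => [j ->|->]; rewrite ?ioS ?io0 ?ffunE.
have io_out (e : Pt d.+1 L * Pt d.+1 L) : inner_box e.1 || inner_box e.2 -> b' e <> 0 ->
    (e.1 \in codom io) && (e.2 \in codom io).
  by move=> _; rewrite /b'; case: ifP => // /andP[h1 h2] _; rewrite !in_codom.
rewrite [X in X <= _]/clock_magnetization -(@mean_transfer _ _ n io _ (@inner_box d.+1 L) (boxb J) b'
  io_inj io_dom io_edge io_out (fun a => cos (2 * a (origin d L))) (fun a => cos (2 * a (origin d.+1 L)))).
- by apply: mean_cos2_mono => // e; rewrite /b'; have := @boxb_ge0 _ L J e hJ; case: ifP; lra.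
- move=> a; congr (cos (2 * a _)); apply/ffunP => i.
  by case: (unliftP ord0 i) => [j ->|->]; rewrite ?ioS ?io0 !ffunE.
- by move=> a1 a2 ->.
Qed.

Section SupNorm.
Variables (d L : nat).
Implicit Types x y : Pt d L.

Definition sup_dist x : nat := \max_(i < d) ((x i - L.+1) + (L.+1 - x i)).

Lemma sup_dist_le x : (sup_dist x <= L.+1)%N.
Proof.
apply/bigmax_leqP => i _; have := ltn_ord (x i) => /leP; have := double_coq L => dL h.
by apply/leP; rewrite -!plusE -!minusE; lia.
Qed.

Lemma sup_dist_out x : ~~ inner_box x -> sup_dist x = L.+1.
Proof.
move=> h; apply/eqP; rewrite eqn_leq sup_dist_le /=.
have [i hi] : exists i, ~~ (0 < x i < L.*2.+2)%N.
  by apply/existsP; rewrite -negb_forall; apply: contra h => /forallP h; apply/innerP.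
apply: leq_trans (leq_bigmax i); move: hi; rewrite negb_and -!leqNgt; have := double_coq L => dL.
by move=> /orP[] /leP h1; apply/leP; rewrite -!plusE -!minusE; lia.
Qed.

Lemma sup_dist_step x y : adj x y -> (sup_dist y <= (sup_dist x).+1)%N.
Proof.
move=> /adjP[i [h1 h2]]; apply/bigmax_leqP => j _.
have /leP := leq_bigmax (F := fun i : 'I_d => (x i - L.+1 + (L.+1 - x i))%N) j; rewrite -/(sup_dist x) => h3.
apply/leP; move: h3; rewrite -!plusE -!minusE.
by case: (eqVneq j i) => [->|/h2 ->]; lia.
Qed.

Lemma sup_dist_origin : sup_dist (origin d L) = 0%N.
Proof.
apply/eqP; rewrite -leqn0; apply/bigmax_leqP => i _; rewrite ffunE inordK ?subnn //.
by have := double_coq L => dL; apply/leP; lia.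
Qed.

Lemma sum_adj x (c : R) : 0 <= c -> \sum_(y : Pt d L) (if adj x y then c else 0) <= INR (2 * d) * c.
Proof.
move=> hc; rewrite -big_mkcond sumR_const; apply: Rmult_le_compat_r => //.
by apply: le_INR; apply/leP; exact: card_adj.
Qed.

Lemma clock_magnetization_high_temperature J : 0 <= J -> INR (2 * d) * J <= 1 ->
  exists2 C, 0 <= C & forall n, odd n.+1 -> (7 < n.+1)%N ->
    clock_magnetization n d L J <= (INR (2 * d) * J) ^ L.+1 + C / INR n.+1.
Proof.
move=> hJ h1.
have [||||||C C0 hC] := @high_temperature_decay _ (@inner_box d L) (boxb J) (origin d L) _ _
  (fun x => L.+1 - sup_dist x)%N (INR (2 * d) * J); last first.
- by exists C => // n on n7; have := hC n on n7; rewrite sup_dist_origin subn0.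
- move=> x _; apply: Rle_trans (sum_adj x hJ); apply: Req_le; exact: eq_bigr.
- by split => //; apply: Rmult_le_pos => //; exact: pos_INR.
- move=> x y; rewrite /boxb; case: ifP => //= a _; have /leP := sup_dist_step a => h.
  by apply/leP; rewrite -!minusE; lia.
- by move=> x /sup_dist_out ->; rewrite subnn.
- by move=> x y; rewrite /boxb /= adjC.
- by move=> e; exact: boxb_ge0.
Qed.
End SupNorm.

(** * A logarithmic rotation profile in the plane *)

Section TwoDimensions.
Variables (L : nat).

Definition harm (m : nat) : R := \sum_(j < m) / INR j.+1.

Lemma harmS m : harm m.+1 = harm m + / INR m.+1. Proof. by rewrite /harm big_ord_recr. Qed.

Lemma harm_ge0 m : 0 <= harm m.
Proof. by apply: sumR_ge0 => j _; apply/Rlt_le/Rinv_0_lt_compat/lt_0_INR/ltP. Qed.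

Lemma harm_le m1 m2 : (m1 <= m2)%N -> harm m1 <= harm m2.
Proof.
elim: m2 => [|m2 IH]; first by rewrite leqn0 => /eqP ->; lra.
rewrite leq_eqVlt => /orP[/eqP ->|/IH h]; first lra.
by rewrite harmS; have : 0 < / INR m2.+1 by [apply/Rinv_0_lt_compat/lt_0_INR/ltP]; lra.
Qed.

Lemma harm_ln m : ln (INR m.+1) <= harm m.
Proof.
elim: m => [|m IH]; first by rewrite /harm big_ord0 INR_1 ln_1; lra.
rewrite harmS; have m0 : 0 < INR m.+1 by apply/lt_0_INR/ltP.
have hi : 0 < / INR m.+1 by exact: Rinv_0_lt_compat.
have -> : INR m.+2 = INR m.+1 * (1 + / INR m.+1) by rewrite (S_INR m.+1); field; lra.
rewrite ln_mult //; last lra.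
suff : ln (1 + / INR m.+1) <= / INR m.+1 by lra.
rewrite -{2}(ln_exp (/ INR m.+1)); case: (Rle_lt_or_eq_dec _ _ (exp_ineq1_le (/ INR m.+1))) => [h|->]; last lra.
by apply/Rlt_le/ln_increasing => //; lra.
Qed.

(** A point at distance [j] is determined by a coordinate that attains it, the sign of this
    coordinate, and the other coordinate, which has [2 j + 1] values. The slack in [8 * j.+1] fits
    the factor [1 / (j + 1) ^ 2] of the gradient energy. *)
Lemma card_sphere (j : nat) : (#|[pred x : Pt 2 L | sup_dist x == j]| <= 8 * j.+1)%N.
Proof.
pose pt (u : 'I_2 * bool * 'I_(2 * j.+1)) : Pt 2 L :=
  [ffun a => if a == u.1.1 then inord (if u.1.2 then L.+1 + j else L.+1 - j)%N else inord (L.+1 - j + u.2)%N].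
have -> : (8 * j.+1 = #|{: 'I_2 * bool * 'I_(2 * j.+1)}|)%N.
  by rewrite !card_prod !card_ord card_bool mulnA.
apply: leq_trans (leq_image_card pt _); apply/subset_leq_card/subsetP => x; rewrite inE => /eqP hx.
have [i hi] : exists i : 'I_2, ((x i - L.+1) + (L.+1 - x i))%N = j.
  have h2 : (0 < #|'I_2|)%N by rewrite card_ord.
  by have [i h] := @eq_bigmax _ (fun i : 'I_2 => (x i - L.+1 + (L.+1 - x i))%N) h2; exists i; rewrite -h.
have le_j a : ((x a - L.+1) + (L.+1 - x a) <= j)%N by rewrite -hx; exact: leq_bigmax.
have [i' hi'] : exists i' : 'I_2, forall a, a != i -> a = i'.
  exists (if i == ord0 then ord_max else ord0) => a.
  by case: i {hi} => [[|[|//]]] ?; case: a => [[|[|//]]] ? //= _; apply/val_inj.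
have hb : ((x i' + j - L.+1) < 2 * j.+1)%N.
  by have /leP := le_j i'; rewrite mul2n (double_coq j.+1) => h; apply/ltP; move: h; rewrite -!plusE -!minusE; lia.
apply/imageP; exists (i, (L.+1 <= x i)%N, Ordinal hb) => //; apply/ffunP => a; rewrite ffunE /=.
have dL := double_coq L; have hj : (j <= L.+1)%N by rewrite -hx; exact: sup_dist_le.
apply/val_inj => /=; case: (eqVneq a i) => [->|/hi' ->].
  have xi := leP (ltn_ord (x i)).
  have -> : (if (L.+1 <= x i)%N then (L.+1 + j)%N else (L.+1 - j)%N) = x i.
    by case: ifP => [/leP|/negbT/leP] h; move: hi; rewrite -!plusE -!minusE; lia.
  by rewrite inordK.
have xi := leP (ltn_ord (x i')); have /leP := le_j i'; move/leP: hj => hj h.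
have -> : (L.+1 - j + (x i' + j - L.+1))%N = x i' by move: h; rewrite -!plusE -!minusE; lia.
by rewrite inordK.
Qed.

Lemma sum_sphere (F : nat -> R) : (forall j, 0 <= F j) ->
  \sum_(x : Pt 2 L) F (sup_dist x) <= 8 * \sum_(j < L.+2) INR j.+1 * F j.
Proof.
move=> F0.
have hs (x : Pt 2 L) : (sup_dist x < L.+2)%N by rewrite ltnS sup_dist_le.
rewrite (partition_big (fun x => Ordinal (hs x)) predT) // sumR_mull; apply: sumR_le => j _.
rewrite (eq_bigr (fun=> F j)) => [|x /eqP <- //].
rewrite sumR_const -Rmult_assoc; apply: Rmult_le_compat_r => //.
rewrite (_ : 8 = INR 8); last by rewrite /=; ring.
rewrite -mult_INR; apply: le_INR; apply/leP; apply: leq_trans (card_sphere j).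
by apply: subset_leq_card; apply/subsetP => x; rewrite !inE => /eqP <-.
Qed.

(** Harmonic numbers serve as discrete logarithm. At distance [j] the increments of [f] are of order
    [1 / (H (j + 1))] on about [j + 1] sites, so the energy is of order [harm L.+2 / H ^ 2], that is
    [1 / H]. *)
Lemma clock_magnetization_two_dimensions J : 0 <= J -> exists2 C, 0 <= C & forall n,
  clock_magnetization n 2 L J <= 16 * PI ^ 2 * J / harm L.+1 + C / INR n.+1.
Proof.
move=> hJ; set H := harm L.+1.
have H1 : 1 <= H by have := @harm_le 1 L.+1 isT; rewrite {1}/harm big_ord1 INR_1 Rinv_1.
have PI0 := PI_RGT_0.
pose f (x : Pt 2 L) := PI / 2 * (1 - harm (sup_dist x) / H).
have hf (x : Pt 2 L) : 0 <= harm (sup_dist x) / H <= 1.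
  have h1 := harm_ge0 (sup_dist x); have h2 := harm_le (sup_dist_le x); rewrite -/H in h2.
  have hi : 0 < / H by apply: Rinv_0_lt_compat; lra.
  split; first by apply: Rmult_le_pos; lra.
  by rewrite -(Rinv_r H); [apply: Rmult_le_compat_r; lra | lra].
have [||||C C0 hC] := @mermin_wagner_bound _ (@inner_box 2 L) (boxb J) (origin 2 L) _ f; last first.
- exists C => // n; apply: Rle_trans (hC n) _; apply: Rplus_le_compat_r.
  pose q j := (/ INR j.+1) ^ 2; pose c := PI / (2 * H).
  have q0 j : 0 <= q j by apply: pow_le; apply/Rlt_le/Rinv_0_lt_compat/lt_0_INR/ltP.
  have c0 : 0 <= c ^ 2 by nra.
  apply: (Rle_trans _ (\sum_(x : Pt 2 L) \sum_(y : Pt 2 L)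
     (if adj x y then J * c ^ 2 / 2 * (q (sup_dist x) + q (sup_dist y)) else 0))).
    have key x y : adj x y -> (f x - f y) ^ 2 <= c ^ 2 * (q (sup_dist x) + q (sup_dist y)).
      move=> a; have s1 := sup_dist_step a; rewrite adjC in a; have s2 := sup_dist_step a.
      have e : f x - f y = c * (harm (sup_dist y) - harm (sup_dist x)) by rewrite /f /c; field; lra.
      rewrite e Rpow_mult_distr; apply: Rmult_le_compat_l => //.
      have := q0 (sup_dist x); have := q0 (sup_dist y).
      move: s1; rewrite leq_eqVlt => /orP[/eqP ->|]; first by rewrite harmS /q; nra.
      rewrite ltnS => s3; move: s2; rewrite leq_eqVlt => /orP[/eqP ->|]; first by rewrite harmS /q; nra.
      by rewrite ltnS => s4; rewrite (_ : sup_dist x = sup_dist y); [nra | apply/eqP; rewrite eqn_leq s3 s4].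
    rewrite pair_bigA /= big_mkcond; apply: sumR_le => -[x y] _ /=; rewrite /boxb /=.
    have nn : 0 <= J * c ^ 2 / 2 * (q (sup_dist x) + q (sup_dist y)).
      by apply: Rmult_le_pos; [nra | have := q0 (sup_dist x); have := q0 (sup_dist y); lra].
    case: (boolP (adj x y)) => [/key h|_]; last by case: ifP; lra.
    case: ifP => _ //; rewrite (_ : J * c ^ 2 / 2 * _ = J * (c ^ 2 * (q (sup_dist x) + q (sup_dist y)) / 2)); last by field.
    by apply: Rmult_le_compat_l => //; lra.
  have -> : \sum_(x : Pt 2 L) \sum_(y : Pt 2 L)
     (if adj x y then J * c ^ 2 / 2 * (q (sup_dist x) + q (sup_dist y)) else 0) =
     2 * \sum_(x : Pt 2 L) \sum_(y : Pt 2 L) (if adj x y then J * c ^ 2 / 2 * q (sup_dist x) else 0).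
    rewrite (_ : forall u, 2 * u = u + u); [|by move=> u; ring].
    rewrite [X in _ = _ + X]exchange_big -!big_split; apply: eq_bigr => x _ /=.
    rewrite -big_split; apply: eq_bigr => y _ /=; rewrite (adjC y x).
    by case: ifP => _; ring.
  apply: (Rle_trans _ (2 * \sum_(x : Pt 2 L) INR (2 * 2) * (J * c ^ 2 / 2 * q (sup_dist x)))).
    apply: Rmult_le_compat_l; first lra.
    by apply: sumR_le => x _; apply: sum_adj; apply: Rmult_le_pos => //; nra.
  rewrite (eq_bigr (fun x => (2 * J * c ^ 2) * q (sup_dist x))) => [|x _]; last by rewrite /=; field.
  rewrite -sumR_mull.
  have h8 := sum_sphere q0.
  have e8 : \sum_(j < L.+2) INR j.+1 * q j = harm L.+2.
    by apply: eq_bigr => j _; rewrite /q; field; apply: INR_nS_neq0.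
  have h2H : harm L.+2 <= 2 * H.
    rewrite harmS -/H; suff : / INR L.+2 <= 1 by lra.
    by rewrite -Rinv_1; apply: Rinv_le_contravar; [lra | have := le_INR 1 L.+2 (leP (isT : 1 <= L.+2)%N); rewrite INR_1].
  rewrite e8 in h8.
  apply: (Rle_trans _ (2 * (2 * J * c ^ 2 * (8 * (2 * H))))).
    have Jc : 0 <= J * c ^ 2 by exact: Rmult_le_pos.
    apply: Rmult_le_compat_l; first lra; apply: Rmult_le_compat_l; first lra.
    by apply: (Rle_trans _ _ _ h8); lra.
  by apply: Req_le; rewrite /c; field; lra.
- by rewrite /f sup_dist_origin /harm big_ord0; field; lra.
- by move=> x; have := hf x; rewrite /f; nra.
- by move=> x /sup_dist_out hx; rewrite /f hx -/H; field; lra.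
- by move=> e; exact: boxb_ge0.
Qed.
End TwoDimensions.

(** * Random phases *)

Section ProductNoise.
Variables (E : finType) (n : nat).
Notation noise := {ffun E -> 'I_n.+1}.
Variable q : E -> 'I_n.+1 -> R.
Hypothesis q_even : forall e u, q e (- u)%ring = q e u.

Let Q (w : noise) : R := \prod_e q e (w e).

Definition flip (e : E) (w : noise) : noise := [ffun e' => if e' == e then (- w e')%ring else w e'].

Lemma flipK e : involutive (flip e).
Proof. by move=> w; apply/ffunP => e'; rewrite !ffunE; case: eqP => // _; rewrite GRing.opprK. Qed.

Lemma sum_flip e (F : noise -> R) : \sum_(w : noise) Q w * F w = \sum_(w : noise) Q w * ((F w + F (flip e w)) / 2).
Proof.
have h : \sum_(w : noise) Q w * F w = \sum_(w : noise) Q w * F (flip e w).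
  rewrite [LHS](reindex (flip e)) /=; last by exists (flip e) => w _; exact: flipK.
  apply: eq_bigr => w _; congr (_ * _); apply: eq_bigr => e' _; rewrite ffunE.
  by case: eqP => // _; rewrite q_even.
have -> : \sum_(w : noise) Q w * F w = (\sum_(w : noise) Q w * F w + \sum_(w : noise) Q w * F (flip e w)) / 2 by rewrite -h; field.
rewrite -big_split /Rdiv sumR_mulr; apply: eq_bigr => w _ /=; ring.
Qed.

Lemma sum_cos_product (m : E -> Z) :
  \sum_(w : noise) Q w * cos (\sum_e IZR (m e) * ang1 (w e)) =
  \prod_e \sum_u q e u * cos (IZR (m e) * ang1 u).
Proof.
rewrite bigA_distr_bigA /=.
(* Averaging over the flip of one phase cancels its sine. The factor [G] collects the cosines of the
   edges already treated, which the remaining flips do not change. *)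
have key r : uniq r -> forall G : noise -> R, (forall e w, e \in r -> G (flip e w) = G w) ->
   \sum_(w : noise) Q w * (G w * cos (\sum_(e <- r) IZR (m e) * ang1 (w e))) =
   \sum_(w : noise) Q w * (G w * \prod_(e <- r) cos (IZR (m e) * ang1 (w e))).
  elim: r => [_ G _|e r IH /= /andP[er ur] G hG].
    by apply: eq_bigr => w _; rewrite !big_nil cos_0.
  rewrite (sum_flip e) [LHS](eq_bigr (fun w => Q w * (G w * cos (IZR (m e) * ang1 (w e)) *
     cos (\sum_(e' <- r) IZR (m e') * ang1 (w e'))))); last first.
    move=> w _; congr (_ * _); cbv beta; rewrite hG ?mem_head // !big_cons.
    have -> : \sum_(e' <- r) IZR (m e') * ang1 (flip e w e') = \sum_(e' <- r) IZR (m e') * ang1 (w e').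
      apply: eq_big_seq => e' he'; rewrite ffunE; case: eqP => // ee.
      by rewrite ee (negbTE er) in he'.
    move: (\sum_(e' <- r) _) => s; rewrite ffunE eqxx.
    have h : eq2pi (IZR (m e) * ang1 (- w e)%ring + s) (s - IZR (m e) * ang1 (w e)).
      have [z hz] := eq2pi_mulz (m e) (ang1N (w e)); exists z; rewrite hz; ring.
    rewrite (cos_eq2pi h) (Rplus_comm _ s) cos_plus cos_minus; field.
  rewrite (IH ur) => [|e' w he']; last first.
    rewrite hG ?inE ?he' ?orbT // ffunE; case: eqP => // ee.
    by rewrite ee he' in er.
  by apply: eq_bigr => w _; rewrite big_cons !Rmult_assoc.
transitivity (\sum_(w : noise) Q w * (1 * cos (\sum_e IZR (m e) * ang1 (w e)))).
  by apply: eq_bigr => w _; rewrite Rmult_1_l.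
rewrite (key _ (index_enum_uniq E) (fun=> 1) (fun _ _ _ => erefl)).
by apply: eq_bigr => w _; rewrite Rmult_1_l /Q -big_split.
Qed.

End ProductNoise.

(** * Estimating the spin at the origin from random phases *)

Section DisorderBound.
Variables (V : finType) (D : pred V) (b : V * V -> R) (o : V) (n : nat).
Hypothesis b_ge0 : forall e, 0 <= b e.
Hypothesis odd_n : odd n.+1.
Variables (G : finType) (S : G -> pred (V * V)) (J : R).
Hypothesis S_D : forall g e, S g e -> D e.1 || D e.2.
Hypothesis S_J : forall g e, S g e -> b e = J.
Hypothesis S_path : forall g (a : V -> R), (forall x, ~~ D x -> a x = 0) ->
  \sum_(e | S g e) (a e.1 - a e.2) = a o.

Notation conf := {ffun V -> 'I_n.+1}.
Notation noise := {ffun (V * V)%type -> 'I_n.+1}.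

(** The damping of [exp (2 i phi)] by the noise of one edge. *)
Definition rho : R := (\sum_(u : 'I_n.+1) exp (J * cos (ang1 u)) * cos (2 * ang1 u)) /
                      \sum_(u : 'I_n.+1) exp (J * cos (ang1 u)).
Hypothesis rho_gt0 : 0 < rho.

Let q (e : V * V) (u : 'I_n.+1) : R := if D e.1 || D e.2 then exp (b e * cos (ang1 u)) else 1.
Let Q (w : noise) : R := \prod_e q e (w e).
Let z (e : V * V) : R := \sum_(u : 'I_n.+1) q e u.

Let q_even e u : q e (- u)%ring = q e u.
Proof. by rewrite /q (cos_eq2pi (ang1N u)) cos_neg. Qed.

Let z_gt0 e : 0 < z e.
Proof.
have qp u : 0 < q e u by rewrite /q; case: ifP => _; [exact: exp_pos | lra].
by apply: (sumR_pos_witness (i0 := ord0)) => [u|]; [exact: Rlt_le | exact: qp].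
Qed.

Let cos2_factor g e : S g e -> \sum_(u : 'I_n.+1) q e u * cos (2 * ang1 u) = rho * z e.
Proof.
move=> hS; have hz := z_gt0 e; rewrite /rho /z /q (S_D hS) (S_J hS); rewrite /z /q (S_D hS) (S_J hS) in hz.
by field; lra.
Qed.

Let holonomy (w : noise) g : R := \sum_(e | S g e) ang1 (w e).

Let holonomyE (w : noise) g : 2 * holonomy w g = \sum_e IZR (if S g e then 2 else 0)%Z * ang1 (w e).
Proof.
rewrite /holonomy big_mkcond sumR_mull; apply: eq_bigr => e _.
by case: ifP => _; ring.
Qed.

Let gauge (k : conf) : noise := [ffun e => ((if D e.1 then k e.1 else 0) - (if D e.2 then k e.2 else 0))%ring].

Let ang1_gauge (k : conf) e : eq2pi (ang1 (gauge k e)) (ang D k e.1 - ang D k e.2).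
Proof.
rewrite ffunE; apply: (eq2pi_trans (ang1B _ _)); apply: eq2pi_sub; rewrite /ang;
  by case: ifP => _; rewrite ?ang10; exact: eq2pi_refl.
Qed.

Let c (w : noise) (e : V * V) : R := ang1 (w e).

Let wt_gauge (k : conf) (w : noise) : wt D b (c (w - gauge k)%ring) k = Q w.
Proof.
rewrite /wt /energy exp_sum /Q [RHS](bigID (fun e : V * V => D e.1 || D e.2)) /=.
rewrite [X in _ * X]big1 => [|e /negbTE he]; last by rewrite /q he.
rewrite Rmult_1_r; apply: eq_bigr => e he; rewrite /q he; congr (exp (_ * _)); apply: cos_eq2pi.
rewrite /c !ffunE.
have h1 := ang1B (w e) (gauge k e); have h2 := ang1_gauge k e.
have := eq2pi_add (eq2pi_refl (ang D k e.1 - ang D k e.2)) (eq2pi_trans h1 (eq2pi_sub (eq2pi_refl _) h2)).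
by rewrite ffunE => h; apply: (eq2pi_trans h); exists 0%Z; ring.
Qed.

Let holonomy_gauge (k : conf) (w : noise) g :
  eq2pi (holonomy (w - gauge k)%ring g + ang D k o) (holonomy w g).
Proof.
have -> : ang D k o = \sum_(e | S g e) (ang D k e.1 - ang D k e.2).
  by rewrite S_path // => x hx; rewrite /ang (negbTE hx).
rewrite /holonomy -big_split /=.
elim/big_ind2: _ => [|*|e _]; [exact: eq2pi_refl | exact: eq2pi_add |].
have h1 := ang1B (w e) (gauge k e); have h2 := ang1_gauge k e.
have := eq2pi_add (eq2pi_trans h1 (eq2pi_sub (eq2pi_refl _) h2)) (eq2pi_refl (ang D k e.1 - ang D k e.2)).
by rewrite !ffunE => h; apply: (eq2pi_trans h); exists 0%Z; ring.
Qed.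

(** The substitution [w - gauge k] absorbs the spins into the phases: the joint weight becomes the
    product weight [Q], whatever [k] is, so gauge invariant observables are averages over
    independent phases. *)
Let sum_gauge (F : noise -> conf -> R) (F0 : noise -> R) :
  (forall w k, F (w - gauge k)%ring k = F0 w) ->
  \sum_(w : noise) \sum_(k : conf) F w k * wt D b (c w) k =
  INR #|{: conf}| * \sum_(w : noise) F0 w * Q w.
Proof.
move=> h; rewrite exchange_big -sumR_const; apply: eq_bigr => k _.
rewrite (reindex (fun w : noise => (w - gauge k)%ring)) /=; last first.
  by exists (fun w : noise => (w + gauge k)%ring) => w _; [exact: GRing.subrK | exact: GRing.addrK].
by apply: eq_bigr => w _; rewrite h wt_gauge.
Qed.

(** Undoes the damping along the path, which makes the estimator unbiased. *)
Let r (g : G) : R := \prod_(e | S g e) / rho.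

Let Zq : R := \prod_e z e.

Let sum_cos1 g : r g * (\sum_(w : noise) cos (2 * holonomy w g) * Q w) = Zq.
Proof.
rewrite (eq_bigr (fun w : noise => Q w * cos (\sum_e IZR (if S g e then 2 else 0)%Z * ang1 (w e)))); last first.
  by move=> w _; rewrite holonomyE Rmult_comm.
rewrite (sum_cos_product q_even) /r big_mkcond -big_split; apply: eq_bigr => e _ /=.
case: (boolP (S g e)) => hS; first by rewrite (cos2_factor hS); field; lra.
rewrite Rmult_1_l; apply: eq_bigr => u _.
by rewrite Rmult_0_l cos_0 Rmult_1_r.
Qed.

(** On an edge of only one path, the damping [rho] is compensated by [r]; on a common edge the two
    phases cancel and the compensation [rho ^ -2] remains. *)
Let sum_cos2 g g' : r g * r g' * (\sum_(w : noise) cos (2 * holonomy w g - 2 * holonomy w g') * Q w) =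
  Zq * \prod_(e | S g e && S g' e) (/ rho) ^ 2.
Proof.
rewrite (eq_bigr (fun w : noise => Q w * cos (\sum_e IZR ((if S g e then 2 else 0) - (if S g' e then 2 else 0))%Z * ang1 (w e)))); last first.
  move=> w _; rewrite !holonomyE -sumR_sub Rmult_comm; congr (_ * cos _).
  by apply: eq_bigr => e _; rewrite minus_IZR; ring.
rewrite (sum_cos_product q_even) /r !(big_mkcond (fun e => S _ e)) (big_mkcond (fun e => S g e && S g' e)) /Zq -!big_split.
apply: eq_bigr => e _ /=.
case: (boolP (S g e)) => hS; case: (boolP (S g' e)) => hS' /=.
- rewrite (eq_bigr (q e)) -/(z e); first ring.
  by move=> u _; rewrite Rmult_0_l cos_0 Rmult_1_r.
- by rewrite (cos2_factor hS); field; lra.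
- rewrite (eq_bigr (fun u => q e u * cos (2 * ang1 u))) => [|u _]; last by rewrite -cos_neg; congr (_ * cos _); ring.
  by rewrite (cos2_factor hS'); field; lra.
- rewrite (eq_bigr (q e)) -/(z e); first ring.
  by move=> u _; rewrite Rmult_0_l cos_0 Rmult_1_r.
Qed.

(* [T1 + i T2] is the unbiased estimator of [exp (2 i a_o)] built from the phases along
   the paths [g]; Cauchy-Schwarz compares it with [mean (exp (2 i a_o))]. *)
Lemma disorder_lower_bound (C : R) : (0 < #|G|)%N -> 0 < C ->
  \sum_(g : G) \sum_(g' : G) \prod_(e | S g e && S g' e) (/ rho) ^ 2 <= C * INR #|G| ^ 2 ->
  1 <= C * mean n D b (fun=> 0) (fun a => cos (2 * a o)) ^ 2.
Proof.
move=> G0 C0 hC; set M := mean n D b _ _.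
have NG : 0 < INR #|G| by apply/lt_0_INR/ltP.
pose T1 w := \sum_g r g * cos (2 * holonomy w g).
pose T2 w := - \sum_g r g * sin (2 * holonomy w g).
set Nc := INR #|{: conf}|; have Nc0 : 0 < Nc.
  by apply: lt_0_INR; apply/ltP/card_gt0P; exists [ffun=> ord0].
have Zq0 : 0 < Zq by apply: prodR_gt0.
have eS1 : \sum_(w : noise) \sum_(k : conf) (T1 w * cos (2 * ang D k o) + T2 w * sin (2 * ang D k o)) * wt D b (c w) k
    = Nc * (Zq * INR #|G|).
  rewrite (sum_gauge (F0 := fun w => \sum_g r g * cos (2 * holonomy w g))) => [|w k].
    congr (_ * _); rewrite (eq_bigr (fun w => \sum_g r g * (cos (2 * holonomy w g) * Q w))); last first.
      by move=> w _; rewrite sumR_mulr; apply: eq_bigr => g _; ring.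
    rewrite exchange_big (eq_bigr (fun=> Zq)) => [|g _]; first by rewrite sumR_const Rmult_comm.
    by rewrite -sumR_mull sum_cos1.
  rewrite /T1 /T2 -Ropp_mult_distr_l !sumR_mulr -/(Rminus _ _) -sumR_sub; apply: eq_bigr => g _.
  have h := eq2pi_mulz 2 (holonomy_gauge k w g).
  by rewrite -(cos_eq2pi h) (Rmult_plus_distr_l 2 (holonomy _ g)) cos_plus Rmult_minus_distr_l !Rmult_assoc.
have eS2 : \sum_(w : noise) \sum_(k : conf) (T1 w ^ 2 + T2 w ^ 2) * wt D b (c w) k
    = Nc * (Zq * \sum_(g : G) \sum_(g' : G) \prod_(e | S g e && S g' e) (/ rho) ^ 2).
  have eT w : T1 w ^ 2 + T2 w ^ 2 = \sum_g \sum_g' r g * r g' * cos (2 * holonomy w g - 2 * holonomy w g').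
    rewrite (_ : T1 w ^ 2 + T2 w ^ 2 = (\sum_g r g * cos (2 * holonomy w g)) * T1 w + (\sum_g r g * sin (2 * holonomy w g)) * - T2 w); last by rewrite /T1 /T2; ring.
    rewrite !sumR_mulr -big_split; apply: eq_bigr => g _ /=.
    rewrite /T1 /T2 Ropp_involutive !sumR_mull -big_split; apply: eq_bigr => g' _ /=.
    by rewrite cos_minus; ring.
  rewrite (sum_gauge (F0 := fun w => \sum_g \sum_g' r g * r g' * cos (2 * holonomy w g - 2 * holonomy w g'))) => [|w k].
    congr (_ * _); rewrite (eq_bigr (fun w => \sum_g \sum_g' r g * r g' * (cos (2 * holonomy w g - 2 * holonomy w g') * Q w))); last first.
      by move=> w _; rewrite sumR_mulr; apply: eq_bigr => g _; rewrite sumR_mulr; apply: eq_bigr => g' _; ring.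
    rewrite exchange_big sumR_mull; apply: eq_bigr => g _.
    rewrite exchange_big sumR_mull; apply: eq_bigr => g' _.
    by rewrite -sumR_mull sum_cos2.
  rewrite eT; apply: eq_bigr => g _; apply: eq_bigr => g' _; congr (_ * _).
  have h := eq2pi_mulz 2 (holonomy_gauge k w g); have h' := eq2pi_mulz 2 (holonomy_gauge k w g').
  have e (x y t : R) : 2 * (x + t) - 2 * (y + t) = 2 * x - 2 * y by ring.
  by rewrite -(cos_eq2pi (eq2pi_sub h h')) e.
have eS0 : \sum_(w : noise) \sum_(k : conf) 1 * wt D b (c w) k = Nc * Zq.
  rewrite (sum_gauge (F0 := fun=> 1)) //; congr (_ * _); rewrite /Zq /z bigA_distr_bigA /=.
  by apply: eq_bigr => w _; rewrite Rmult_1_l.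
have [M2 eM2] : exists M2, M2 = M ^ 2 by exists (M ^ 2).
(* Parameter of [x y <= s x^2 / 2 + y^2 / (2 s)], chosen such that the second moment of the
   estimator accounts for at most half of the left side. *)
pose s := / (C * INR #|G|); have s0 : 0 < s by apply: Rinv_0_lt_compat; nra.
have main : Nc * (Zq * INR #|G|) <= s / 2 * (Nc * (Zq * \sum_(g : G) \sum_(g' : G) \prod_(e | S g e && S g' e) (/ rho) ^ 2))
    + M2 / s / 2 * (Nc * Zq).
  rewrite -eS1 -eS2 -eS0 !sumR_mull -big_split; apply: sumR_le => w _ /=.
  have -> : \sum_(k : conf) (T1 w * cos (2 * ang D k o) + T2 w * sin (2 * ang D k o)) * wt D b (c w) k =
      mean n D b (c w) (fun a => T1 w * cos (2 * a o) + T2 w * sin (2 * a o)) * pfun n D b (c w).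
    exact: mean_pfun n D b (c w) (fun a => T1 w * cos (2 * a o) + T2 w * sin (2 * a o)).
  rewrite -!sumR_mull [X in _ <= _ * (X) + _](_ : _ = (T1 w ^ 2 + T2 w ^ 2) * pfun n D b (c w)); last by rewrite /pfun sumR_mull.
  rewrite [X in _ <= _ + _ * X](_ : _ = pfun n D b (c w)); last by rewrite Rmult_1_l.
  have Zp := pfun_gt0 n D b (c w).
  rewrite -!Rmult_assoc -Rmult_plus_distr_r; apply: Rmult_le_compat_r; first lra.
  rewrite mean_add !mean_scal.
  have : mean n D b (c w) (fun a => cos (2 * a o)) * mean n D b (c w) (fun a => cos (2 * a o)) +
     mean n D b (c w) (fun a => sin (2 * a o)) * mean n D b (c w) (fun a => sin (2 * a o)) <= M2.
    rewrite eM2 /M !mean_cos2 (@mean_ext _ n D b _ (fun a => sin (2 * a o)) (fun a => sin (dot (twicev o) a))) => [|k].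
      exact: (@ginibre_modulus V n D D b b (c w) (twicev o) odd_n (fun e => conj (b_ge0 e) (Rle_refl _)) (fun x h => h)).
    by rewrite dot_twicev.
  move: (mean n D b (c w) (fun a => cos (2 * a o))) (mean n D b (c w) (fun a => sin (2 * a o))) (T1 w) (T2 w) => A B t1 t2 hAB.
  have h1 : 0 <= (s * t1 - A) ^ 2 / s by apply: Rmult_le_pos; [exact: pow2_ge_0 | exact/Rlt_le/Rinv_0_lt_compat].
  have h2 : 0 <= (s * t2 - B) ^ 2 / s by apply: Rmult_le_pos; [exact: pow2_ge_0 | exact/Rlt_le/Rinv_0_lt_compat].
  have h3 : (A * A + B * B) / s <= M2 / s by apply: Rmult_le_compat_r => //; exact/Rlt_le/Rinv_0_lt_compat.
  have e1 : (s * t1 - A) ^ 2 / s = s * t1 ^ 2 - 2 * t1 * A + A * A / s by field; lra.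
  have e2 : (s * t2 - B) ^ 2 / s = s * t2 ^ 2 - 2 * t2 * B + B * B / s by field; lra.
  have e3 : (A * A + B * B) / s = A * A / s + B * B / s by field; lra.
  by move: h1 h2 h3; rewrite e1 e2 e3; move: (A * A / s) (B * B / s) (M2 / s) => *; lra.
have h4 : s / 2 * (Nc * (Zq * \sum_(g : G) \sum_(g' : G) \prod_(e | S g e && S g' e) (/ rho) ^ 2)) <=
   s / 2 * (Nc * (Zq * (C * INR #|G| ^ 2))).
  by apply: Rmult_le_compat_l; [lra | apply: Rmult_le_compat_l; [lra | apply: Rmult_le_compat_l; lra]].
have e4 : s / 2 * (Nc * (Zq * (C * INR #|G| ^ 2))) = Nc * Zq * INR #|G| / 2 by rewrite /s; field; lra.
have e5 : M2 / s / 2 * (Nc * Zq) = Nc * Zq * INR #|G| / 2 * (C * M2) by rewrite /s; field; lra.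
have pos : 0 < Nc * Zq * INR #|G| / 2 by apply: Rmult_lt_0_compat; [apply: Rmult_lt_0_compat => //; nra | lra].
by rewrite -eM2; apply: (Rmult_le_reg_l (Nc * Zq * INR #|G| / 2)) => //; lra.
Qed.

End DisorderBound.

(** * Unpredictable paths *)

Local Close Scope bigR_scope.
Local Close Scope R_scope.

Section SlotCount.

Lemma sum_nat_mul (F : nat -> nat) a b :
  \sum_(0 <= j < a * b) F j = \sum_(0 <= r < a) \sum_(0 <= i < b) F (r * b + i).
Proof.
elim: a => [|a IH]; first by rewrite mul0n !big_geq.
rewrite (@big_cat_nat _ _ _ (a * b)) //=; last by rewrite leq_mul2r leqnSn orbT.
rewrite IH big_nat_recr //=; congr (_ + _).
rewrite -{1}[a * b]add0n big_addn mulSn addnK.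
by apply: eq_bigr => i _; rewrite addnC.
Qed.

(* Time slot [u] has level [v = v_2 (u + 1)]; slots are grouped into blocks of length
   [8 ^ v], and [rank u] numbers the level-[v] slots of a block. *)
Definition lev (u : nat) : nat := logn 2 u.+1.
Definition rank (u : nat) : nat := (u %% 8 ^ lev u) %/ 2 ^ (lev u).+1.

Lemma lev_le u : lev u <= u.
Proof.
rewrite -ltnS; apply: (@leq_trans (2 ^ lev u)); first exact: ltn_expl.
by apply: dvdn_leq => //; exact: pfactor_dvdnn.
Qed.

(** Level [v] means that [u + 1] is [2 ^ v] modulo [2 ^ v.+1], so every window of that length has
    exactly one such slot. *)
Lemma lev_slot v m i : i < 2 ^ v.+1 -> (lev (m * 2 ^ v.+1 + i) == v) = (i == (2 ^ v).-1).
Proof.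
move=> hi; have p0 : 0 < 2 ^ v by rewrite expn_gt0.
have hl k : (k <= lev (m * 2 ^ v.+1 + i)) = (2 ^ k %| m * 2 ^ v.+1 + i.+1).
  by rewrite /lev -pfactor_dvdn // -addnS.
have h1 : (v <= lev (m * 2 ^ v.+1 + i)) = (2 ^ v %| i.+1).
  by rewrite hl dvdn_addr // expnS mulnA dvdn_mull.
have h2 : (v < lev (m * 2 ^ v.+1 + i)) = (2 ^ v.+1 %| i.+1).
  by rewrite hl dvdn_addr // dvdn_mull.
rewrite eqn_leq leqNgt h1 h2; apply/andP/eqP => [[h3 /dvdnP[k hk]]|->].
  have : k * 2 ^ v <= 2 * 2 ^ v by rewrite -hk -expnS.
  rewrite leq_pmul2r // => k2; case: k hk k2 => [|[|[|//]]] //; first by rewrite mul1n => <-.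
  by rewrite -expnS => hk; rewrite hk dvdnn in h3.
rewrite prednK // dvdnn; split=> //; apply/negP => /dvdn_leq; rewrite expnS => /(_ p0).
by rewrite -{2}[2 ^ v]mul1n leq_pmul2r.
Qed.

Lemma sum_ltn_bound m delta : delta <= m -> \sum_(0 <= r < m) ((r < delta) : nat) = delta.
Proof.
move=> h; rewrite (@big_cat_nat _ _ _ delta) //= [X in _ + X]big_nat_cond [X in _ + X]big1 ?addn0; last first.
  by move=> r /andP[/andP[h1 _] _]; rewrite ltnNge h1.
rewrite big_nat_cond (eq_bigr (fun=> 1)) => [|r /andP[/andP[_ ->]] //].
by rewrite -big_nat_cond sum_nat_const_nat subn0 muln1.
Qed.

(* Within a complete block of level v, the slots of a given parity have
   half-ranks 0, 1, ..., 4^(v-1) - 1, each exactly once. *)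
Lemma block_count v b (c : bool) t delta : b.+1 * 8 ^ v <= t -> delta < 4 ^ v.-1 ->
  \sum_(0 <= u < t | [&& lev u == v, u %/ 8 ^ v == b & odd (rank u) == c]) (((rank u)./2 < delta) : nat) = delta.
Proof.
move=> ht hd; have [delta0|d0] := posnP delta; first by rewrite delta0 big1.
case: v ht hd => [|v] ht hd; first by move: d0; rewrite ltnNge -ltnS hd.
(* A block of level [v + 1] has [2 * 4 ^ v] slots of its level, half of them for each parity. *)
have e8 : 8 ^ v.+1 = (4 ^ v * 2) * 2 ^ v.+2.
  by rewrite expnS (@expnMn 4 2) !expnS; nia.
have p8 : 0 < 8 ^ v.+1 by rewrite expn_gt0.
rewrite (@big_cat_nat _ _ _ (b * 8 ^ v.+1)) //=; last first.
  by apply: leq_trans ht; rewrite leq_mul2r leqnSn orbT.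
rewrite big_nat_cond big_pred0 => [|u]; last first.
  apply/negP => /andP[/andP[_ hu] /and3P[_ /eqP hb _]].
  by move: hu; rewrite -hb ltnNge leq_divM.
rewrite add0n (@big_cat_nat _ _ _ (b.+1 * 8 ^ v.+1)) //=; last by rewrite leq_mul2r leqnSn orbT.
rewrite [X in _ + X]big_nat_cond [X in _ + X]big_pred0 ?addn0 => [|u]; last first.
  apply/negP => /andP[/andP[hu _] /and3P[_ /eqP hb _]].
  by move: hu; rewrite -leq_divRL // hb ltnn.
rewrite -{1}[b * 8 ^ v.+1]add0n big_addn mulSn addnK big_mkcond e8 sum_nat_mul.
have main r : r < 4 ^ v * 2 ->
    \sum_(0 <= i < 2 ^ v.+2) (let u := r * 2 ^ v.+2 + i + b * (4 ^ v * 2 * 2 ^ v.+2) in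
      if [&& lev u == v.+1, u %/ (4 ^ v * 2 * 2 ^ v.+2) == b & odd (rank u) == c]
      then (((rank u)./2 < delta) : nat) else 0) = if odd r == c then ((r./2 < delta) : nat) else 0.
  move=> hr; have p2 : 0 < 2 ^ v.+1 by rewrite expn_gt0.
  have hs : (2 ^ v.+1).-1 < 2 ^ v.+2 by rewrite prednK // leq_exp2l.
  rewrite big_mkord (bigD1 (Ordinal hs)) //= big1 ?addn0; last first.
    move=> i /eqP hi; case: ifP => // /and3P[]; rewrite mulnA addnAC -mulnDl lev_slot //.
    by move=> /eqP hi'; case: hi; apply/val_inj.
  set u := (_ + b * _).
  have hl : lev u = v.+1 by apply/eqP; rewrite /u mulnA addnAC -mulnDl lev_slot.
  have hj : r * 2 ^ v.+2 + (2 ^ v.+1).-1 < 8 ^ v.+1.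
    rewrite e8; apply: (@leq_trans (r.+1 * 2 ^ v.+2)); last by rewrite leq_mul2r hr orbT.
    by rewrite mulSn addnC ltn_add2r.
  have hq : u %/ 8 ^ v.+1 = b by rewrite /u -e8 divnDMl // divn_small.
  have hrk : rank u = r.
    rewrite /rank hl /u -e8 addnC modnMDl.
    by rewrite modn_small // divnMDl ?expn_gt0 // divn_small // addn0.
  by rewrite -e8 hl hq hrk !eqxx.
rewrite (eq_big_nat _ _ (F2 := fun r => if odd r == c then ((r./2 < delta) : nat) else 0)); last first.
  by move=> r /andP[_ hr]; rewrite -(main r hr).
rewrite sum_nat_mul -[RHS](@sum_ltn_bound (4 ^ v) delta (ltnW hd)); apply: eq_bigr => r _.
rewrite !big_nat_recl // big_geq // addn0 addn0 addn1 muln2 /= !odd_double /= uphalf_double doubleK.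
by case: (c); rewrite ?addn0.
Qed.
End SlotCount.

Local Open Scope R_scope.
Local Open Scope bigR_scope.

(** * Meeting probabilities of the random programs *)

Section Unpredictable.
Variable T' : nat.
Let T := T'.+1.
(** A common multiple of the moduli [4 ^ v.-1] in use, so that reducing a uniform variable leaves it
    uniform. *)
Let M := (4 ^ T)%N.
(* A program draws one independent uniform variable per level, block and parity; the
   walker moves in direction [0] or [1] (the parity of the rank) at the slots of the
   block whose half-rank is below the variable, and in direction [2] otherwise. *)
Definition slotvar : finType := ('I_T * 'I_T * bool)%type.
Definition program : finType := {ffun slotvar -> 'I_M}.
Implicit Types (g : program) (w : slotvar) (d : 'I_M) (F : program -> R).

Definition slot_of (u : nat) : slotvar := (inord (lev u), inord (u %/ 8 ^ lev u), odd (rank u)).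
Definition active g (u : nat) : bool := ((rank u)./2 < g (slot_of u) %% 4 ^ (lev u).-1)%N.
Definition steps_before g (t : nat) (c : bool) : nat :=
  (\sum_(0 <= u < t | odd (rank u) == c) (active g u : nat))%N.

Definition upd g w d : program := [ffun w' => if w' == w then d else g w'].

Lemma upd_same g w d : upd g w d w = d. Proof. by rewrite ffunE eqxx. Qed.

Lemma sum_upd (H : program -> R) w : INR M * (\sum_g H g) = \sum_g \sum_d H (upd g w d).
Proof.
have -> : INR M * (\sum_g H g) = \sum_g \sum_(d : 'I_M) H g.
  by rewrite sumR_mull; apply: eq_bigr => g _; rewrite sumR_const card_ord.
rewrite !pair_bigA /= [LHS](reindex (fun p : program * 'I_M => (upd p.1 w p.2, p.1 w))) //=.
by exists (fun p : program * 'I_M => (upd p.1 w p.2, p.1 w)) => -[g d] _ /=; rewrite upd_same;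
  congr (_, _); apply/ffunP => w'; rewrite !ffunE; case: eqP => [->|].
Qed.

Lemma count_mod (m r y : nat) : (0 < m)%N -> (m %| M)%N ->
  INR #|[pred d : 'I_M | (r + d %% m == y)%N]| <= INR M * / INR m.
Proof.
move=> m0 /dvdnP[k hk].
have k0 : (0 < k)%N by rewrite -(ltn_pmul2r m0) mul0n -hk expn_gt0.
have hm : 0 < INR m by apply/lt_0_INR/ltP.
have -> : INR M * / INR m = INR k by rewrite hk mult_INR; field; lra.
apply: le_INR; apply/leP; rewrite -[X in (_ <= X)%N]card_ord.
have hf (d : 'I_M) : (d %/ m < k)%N by rewrite ltn_divLR // -hk.
pose f (d : 'I_M) := Ordinal (hf d).
have inj : {in [pred d : 'I_M | (r + d %% m == y)%N] &, injective f}.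
  move=> d d'; rewrite !inE => /eqP h /eqP h' [hd]; apply/val_inj.
  rewrite /= (divn_eq d m) (divn_eq d' m) hd.
  by congr (_ + _)%N; apply/eqP; rewrite -(eqn_add2l r) h h'.
by rewrite -(card_in_image inj) max_card.
Qed.

(** Conditioning on all variables but [w]: [F] and [r] are then constants, and at most one residue
    of [g w] modulo [m] meets the condition. *)
Lemma slot_average F (r : program -> nat) w (m y : nat) : (0 < m)%N -> (m %| M)%N ->
  (forall g, 0 <= F g) -> (forall g d, F (upd g w d) = F g) -> (forall g d, r (upd g w d) = r g) ->
  \sum_g F g * INR (r g + g w %% m == y)%N <= / INR m * \sum_g F g.
Proof.
move=> m0 mM F0 hF hr; have M0 : 0 < INR M by apply/lt_0_INR/ltP; rewrite expn_gt0.
apply: (Rmult_le_reg_l (INR M)) => //; rewrite (sum_upd _ w) -Rmult_assoc sumR_mull.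
apply: sumR_le => g _.
rewrite (eq_bigr (fun d => F g * INR (r g + d %% m == y)%N)) => [|d _]; last by rewrite hF hr upd_same.
rewrite -sumR_mull Rmult_comm; apply: Rmult_le_compat_r => //.
apply: Rle_trans (count_mod (r g) y m0 mM); apply: Req_le.
rewrite -INR_sum -sum1_card [in RHS]big_mkcond.
by congr INR.
Qed.

Lemma active_upd g w d u : slot_of u != w -> active (upd g w d) u = active g u.
Proof. by move=> h; rewrite /active ffunE (negbTE h). Qed.

Definition steps_before_except g w t c : nat :=
  (\sum_(0 <= u < t | (odd (rank u) == c) && (slot_of u != w)) (active g u : nat))%N.

Lemma steps_before_except_upd g w d t c : steps_before_except (upd g w d) w t c = steps_before_except g w t c.
Proof. by apply: eq_bigr => u /andP[_ h]; rewrite active_upd. Qed.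

Lemma steps_before_upd g w d t c : c != w.2 -> steps_before (upd g w d) t c = steps_before g t c.
Proof.
move=> hc; apply: eq_bigr => u /eqP hu; rewrite active_upd //.
by apply: contraNneq hc => <-; rewrite /= hu.
Qed.

(** A block completed before [t] contributes exactly the reduced value of its variable, so the
    position is that variable plus a quantity independent of it. *)
Lemma steps_before_block g (v b t : nat) (c : bool) : (t <= T)%N -> (b.+1 * 8 ^ v <= t)%N ->
  steps_before g t c = (steps_before_except g (inord v, inord b, c) t c + g (inord v, inord b, c) %% 4 ^ v.-1)%N.
Proof.
move=> tT hb; set w := (_, _, c).
have p8 : (0 < 8 ^ v)%N by rewrite expn_gt0.
have vT : (v < T)%N.
  apply: leq_trans tT; apply: leq_trans hb.
  by apply: (@leq_trans (8 ^ v)); [rewrite ltn_expl | rewrite leq_pmull].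
have bT : (b < T)%N.
  by apply: leq_trans tT; apply: leq_trans hb; rewrite leq_pmulr.
have levT u : (u < t)%N -> (lev u < T)%N.
  by move=> hu; apply: leq_ltn_trans (lev_le u) _; exact: leq_trans tT.
have blT u : (u < t)%N -> (u %/ 8 ^ lev u < T)%N.
  by move=> hu; apply: leq_ltn_trans (leq_div _ _) _; exact: leq_trans tT.
have hslot u : (u < t)%N -> (slot_of u == w) = [&& lev u == v, u %/ 8 ^ v == b & odd (rank u) == c].
  move=> hu; rewrite /slot_of /w !xpair_eqE -!val_eqE /= !inordK ?levT ?blT // -andbA.
  by case: (lev u =P v) => [->|].
rewrite /steps_before (bigID (fun u => slot_of u != w)) /= -/(steps_before_except g w t c); congr (_ + _)%N.
rewrite -(@block_count v b c t (g w %% 4 ^ v.-1)%N hb); last by rewrite ltn_mod expn_gt0.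
rewrite big_nat_cond [RHS]big_nat_cond; apply: eq_big => [u|u /andP[/andP[_ hu] /andP[_ hs]]].
  case: (ltnP u t) => hu; rewrite ?andbF //= negbK hslot //.
  by case: (odd (rank u) == c); rewrite ?andbF ?andbT.
move: hs; rewrite negbK => /eqP hs; rewrite /active hs.
by have := eqxx w; rewrite -{1}hs hslot // => /and3P[/eqP -> _ _].
Qed.

(** Adaptedness: [F] is a function of the walk before time [s]. *)
Definition depends_before F (s : nat) :=
  forall g g', (forall u, (u < s)%N -> active g u = active g' u) -> F g = F g'.

Lemma depends_upd F s (v b : nat) c g d : (s <= T)%N -> (b < T)%N -> depends_before F s -> (s <= b * 8 ^ v)%N -> (v < T)%N ->
  F (upd g (inord v, inord b, c) d) = F g.
Proof.
move=> sT bT hF hs vT; apply: hF => u hu; apply: active_upd; apply/negP => /eqP.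
rewrite /slot_of => -[/(congr1 val) /= h1 /(congr1 val) /= h2 _].
move: h1 h2; rewrite !inordK //; last first.
- by apply: leq_ltn_trans (lev_le u) _; exact: leq_trans sT.
- by apply: leq_ltn_trans (leq_div _ _) _; exact: leq_trans sT.
move=> -> hb; move: hs; rewrite -hb leqNgt => /negP; apply; apply: leq_ltn_trans hu.
exact: leq_divM.
Qed.

(** The largest [v] with [2 * 8 ^ v <= k]: an interval of that length contains an aligned block of
    length [8 ^ v]. For [k < 2] the value is 0. *)
Definition lag_level (k : nat) : nat := trunc_log 8 k./2.
Definition meet_bound (k : nat) : R := 16 / 16 ^ lag_level k.

Lemma meet_bound_gt0 k : 0 < meet_bound k.
Proof. by apply: Rdiv_lt_0_compat; [lra | apply: pow_lt; lra]. Qed.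

(* The interval [[s, t)] contains a complete block of level
   [v = lag_level (t - s)]; given all other variables, the one of that block makes the number
   of steps uniform over [4 ^ (v - 1)] values in each of the two directions. *)
Lemma unpredictable F s t (y0 y1 : nat) : (s <= t)%N -> (t <= T)%N -> (forall g, 0 <= F g) ->
  depends_before F s ->
  \sum_g F g * INR ((steps_before g t false == y0) && (steps_before g t true == y1)) <= meet_bound (t - s) * \sum_g F g.
Proof.
move=> st tT F0 hF; have SF : 0 <= \sum_g F g by apply: sumR_ge0.
(* At level 0 the bound is 16 and there is nothing to prove for a probability. *)
have [l0|l0] := posnP (lag_level (t - s)).
  have -> : meet_bound (t - s) = 16 by rewrite /meet_bound l0 /=; lra.
  apply: (Rle_trans _ (\sum_g F g)); last lra.
  by apply: sumR_le => g _; have := F0 g; case: (_ && _) => /=; lra.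
(* The quotient is rounded up: [b] is the first block of level [v] that starts at [s] or later. *)
set v := lag_level (t - s) in l0; pose b := ((s + (8 ^ v).-1) %/ 8 ^ v)%N.
have p8 : (0 < 8 ^ v)%N by rewrite expn_gt0.
have h8 : (8 ^ v * 2 <= t - s)%N.
  have hpos : (0 < (t - s)./2)%N by move: l0; rewrite /v /lag_level; case: (_./2) => //; rewrite trunc_log0.
  apply: leq_trans (_ : (t - s)./2 * 2 <= t - s)%N; first by rewrite leq_pmul2r // trunc_logP.
  by rewrite muln2 -{2}(odd_double_half (t - s)) leq_addl.
have hb1 : (s <= b * 8 ^ v)%N.
  have := ltn_pmod (s + (8 ^ v).-1) p8; have := divn_eq (s + (8 ^ v).-1) (8 ^ v); rewrite -/b.
  by move: (b * _)%N (_ %% _)%N => x y; move: p8; case: (8 ^ v)%N => // e _ /= => h1 h2; rewrite -(leq_add2r e) h1 leq_add2l -ltnS.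
have hb2 : (b.+1 * 8 ^ v <= t)%N.
  have := leq_divM (s + (8 ^ v).-1) (8 ^ v); rewrite -/b mulSn => h.
  apply: (@leq_trans (8 ^ v + (s + 8 ^ v))); first by rewrite leq_add2l (leq_trans h) // leq_add2l leq_pred.
  by rewrite addnCA addnn -muln2 -(subnKC st) leq_add2l.
have vT : (v < T)%N.
  apply: leq_trans tT; apply: leq_trans hb2.
  by apply: (@leq_trans (8 ^ v)); [rewrite ltn_expl | rewrite leq_pmull].
have bT : (b < T)%N by apply: leq_trans tT; apply: leq_trans hb2; rewrite leq_pmulr.
have sT := leq_trans st tT.
pose m := (4 ^ v.-1)%N; have m0 : (0 < m)%N by rewrite expn_gt0.
have mM : (m %| M)%N by apply: dvdn_exp2l; apply: leq_trans (leq_pred v) (ltnW vT).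
have -> : meet_bound (t - s) = / INR m * / INR m.
  rewrite /meet_bound -/v -Rinv_mult -mult_INR.
  have -> : INR (m * m) = 16 ^ v / 16.
    rewrite /m -expnMn; case: v l0 {h8 hb1 hb2 vT bT p8 m m0 mM} b => // v _ _ /=.
    by rewrite INR_expn (_ : INR (4 * 4) = 16); [field | rewrite /=; ring].
  by field; apply: pow_nonzero; lra.
(* The two parities use different variables, so the steps of parity [true] act as a constant while
   the variable of parity [false] is averaged. *)
have st1 := @slot_average (fun g => F g * INR (steps_before g t true == y1)) (fun g => steps_before_except g (inord v, inord b, false) t false)
  (inord v, inord b, false) m y0 m0 mM.
have st2 := @slot_average F (fun g => steps_before_except g (inord v, inord b, true) t true)
  (inord v, inord b, true) m y1 m0 mM F0.
apply: (Rle_trans _ (/ INR m * (\sum_g F g * INR (steps_before g t true == y1)))).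
  apply: Rle_trans (st1 _ _ _).
  - apply: Req_le; apply: eq_bigr => g _; rewrite -(steps_before_block g false tT hb2).
    by case: (steps_before g t false == y0); rewrite /= ?Rmult_1_r ?Rmult_0_r.
  - by move=> g; apply: Rmult_le_pos => //; exact: pos_INR.
  - by move=> g d; rewrite (depends_upd _ _ _ sT bT hF hb1 vT) steps_before_upd.
  - by move=> g d; rewrite steps_before_except_upd.
rewrite Rmult_assoc; apply: Rmult_le_compat_l; first by apply/Rlt_le/Rinv_0_lt_compat/lt_0_INR/ltP.
apply: Rle_trans (st2 _ _).
- apply: Req_le; apply: eq_bigr => g _; by rewrite -(steps_before_block g true tT hb2).
- by move=> g d; rewrite (depends_upd _ _ _ sT bT hF hb1 vT).
- by move=> g d; rewrite steps_before_except_upd.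
Qed.

(** The [14 * 8 ^ m] lags of level [m] contribute [16 / 16 ^ m] each, together [224 / 2 ^ m]. The
    geometric series gives 448, and the lags 0 and 1 another 32. *)
Lemma meet_bound_sum_dyadic m : \sum_(0 <= k < 2 * 8 ^ m) meet_bound k <= 480 - 448 / 2 ^ m.
Proof.
elim: m => [|m IH].
  rewrite expn0 muln1 !big_nat_recl // big_geq // /meet_bound /lag_level /=; lra.
have h8 : (2 * 8 ^ m <= 2 * 8 ^ m.+1)%N by rewrite leq_pmul2l // leq_exp2l.
rewrite (@big_cat_nat _ _ _ (2 * 8 ^ m)) //=.
rewrite [X in _ + X](eq_big_nat _ _ (F2 := fun=> 16 / 16 ^ m)) => [|k /andP[k1 k2]]; last first.
  rewrite /meet_bound /lag_level (@trunc_log_eq 8 m) //.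
  by rewrite geq_half_double ltn_half_double -!mul2n k1 k2.
rewrite sumR_const_nat expnS mulnA -mulnBl mult_INR INR_expn.
have -> : 448 / 2 ^ m.+1 = 448 / 2 ^ m - 224 / 2 ^ m by rewrite /=; field; apply: pow_nonzero; lra.
have -> : INR (2 * 8 - 2) * INR 8 ^ m * (16 / 16 ^ m) = 224 / 2 ^ m.
  have -> : 16 ^ m = INR 8 ^ m * 2 ^ m by rewrite -Rpow_mult_distr; congr (_ ^ _); rewrite /=; ring.
  have -> : INR (2 * 8 - 2) = 14 by rewrite /=; ring.
  by field; split; apply: pow_nonzero; rewrite /=; lra.
lra.
Qed.

Lemma meet_bound_sum N : \sum_(0 <= k < N) meet_bound k <= 480.
Proof.
have hN : (N <= 2 * 8 ^ N)%N.
  by apply: (@leq_trans (8 ^ N)); [exact/ltnW/ltn_expl | rewrite leq_pmull].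
have := meet_bound_sum_dyadic N; rewrite (@big_cat_nat _ _ _ N) //= => h.
have : 0 <= \sum_(N <= k < 2 * 8 ^ N) meet_bound k by apply: sumR_ge0 => k _; exact/Rlt_le/meet_bound_gt0.
have : 0 < 448 / 2 ^ N by apply: Rdiv_lt_0_compat; [lra | apply: pow_lt; lra].
lra.
Qed.

Lemma meet_bound_sum_shift (s N : nat) : \sum_(0 <= t < N) (if (s < t)%N then meet_bound (t - s) else 0) <= \sum_(0 <= k < N - s) meet_bound k.
Proof.
elim: N => [|N IH]; first by rewrite !big_geq //; lra.
rewrite big_nat_recr //=; case: (ltnP s N) => h.
  by rewrite (subSn (ltnW h)) [X in _ <= X]big_nat_recr //=; lra.
apply: (Rle_trans _ (\sum_(0 <= k < N - s) meet_bound k)); first lra.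
rewrite [X in _ <= X](@big_cat_nat _ _ _ (N - s)) //=; last by rewrite leq_sub2r.
have : 0 <= \sum_(N - s <= k < N.+1 - s) meet_bound k by apply: sumR_ge0 => k _; exact/Rlt_le/meet_bound_gt0.
lra.
Qed.

Variable target : nat -> bool -> nat.
Definition meet g (t : nat) : R :=
  INR ((steps_before g t false == target t false) && (steps_before g t true == target t true)).

Definition meet_prod (a : R) g (t : nat) : R := \big[Rmult/1]_(0 <= s < t) (1 + a * meet g s).

(** The product is expanded according to the last meeting that is selected, which makes the
    remaining factor depend on the past only. *)
Lemma meet_prodE a g t : meet_prod a g t = 1 + a * \sum_(0 <= s < t) meet g s * meet_prod a g s.
Proof.
elim: t => [|t IH]; first by rewrite /meet_prod !big_geq //; ring.
rewrite {1}/meet_prod !big_nat_recr //= -/(meet_prod a g t).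
move: IH; move: (\sum_(0 <= s < t) _) => u IH; move: (meet_prod a g t) IH => p IH; nra.
Qed.

Lemma meet_ge0 g t : 0 <= meet g t. Proof. exact: pos_INR. Qed.

Lemma meet_prod_ge0 a g t : 0 <= a -> 0 <= meet_prod a g t.
Proof. by move=> a0; apply: prodR_ge0 => s _; have := meet_ge0 g s; nra. Qed.

Lemma steps_before_depends g g' s t c : (t <= s)%N -> (forall u, (u < s)%N -> active g u = active g' u) ->
  steps_before g t c = steps_before g' t c.
Proof.
move=> ts h; rewrite /steps_before big_nat_cond [RHS]big_nat_cond; apply: eq_bigr => u /andP[/andP[_ hu] _].
by rewrite h // (leq_trans hu).
Qed.

Lemma meet_prod_depends a s : depends_before (fun g => meet g s * meet_prod a g s) s.
Proof.
move=> g g' h; rewrite /meet !(steps_before_depends _ (leqnn s) h); congr (_ * _).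
rewrite /meet_prod; apply: eq_big_nat => t /andP[_ ts].
by rewrite /meet !(steps_before_depends _ (ltnW ts) h).
Qed.

(** The sums [h t] of [meet_prod] over programs that meet at [t] satisfy a renewal inequality with
    kernel [meet_bound], of total mass at most 480. Their sum [S] thus obeys [S <= 480 P + 480 a S];
    for [a <= 1/960] this gives [S <= 960 P], hence [P + a S <= 2 P]. *)
Lemma exponential_intersection_tail (a : R) (N : nat) : 0 <= a <= / 960 -> (N <= T.+1)%N ->
  \sum_g meet_prod a g N <= 2 * INR #|program|.
Proof.
move=> [a0 a1] hN; set P := INR _.
have P0 : 0 <= P by exact: pos_INR.
pose h t := \sum_g meet g t * meet_prod a g t.
have h0 t : 0 <= h t by apply: sumR_ge0 => g _; apply: Rmult_le_pos; [exact: meet_ge0 | exact: meet_prod_ge0].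
have hrec t : (t <= T)%N -> h t <= meet_bound t * P + a * \sum_(0 <= s < t) meet_bound (t - s) * h s.
  move=> tT; rewrite /h (eq_bigr (fun g => 1 * meet g t + a * \sum_(0 <= s < t) meet g s * meet_prod a g s * meet g t)); last first.
    by move=> g _; rewrite meet_prodE -sumR_mulr; ring.
  rewrite big_split /= -[X in _ + X <= _]sumR_mull [X in _ + _ * X <= _]exchange_big /=; apply: Rplus_le_compat.
    have := @unpredictable (fun=> 1) 0 t (target t false) (target t true) (leq0n t) tT (fun _ => Rle_0_1) (fun _ _ _ => erefl).
    by rewrite subn0 sumR_const Rmult_1_r.
  apply: Rmult_le_compat_l => //; rewrite big_nat_cond [X in _ <= X]big_nat_cond.
  apply: sumR_le => s /andP[/andP[_ st] _].
  apply: unpredictable => //; [exact: ltnW | | exact: meet_prod_depends].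
  by move=> g; apply: Rmult_le_pos; [exact: meet_ge0 | exact: meet_prod_ge0].
pose S := \sum_(0 <= t < N) h t.
have S0 : 0 <= S by apply: sumR_ge0.
have hS : S <= 480 * P + a * (480 * S).
  apply: (Rle_trans _ (\sum_(0 <= t < N) (meet_bound t * P + a * \sum_(0 <= s < t) meet_bound (t - s) * h s))).
    rewrite /S big_nat_cond [X in _ <= X]big_nat_cond; apply: sumR_le => t /andP[/andP[_ tN] _].
    by apply: hrec; rewrite -ltnS (leq_trans tN).
  rewrite big_split /= -sumR_mulr -sumR_mull; apply: Rplus_le_compat.
    by apply: Rmult_le_compat_r => //; exact: meet_bound_sum.
  apply: Rmult_le_compat_l => //.
  have -> : \sum_(0 <= t < N) \sum_(0 <= s < t) meet_bound (t - s) * h s =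
     \sum_(0 <= t < N) \sum_(0 <= s < N) (if (s < t)%N then meet_bound (t - s) else 0) * h s.
    apply: eq_big_nat => t /andP[_ tN]; rewrite (big_nat_widen _ _ N) /=; last exact: ltnW.
    by rewrite big_mkcond /=; apply: eq_bigr => s _; case: ifP => _; ring.
  rewrite exchange_big /= /S sumR_mull; apply: sumR_le => s _.
  rewrite -sumR_mulr; apply: Rmult_le_compat_r => //.
  exact: Rle_trans (meet_bound_sum_shift s N) (meet_bound_sum _).
have -> : \sum_g meet_prod a g N = P + a * S.
  rewrite (eq_bigr (fun g => 1 + a * \sum_(0 <= s < N) meet g s * meet_prod a g s)) => [|g _]; last exact: meet_prodE.
  by rewrite big_split /= sumR_const Rmult_1_r -sumR_mull exchange_big.
have : a * (480 * S) <= / 960 * (480 * S) by apply: Rmult_le_compat_r; lra.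
have : a * S <= / 960 * S by apply: Rmult_le_compat_r.
lra.
Qed.
End Unpredictable.

(** Integration by parts for one angle: up to [O(1/n)], the mean of [cos] is [J] times that of
    [sin ^ 2], so the latter is at most [1 / J], and [cos (2 u) = 1 - 2 sin ^ 2 u]. *)
Lemma rho_lower (J : R) : 0 < J -> exists2 C, 0 <= C & forall n, (7 < n.+1)%N ->
  1 - 2 / J - C / INR n.+1 <= rho n J.
Proof.
move=> J0; pose X := {n : nat & 'I_n.+1}; pose A (u : X) : R := ang1 (projT2 u).
have [C C0 hC] := expandable_mul (expandable_sin A 1)
  (expandable_exp (expandable_mul (expandable_const X J) (expandable_cos A 1))).
have PI0 := PI_RGT_0; have eJ := exp_pos J.
exists (2 * (C * (2 * PI) * exp J / J)).
  by apply: Rmult_le_pos; [lra | apply: Rmult_le_pos; [apply: Rmult_le_pos; [apply: Rmult_le_pos => // |]; lra | exact/Rlt_le/Rinv_0_lt_compat]].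
move=> n n7; have n0 : 0 < INR n.+1 by apply: lt_0_INR; apply/ltP.
set h := 2 * PI / INR n.+1.
have h0 : 0 < h by apply: Rdiv_lt_0_compat => //; lra.
have h1 : h <= 1.
  apply: (Rmult_le_reg_r (INR n.+1)) => //; rewrite Rmult_1_l /h.
  rewrite (_ : 2 * PI / _ * _ = 2 * PI); last by field; lra.
  have h8 : INR 8 <= INR n.+1 by apply: le_INR; apply/leP.
  have e8 : INR 8 = 8 by rewrite /=; ring.
  by have := PI_4; lra.
pose w (u : 'I_n.+1) := exp (J * cos (ang1 u)); pose Z := \sum_u w u.
have wp u : 0 < w u by exact: exp_pos.
have Zp : 0 < Z by apply: (sumR_pos_witness (i0 := ord0)) => // u; exact: Rlt_le.
have Zlow : INR n.+1 * exp (- J) <= Z.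
  rewrite -[X in INR X]card_ord -sumR_const; apply: sumR_le => u _; apply: exp_le.
  by have := COS_bound (ang1 u); nra.
pose s2 := \sum_u sin (ang1 u) ^ 2 * w u; pose c1 := \sum_u cos (ang1 u) * w u.
have hshift : \sum_(u : 'I_n.+1) sin (ang1 u + 1 * h) * exp (J * cos (ang1 u + 1 * h)) =
    \sum_(u : 'I_n.+1) sin (ang1 u) * w u.
  rewrite [RHS](reindex (fun u : 'I_n.+1 => (u + inord 1)%ring)) /=; last first.
    by exists (fun u : 'I_n.+1 => (u - inord 1)%ring) => u _; [exact: GRing.addrK | exact: GRing.subrK].
  apply: eq_bigr => u _; have : eq2pi (ang1 (u + inord 1)%ring) (ang1 u + 1 * h).
    apply: (eq2pi_trans (ang1D u (inord 1))); rewrite {2}/ang1 inordK; last by case: (n) n7.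
    by exists 0%Z; rewrite /h INR_1; field; lra.
  by move=> e; rewrite /w (cos_eq2pi e) (sin_eq2pi e).
have key : Rabs (c1 - J * s2) <= C * h * INR n.+1.
  suff : Rabs (h * (c1 - J * s2)) <= INR n.+1 * (C * h ^ 2).
    by rewrite Rabs_mult (Rabs_pos_eq h) => [hh|]; [apply: (Rmult_le_reg_l h) => //; lra | lra].
  rewrite -Rabs_Ropp (_ : - _ = \sum_(u : 'I_n.+1) (sin (ang1 u + 1 * h) * exp (J * cos (ang1 u + 1 * h)) -
      sin (ang1 u) * w u - h * (cos (ang1 u) * w u - J * (sin (ang1 u) ^ 2 * w u)))); last first.
    by rewrite !sumR_sub hshift -sumR_mull sumR_sub -sumR_mull /c1 /s2 (Rminus_diag_eq _ _ erefl) Rminus_0_l.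
  apply: (Rle_trans _ _ _ (sumR_abs _ _ _)).
  rewrite -[X in INR X * _]card_ord -sumR_const; apply: sumR_le => u _.
  have [_ _] := hC (existT _ n u) h (conj (Rlt_le _ _ h0) h1); rewrite /A /= !Rmult_0_r !Rplus_0_r.
  by congr (Rabs _ <= _); rewrite /w; ring.
have hc1 : c1 <= Z.
  apply: sumR_le => u _; have := COS_bound (ang1 u); have := wp u; nra.
have hrho : rho n J = (Z - 2 * s2) / Z.
  rewrite /rho -/Z; congr (_ / _); rewrite /Z /s2 sumR_mull -sumR_sub; apply: eq_bigr => u _.
  by rewrite cos_2a_sin /w; ring.
have hs2 : J * s2 <= Z + C * h * INR n.+1 by have := Rle_abs (- (c1 - J * s2)); rewrite Rabs_Ropp; lra.
have hnZ : INR n.+1 <= exp J * Z.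
  have : exp J * exp (- J) = 1 by rewrite -exp_plus Rplus_opp_r exp_0.
  by nra.
have hChn : C * h * INR n.+1 <= C * h * exp J * Z.
  by rewrite (Rmult_assoc (C * h)); apply: Rmult_le_compat_l => //; nra.
rewrite hrho; apply: (Rmult_le_reg_r (J * Z)); first nra.
have -> : (Z - 2 * s2) / Z * (J * Z) = J * Z - 2 * (J * s2) by field; lra.
have -> : (1 - 2 / J - 2 * (C * (2 * PI) * exp J / J) / INR n.+1) * (J * Z) =
  J * Z - 2 * Z - 2 * (C * h * exp J * Z) by rewrite /h; field; lra.
lra.
Qed.

(** * Oriented lattice paths in three dimensions *)

Section LatticeWalk.
Variable L : nat.
(** Each step raises one coordinate, and none exceeds [L] inside the box, so [3 * L + 1] steps force
    an exit. *)
Let T' := (3 * L)%N.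
Let T := T'.+1.
Notation prog := (program T').
Implicit Types g : prog.

Definition stepc g (u : nat) : 'I_3 := if active g u then (if odd (rank u) then inord 1 else ord0) else inord 2.

Definition posc g (t : nat) (c : 'I_3) : nat := (\sum_(0 <= u < t) (stepc g u == c : nat))%N.

Lemma posc_steps_before g t (c : bool) : posc g t (inord c) = steps_before g t c.
Proof.
rewrite /posc /steps_before [RHS]big_mkcond; apply: eq_bigr => u _ /=; rewrite /stepc.
have e0 : (ord0 : 'I_3) = inord false by apply/val_inj; rewrite /= inordK.
rewrite e0; case: (active g u); case: (odd (rank u)); case: c;
  by rewrite -val_eqE /= !inordK.
Qed.

Lemma sum_posc g t : (\sum_(c < 3) posc g t c)%N = t.
Proof.
rewrite exchange_big /= (eq_bigr (fun=> 1%N)) => [|u _]; first by rewrite sum_nat_const_nat subn0 muln1.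
rewrite (bigD1 (stepc g u)) //= eqxx big1 ?addn0 // => c hc.
by rewrite eq_sym (negbTE hc).
Qed.

Lemma poscS g t c : posc g t.+1 c = (posc g t c + (stepc g t == c))%N.
Proof. by rewrite /posc big_nat_recr. Qed.

(** Coordinates are clamped one step outside the box to fit in [Pt]; [walk] keeps only the steps
    that start inside, where the clamp has no effect. *)
Definition vtx g t : Pt 3 L := [ffun c => inord (L.+1 + minn (posc g t c) L.+1)%N].

Lemma vtxE g t c : vtx g t c = (L.+1 + minn (posc g t c) L.+1)%N :> nat.
Proof.
by rewrite ffunE inordK //; lia.
Qed.

Lemma inner_vtx g t : inner_box (vtx g t) = [forall c, (posc g t c <= L)%N].
Proof. by apply/innerP/forallP => h c; have := h c; rewrite vtxE; lia. Qed.

Lemma inner_vtx_sum g t : inner_box (vtx g t) -> (\sum_(c < 3) (vtx g t c - L.+1))%N = t.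
Proof.
rewrite inner_vtx => /forallP h; rewrite -[RHS](sum_posc g t); apply: eq_bigr => c _.
by have := h c; rewrite vtxE; lia.
Qed.

(** The sum of the coordinates is the time, so two oriented walks can share an interior vertex only
    at the same time. *)
Lemma inner_vtx_inj g g' t t' : inner_box (vtx g t) -> vtx g t = vtx g' t' -> t = t'.
Proof.
move=> h e; have h' := h; rewrite e in h'.
by rewrite -(inner_vtx_sum h) -(inner_vtx_sum h') e.
Qed.

Lemma inner_vtx_steps_before g g' t : inner_box (vtx g t) -> vtx g t = vtx g' t ->
  forall c : bool, steps_before g t c = steps_before g' t c.
Proof.
move=> h e c; have h' := h; rewrite e in h'.
move: h h'; rewrite !inner_vtx => /forallP /(_ (inord c)) h /forallP /(_ (inord c)) h'.
have := congr1 (fun x : Pt 3 L => x (inord c) : nat) e; rewrite /= !vtxE -!posc_steps_before; lia.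
Qed.

Lemma vtx0 g : vtx g 0 = origin 3 L.
Proof. by apply/ffunP => c; rewrite !ffunE /posc big_geq // min0n addn0. Qed.

Lemma inner_vtx_pred g t : inner_box (vtx g t.+1) -> inner_box (vtx g t).
Proof.
rewrite !inner_vtx => /forallP h; apply/forallP => c; have := h c; rewrite poscS; lia.
Qed.

Lemma inner_vtxT g : ~~ inner_box (vtx g T).
Proof.
rewrite inner_vtx; apply/negP => /forallP h.
have := sum_posc g T; rewrite !big_ord_recl big_ord0.
have := h ord0; have := h (lift ord0 ord0); have := h (lift ord0 (lift ord0 ord0)); rewrite /T /T'; lia.
Qed.

Lemma adj_vtx g t : inner_box (vtx g t) -> adj (vtx g t) (vtx g t.+1).
Proof.
rewrite inner_vtx => /forallP h; apply/adjP; exists (stepc g t); split.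
  by left; have := h (stepc g t); rewrite !vtxE poscS eqxx; lia.
by move=> c hc; apply/val_inj; rewrite /= !vtxE poscS eq_sym (negbTE hc) addn0.
Qed.

Definition walk g : seq (Pt 3 L * Pt 3 L) :=
  [seq (vtx g t, vtx g t.+1) | t <- iota 0 T & inner_box (vtx g t)].

Lemma walk_uniq g : uniq (walk g).
Proof.
rewrite map_inj_in_uniq ?filter_uniq ?iota_uniq // => t t'.
by rewrite !mem_filter => /andP[h _] _ [/(inner_vtx_inj h)].
Qed.

Lemma sum_walk g (F : Pt 3 L * Pt 3 L -> R) :
  \sum_(e | e \in walk g) F e = \sum_(0 <= t < T) (if inner_box (vtx g t) then F (vtx g t, vtx g t.+1) else 0).
Proof.
rewrite -big_uniq ?walk_uniq //= /walk big_map big_filter big_mkcond /=.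
by rewrite /index_iota subn0.
Qed.

Lemma walk_path g (a : Pt 3 L -> R) : (forall x, ~~ inner_box x -> a x = 0) ->
  \sum_(e | e \in walk g) (a e.1 - a e.2) = a (origin 3 L).
Proof.
move=> ha; rewrite sum_walk -(vtx0 g).
have tele m : \sum_(0 <= t < m) (if inner_box (vtx g t) then a (vtx g t, vtx g t.+1).1 - a (vtx g t, vtx g t.+1).2 else 0)
    = a (vtx g 0) - a (vtx g m).
  elim: m => [|m IH]; first by rewrite big_geq //; ring.
  rewrite big_nat_recr //= IH; case: ifP => h /=; first ring.
  rewrite (ha (vtx g m)) ?h // (ha (vtx g m.+1)); first ring.
  by apply/negP => /inner_vtx_pred; rewrite h.
by rewrite tele (ha (vtx g T)) ?inner_vtxT //; ring.
Qed.

Lemma walk_edge g e : e \in walk g -> inner_box e.1 /\ adj e.1 e.2.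
Proof. by case/mapP => t; rewrite mem_filter => /andP[h _] ->; split => //; exact: adj_vtx. Qed.

(** Each common edge starts at a common vertex, that is a meeting of [g] with the target given by
    [g']. *)
Lemma walk_overlap g g' (x : R) : 1 <= x ->
  \prod_(e | (e \in walk g) && (e \in walk g')) x <= meet_prod (fun t c => steps_before g' t c) (x - 1) g T.
Proof.
move=> hx.
rewrite big_mkcondr /= -big_uniq ?walk_uniq // {1}/walk big_map big_filter big_mkcond.
rewrite /meet_prod /index_iota subn0.
elim: (iota 0 T) => [|t s IH]; first by rewrite !big_nil; lra.
have nn : 0 <= \big[Rmult/1]_(t <- s) (1 + (x - 1) * meet (fun t c => steps_before g' t c) g t).
  apply: prodR_ge0 => u _; have hm := meet_ge0 (fun t c => steps_before g' t c) g u.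
  by have := Rmult_le_pos (x - 1) _ _ hm; lra.
have m0 := meet_ge0 (fun t c => steps_before g' t c) g t.
have xm : 0 <= (x - 1) * meet (fun t c => steps_before g' t c) g t by apply: Rmult_le_pos => //; lra.
rewrite !big_cons /=; case: ifP => h; last first.
  by rewrite Rmult_1_l; apply: (Rle_trans _ _ _ IH); rewrite -{1}(Rmult_1_l (\big[Rmult/1]_(_ <- s) _)); apply: Rmult_le_compat_r => //; lra.
have p0 : 0 <= \big[Rmult/1]_(t0 <- s) (if inner_box (vtx g t0) then if (vtx g t0, vtx g t0.+1) \in walk g' then x else 1 else 1).
  by apply: prodR_ge0 => u _; case: ifP => _; [case: ifP => _ |]; lra.
apply: Rmult_le_compat => //; first by case: ifP => _; lra.
case: ifP => [/mapP[t' _ [e _]]|_]; last lra.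
have tt := inner_vtx_inj h e; rewrite -tt in e.
by rewrite /meet !(inner_vtx_steps_before h e) !eqxx /=; lra.
Qed.

End LatticeWalk.

Lemma clock_magnetization_three_dimensions : exists J, 0 <= J /\ exists N, forall n L, (N <= n)%N -> odd n.+1 ->
  1 <= 2 * clock_magnetization n 3 L J ^ 2.
Proof.
(* With [J = 8000], [rho] is so close to 1 that [rho ^- 2 - 1 <= 1 / 960], the range of
   [exponential_intersection_tail]. *)
exists 8000; split; first lra.
have [|C C0 hC] := @rho_lower 8000; first lra.
(* The discretization then costs at most [1/4000], like the term [2 / J], which leaves
   [rho >= 1999/2000]. *)
have [N hN] : exists N : nat, C * 4000 < INR N.
  have [k hk] := INR_unbounded (C * 4000); exists k; exact: hk.
exists (N + 7)%N => n L hn on.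
have n7 : (7 < n.+1)%N by lia.
have n0 : 0 < INR n.+1 by apply: lt_0_INR; apply/ltP.
have hrho : 1999 / 2000 <= rho n 8000.
  apply: Rle_trans (hC n n7).
  have hnN : INR N <= INR n.+1 by apply: le_INR; apply/leP; lia.
  have : C / INR n.+1 <= / 4000.
    by apply: (Rmult_le_reg_r (INR n.+1)) => //; rewrite /Rdiv Rmult_assoc Rinv_l; lra.
  lra.
have hx : 1 <= (/ rho n 8000) ^ 2 <= 1 + / 960.
  have r1 : rho n 8000 <= 1.
    apply: (Rmult_le_reg_r (\sum_(u : 'I_n.+1) exp (8000 * cos (ang1 u)))).
      by apply: (sumR_pos_witness (i0 := ord0)) => [u|]; [exact/Rlt_le/exp_pos | exact: exp_pos].
    rewrite /rho /Rdiv Rmult_assoc Rinv_l ?Rmult_1_r ?Rmult_1_l.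
      apply: sumR_le => u _; have := exp_pos (8000 * cos (ang1 u)); have := COS_bound (2 * ang1 u); nra.
    apply: Rgt_not_eq; apply: (sumR_pos_witness (i0 := ord0)) => [u|]; [exact/Rlt_le/exp_pos | exact: exp_pos].
  have ri : rho n 8000 * / rho n 8000 = 1 by apply: Rinv_r; lra.
  have i1 : 1 <= / rho n 8000 by rewrite -Rinv_1; apply: Rinv_le_contravar; lra.
  have i2 : / rho n 8000 <= 2000 / 1999.
    by rewrite (_ : 2000 / 1999 = / (1999 / 2000)); [apply: Rinv_le_contravar; lra | field].
  by nra.
apply: (@disorder_lower_bound _ (@inner_box 3 L) (boxb 8000) (origin 3 L) n _ on (program (3 * L)) (fun g e => e \in walk g) 8000).
- by move=> e; apply: boxb_ge0; lra.
- by move=> g e /walk_edge[-> _].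
- by move=> g e /walk_edge[_ h]; rewrite /boxb h.
- exact: walk_path.
- lra.
- by apply/card_gt0P; exists [ffun=> Ordinal (expn_gt0 4 _)].
- lra.
- apply: (Rle_trans _ (\sum_(g' : program (3 * L)) 2 * INR #|program (3 * L)|)); last first.
    by rewrite sumR_const; apply: Req_le; move: (INR _) => u; ring.
  (* The second walk is fixed as a deterministic target while the first one is averaged. *)
  rewrite exchange_big.
  apply: sumR_le => g' _.
  apply: Rle_trans (@exponential_intersection_tail (3 * L) (fun t c => steps_before g' t c) ((/ rho n 8000) ^ 2 - 1) (3 * L).+1 _ _) => //; last by lra.
  by apply: sumR_le => g _; apply: walk_overlap; lra.
Qed.

(** * From wires to spins *)

Section ClockMoments.
Variable n : nat.
Implicit Types (u : 'I_n.+1) (f : 'I_n.+1 -> R).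

Lemma sum_shift1 f : \sum_(u : 'I_n.+1) f (u + inord 1)%ring = \sum_(u : 'I_n.+1) f u.
Proof.
rewrite [RHS](reindex (fun u : 'I_n.+1 => (u + inord 1)%ring)) //=.
by exists (fun u : 'I_n.+1 => (u - inord 1)%ring) => u _; [exact: GRing.addrK | exact: GRing.subrK].
Qed.

(** A shift by one step fixes the vector [(c, s)] and also rotates it by the angle [t], which is no
    multiple of [2 * PI] for these [j]; so the vector is 0. *)
Lemma sum_character (j : Z) : j <> 0%Z -> (Z.abs j <= Z.of_nat n)%Z ->
  \sum_(u : 'I_n.+1) cos (IZR j * ang1 u) = 0 /\ \sum_(u : 'I_n.+1) sin (IZR j * ang1 u) = 0.
Proof.
move=> j0 jn; have n0 : (0 < n)%N by case: (n) jn => // /=; lia.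
set c := \sum_(u : 'I_n.+1) cos (IZR j * ang1 u); set s := \sum_(u : 'I_n.+1) sin (IZR j * ang1 u).
set t := IZR j * (2 * PI / INR n.+1).
have hn : 0 < INR n.+1 by apply/lt_0_INR/ltP.
have hang u : eq2pi (IZR j * ang1 (u + inord 1)%ring) (IZR j * ang1 u + t).
  rewrite /t -Rmult_plus_distr_l; apply: eq2pi_mulz; apply: (eq2pi_trans (ang1D u (inord 1))).
  by rewrite {2}/ang1 inordK // INR_1 Rmult_1_r; exact: eq2pi_refl.
have e1 : c = c * cos t - s * sin t.
  rewrite {1}/c -sum_shift1 /c /s !sumR_mulr -sumR_sub; apply: eq_bigr => u _.
  by rewrite (cos_eq2pi (hang u)) cos_plus.
have e2 : s = s * cos t + c * sin t.
  rewrite {1}/s -sum_shift1 /c /s !sumR_mulr -big_split; apply: eq_bigr => u _ /=.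
  by rewrite (sin_eq2pi (hang u)) sin_plus.
have h1 : cos t < 1.
  have PI0 := PI_RGT_0.
  have hs : sin (t / 2) <> 0.
    have -> : t / 2 = IZR j * PI / INR n.+1 by rewrite /t; field; lra.
    have hpos (i : R) : 0 < i < INR n.+1 -> 0 < sin (i * PI / INR n.+1).
      move=> [i0 i1]; apply: sin_gt_0.
        by apply: Rdiv_lt_0_compat => //; nra.
      apply: (Rmult_lt_reg_r (INR n.+1)) => //.
      rewrite (_ : i * PI / INR n.+1 * INR n.+1 = i * PI); last by field; lra.
      by nra.
    have hjn : IZR (Z.abs j) < INR n.+1 by rewrite INR_IZR_INZ; apply: IZR_lt; lia.
    case: (Z_lt_le_dec 0 j) => hj.
      by apply: Rgt_not_eq; apply: hpos; split; [exact: IZR_lt | rewrite Z.abs_eq in hjn; [|lia]].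
    have h : 0 < sin (- IZR j * PI / INR n.+1).
      apply: hpos; rewrite -opp_IZR; split; first by apply: IZR_lt; lia.
      by rewrite Z.abs_neq in hjn.
    move: h; rewrite (_ : - IZR j * PI / INR n.+1 = - (IZR j * PI / INR n.+1)); last by field; lra.
    by rewrite sin_neg; lra.
  have -> : t = 2 * (t / 2) by field.
  by rewrite cos_2a_sin; nra.
have e3 := sin2_cos2 t; rewrite /Rsqr in e3.
have h3 : (c * c + s * s) * (1 - cos t) = 0 by nra.
have h4 : c * c + s * s = 0 by case: (Rmult_integral _ _ h3) => //; lra.
by split; nra.
Qed.

(* [f] is a trigonometric polynomial of degree at most [K] with derivative [f']:
   summation by parts against [exp (i j x)] is exact as long as no aliasing occurs. *)
Definition trig (K : Z) f f' := forall j : Z, (Z.abs j + K <= Z.of_nat n)%Z ->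
  \sum_(u : 'I_n.+1) (f' u * cos (IZR j * ang1 u) - IZR j * f u * sin (IZR j * ang1 u)) = 0 /\
  \sum_(u : 'I_n.+1) (f' u * sin (IZR j * ang1 u) + IZR j * f u * cos (IZR j * ang1 u)) = 0.

Lemma trig1 : trig 0 (fun=> 1) (fun=> 0).
Proof.
move=> j hj; case: (Z.eq_dec j 0) => [->|j0].
  by split; rewrite big1 // => u _; ring.
have [h1 h2] := sum_character j0 (ltac:(lia)).
split.
  rewrite (eq_bigr (fun u => - IZR j * sin (IZR j * ang1 u))) => [|u _]; last ring.
  by rewrite -sumR_mull h2; ring.
rewrite (eq_bigr (fun u => IZR j * cos (IZR j * ang1 u))) => [|u _]; last ring.
by rewrite -sumR_mull h1; ring.
Qed.

Let jp (j : Z) u : IZR (j + 1) * ang1 u = IZR j * ang1 u + ang1 u.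
Proof. by rewrite plus_IZR; ring. Qed.
Let jm (j : Z) u : IZR (j - 1) * ang1 u = IZR j * ang1 u - ang1 u.
Proof. by rewrite minus_IZR; ring. Qed.

Let half_add (x y z : R) : x = 0 -> y = 0 -> z = / 2 * (x + y) -> z = 0.
Proof. by move=> -> -> ->; ring. Qed.
Let half_sub (x y z : R) : x = 0 -> y = 0 -> z = / 2 * (x - y) -> z = 0.
Proof. by move=> -> -> ->; ring. Qed.

(** Multiplying by a cosine splits the frequency [j] into [j + 1] and [j - 1], at the price of one
    degree. *)
Lemma trig_cos K f f' : trig K f f' ->
  trig (K + 1) (fun u => cos (ang1 u) * f u) (fun u => cos (ang1 u) * f' u - sin (ang1 u) * f u).
Proof.
move=> h j hj; have [p1 p2] := h (j + 1)%Z (ltac:(lia)); have [m1 m2] := h (j - 1)%Z (ltac:(lia)).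
split.
  apply: (half_add p1 m1); rewrite -big_split sumR_mull; apply: eq_bigr => u _ /=.
  rewrite jp jm cos_plus cos_minus sin_plus sin_minus plus_IZR minus_IZR; field.
apply: (half_add p2 m2); rewrite -big_split sumR_mull; apply: eq_bigr => u _ /=.
rewrite jp jm cos_plus cos_minus sin_plus sin_minus plus_IZR minus_IZR; field.
Qed.

Lemma trig_sin K f f' : trig K f f' ->
  trig (K + 1) (fun u => sin (ang1 u) * f u) (fun u => sin (ang1 u) * f' u + cos (ang1 u) * f u).
Proof.
move=> h j hj; have [p1 p2] := h (j + 1)%Z (ltac:(lia)); have [m1 m2] := h (j - 1)%Z (ltac:(lia)).
split.
  apply: (half_sub p2 m2); rewrite -sumR_sub sumR_mull; apply: eq_bigr => u _ /=.
  rewrite jp jm cos_plus cos_minus sin_plus sin_minus plus_IZR minus_IZR; field.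
apply: (half_sub m1 p1); rewrite -sumR_sub sumR_mull; apply: eq_bigr => u _ /=.
rewrite jp jm cos_plus cos_minus sin_plus sin_minus plus_IZR minus_IZR; field.
Qed.

Definition moment (a b : nat) : R := \sum_(u : 'I_n.+1) cos (ang1 u) ^ a * sin (ang1 u) ^ b.

Lemma trig_monomial a b : trig (Z.of_nat (a + b)) (fun u => cos (ang1 u) ^ a * sin (ang1 u) ^ b)
  (fun u => INR b * (cos (ang1 u) ^ a.+1 * sin (ang1 u) ^ b.-1) - INR a * (cos (ang1 u) ^ a.-1 * sin (ang1 u) ^ b.+1)).
Proof.
have ext K f f' g g' : f =1 g -> f' =1 g' -> trig K f f' -> trig K g g'.
  move=> e e' h j hj; have [h1 h2] := h j hj.
  by split; [rewrite -[RHS]h1 | rewrite -[RHS]h2]; apply: eq_bigr => u _; rewrite e e'.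
elim: a => [|a IH].
  elim: b => [|b IH]; first by apply: ext trig1 => u /=; ring.
  have := trig_sin IH; rewrite addnS Nat2Z.inj_succ; apply: ext => u; first by rewrite /=; ring.
  by case: b {IH} => [|b]; rewrite ?S_INR /=; ring.
have := trig_cos IH; rewrite addSn Nat2Z.inj_succ; apply: ext => u; first by rewrite /=; ring.
by case: a {IH} => [|a]; rewrite ?S_INR /=; ring.
Qed.

Lemma moment_parts a b : (a + b <= n)%N -> INR b * moment a.+1 b.-1 = INR a * moment a.-1 b.+1.
Proof.
move=> /leP hab; have [h _] := @trig_monomial a b 0%Z (ltac:(rewrite /= ; lia)).
rewrite /moment !sumR_mull; apply: Rminus_diag_uniq; rewrite -sumR_sub -[RHS]h.
by apply: eq_bigr => u _; rewrite !Rmult_0_l cos_0; ring.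
Qed.

Lemma moment_add a b : moment a.+2 b + moment a b.+2 = moment a b.
Proof.
rewrite /moment -big_split; apply: eq_bigr => u _ /=.
have := sin2_cos2 (ang1 u); rewrite /Rsqr => h.
by rewrite -[RHS]Rmult_1_r -h; ring.
Qed.

Lemma moment_rec_l a b : (a + b + 2 <= n)%N -> moment a.+2 b * INR (a + b + 2) = INR a.+1 * moment a b.
Proof.
have <- : (a.+1 + b.+1)%N = (a + b + 2)%N by rewrite addSn addnS addn2.
move=> h; have e : INR b.+1 * moment a.+2 b = INR a.+1 * moment a b.+2 := @moment_parts a.+1 b.+1 h.
by rewrite -(moment_add a b) !plus_INR; rewrite !S_INR in e *; lra.
Qed.

Lemma moment_rec_r a b : (a + b + 2 <= n)%N -> moment a b.+2 * INR (a + b + 2) = INR b.+1 * moment a b.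
Proof.
have <- : (a.+1 + b.+1)%N = (a + b + 2)%N by rewrite addSn addnS addn2.
move=> h; have e : INR b.+1 * moment a.+2 b = INR a.+1 * moment a b.+2 := @moment_parts a.+1 b.+1 h.
by rewrite -(moment_add a b) !plus_INR; rewrite !S_INR in e *; lra.
Qed.

Lemma dfact_odd k : odd k -> dfact k = 0%N.
Proof.
elim: {k}k.+1 {-2}k (ltnSn k) => // N IH [|[|k]] //; rewrite !ltnS => hk.
by rewrite !oddS negbK => ok; rewrite dfactSS IH ?muln0 //; exact: leq_trans hk.
Qed.

Lemma dfact_oddM a b : odd (a + b) -> (dfact a * dfact b)%N = 0%N.
Proof.
rewrite oddD; case: (boolP (odd a)) => [oa _|_ ob]; first by rewrite dfact_odd.
by rewrite (dfact_odd ob) muln0.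
Qed.

Let pow_fact_gt0 h : 0 < 2 ^ h * INR (fact h).
Proof. by apply: Rmult_lt_0_compat; [apply: pow_lt; lra | exact: INR_fact_lt_0]. Qed.

Let moment_step (x y : R) (a b k : nat) (z : nat) :
  x * INR (a + b + 2) = INR k * y -> (odd (a + b) -> z = 0%N) ->
  y * (2 ^ (a + b)./2 * INR (fact (a + b)./2)) = INR n.+1 * INR z ->
  x * (2 ^ (a + b).+2./2 * INR (fact (a + b).+2./2)) = INR n.+1 * INR (k * z).
Proof.
move=> e hz hy; case: (boolP (odd (a + b))) => o.
  have y0 : y = 0.
    have := hy; rewrite (hz o) Rmult_0_r => /Rmult_integral[] //.
    by have := pow_fact_gt0 (a + b)./2; lra.
  have x0 : x = 0.
    move: e; rewrite y0 Rmult_0_r => /Rmult_integral[] // h.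
    have p0 : 0 < INR (a + b + 2) by apply/lt_0_INR/ltP; rewrite addn2.
    by rewrite h in p0; lra.
  by rewrite x0 (hz o) muln0 Rmult_0_l Rmult_0_r.
set h := (a + b)./2 in hy *.
have e2 : INR (a + b + 2) = 2 * INR h.+1.
  by rewrite -(even_halfK o) -/h addn2 -doubleS -mul2n mult_INR.
rewrite (_ : (a + b).+2./2 = h.+1) // (_ : fact h.+1 = (h.+1 * fact h)%N) // !mult_INR.
rewrite (_ : INR n.+1 * (INR k * INR z) = INR k * y * (2 ^ h * INR (fact h))); last first.
  by rewrite (Rmult_assoc (INR k)) hy; ring.
by rewrite -e e2 -tech_pow_Rmult; ring.
Qed.

(** Summation by parts and [cos ^ 2 + sin ^ 2 = 1] give the recursions of the circle moments, and
    these hold without error as long as the degree is at most [n]. *)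
Lemma moment_dfact a b : (2 <= n)%N -> (a + b <= n)%N ->
  moment a b * (2 ^ (a + b)./2 * INR (fact (a + b)./2)) = INR n.+1 * INR (dfact a * dfact b).
Proof.
move=> n2; elim: {a b}(a + b)%N.+1 {-2}a {-2}b (ltnSn (a + b)) => // N IH a b; rewrite ltnS => hN hab.
have n1 := ltnW n2.
have stepb b' : b = b'.+2 ->
    moment a b * (2 ^ (a + b)./2 * INR (fact (a + b)./2)) = INR n.+1 * INR (dfact a * dfact b).
  move=> eb; rewrite eb !addnS in hN hab *; rewrite dfactSS mulnCA; apply: (@moment_step _ (moment a b')).
  - by apply: moment_rec_r; rewrite addn2.
  - exact: dfact_oddM.
  - by apply: IH; [exact: ltnW | exact/ltnW/ltnW].
case: b hN hab stepb => [|[|b]] hN hab stepb; last exact: (stepb b).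
- case: a hN hab {stepb} => [|[|a]] hN hab.
  + rewrite /moment (eq_bigr (fun=> 1)) => [|u _]; last by rewrite /=; ring.
    by rewrite sumR_const card_ord !Rmult_1_r.
  + have := @moment_parts 0 1 n1; rewrite /= => e.
    by rewrite (_ : moment 1 0 = 0); [rewrite Rmult_0_l Rmult_0_r | lra].
  rewrite dfactSS -mulnA !addSn in hN hab *; apply: (@moment_step _ (moment a 0)).
  + by apply: moment_rec_l; rewrite addn2.
  + exact: dfact_oddM.
  + by apply: IH; [exact: ltnW | exact/ltnW/ltnW].
case: a hN hab {stepb} => [|[|a]] hN hab.
- have := @moment_parts 1 0 n1; rewrite /= => e.
  by rewrite (_ : moment 0 1 = 0); [rewrite Rmult_0_l Rmult_0_r | lra].
- have := @moment_parts 2 0 n2; rewrite /= => e.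
  by rewrite (_ : moment 1 1 = 0); [rewrite Rmult_0_l Rmult_0_r | lra].
rewrite dfactSS -mulnA !addSn in hN hab *; apply: (@moment_step _ (moment a 1)).
- by apply: moment_rec_l; rewrite addn2.
- exact: dfact_oddM.
- by apply: IH; [exact: ltnW | exact/ltnW/ltnW].
Qed.

(** Writing [cos (2 u)] as [cos ^ 2 - sin ^ 2] gives the difference of the two recursions. The
    factor obtained is the normalised color difference in [site_factor]. *)
Lemma moment_cos2 a b : (a + b + 2 <= n)%N ->
  \sum_(u : 'I_n.+1) cos (ang1 u) ^ a * sin (ang1 u) ^ b * cos (2 * ang1 u) =
  moment a b * ((INR a - INR b) / (2 * (INR (a + b)./2 + 1))).
Proof.
move=> hab; have n2 : (2 <= n)%N by apply: leq_trans hab; rewrite leq_addl.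
have -> : \sum_(u : 'I_n.+1) cos (ang1 u) ^ a * sin (ang1 u) ^ b * cos (2 * ang1 u) = moment a.+2 b - moment a b.+2.
  by rewrite /moment -sumR_sub; apply: eq_bigr => u _; rewrite cos_2a /=; ring.
have e1 := moment_rec_l hab; have e2 := moment_rec_r hab.
have p0 : 0 < INR (a + b + 2) by apply: lt_0_INR; apply/ltP; rewrite addn2.
apply: (Rmult_eq_reg_r (INR (a + b + 2))); last lra.
rewrite Rmult_minus_distr_r e1 e2 !S_INR.
case: (boolP (odd (a + b))) => o.
  have := moment_dfact n2 (leq_trans (leq_addr 2 _) hab); rewrite (dfact_oddM o) Rmult_0_r => /Rmult_integral[->|h]; first ring.
  by have := pow_fact_gt0 (a + b)./2; lra.
have -> : INR (a + b + 2) = 2 * (INR (a + b)./2 + 1).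
  by rewrite -S_INR -{1}(even_halfK o) addn2 -doubleS -mul2n mult_INR.
by have := pos_INR (a + b)./2 => ?; field; lra.
Qed.
End ClockMoments.

(** * The exact identity between wires and spins *)

Section Assembly.
Variables (T : finType) (inner : pred T) (Ed : finType) (inc : Ed -> T -> bool) (N : nat).
Variables (src tgt : Ed -> T).
Hypothesis incE : forall e x, inc e x = (x == src e) || (x == tgt e).
Hypothesis src_tgt : forall e, src e != tgt e.
Hypothesis inner_src : forall e, inner (src e).

Notation link := (link Ed N).
Notation hlink := (hlink T Ed N).
Notation coloring := {ffun link -> bool}.
Notation pairing := {ffun hlink -> hlink}.

Section Counting.
Variables (m : cfg Ed N) (c : coloring).

Definition halves : {set hlink} := [set h : hlink | valid_hl inner inc m h].
Definition cnt (k : T * bool) : nat := #|[set h in halves | (h.2, c h.1) == k]|.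

Lemma card_pairings :
  #|[set p : pairing | is_pairing inner inc m p && compatible inner inc m p c]| =
  (\prod_(x : T) (dfact (cnt (x, true)) * dfact (cnt (x, false))))%N.
Proof.
have -> : (\prod_(x : T) (dfact (cnt (x, true)) * dfact (cnt (x, false))))%N = (\prod_(k : T * bool) dfact (cnt k))%N.
  rewrite (eq_bigr (fun k => dfact (cnt (k.1, k.2)))) => [|[x b] _ //].
  rewrite -(pair_bigA _ (fun x b => dfact (cnt (x, b)))) /=.
  by apply: eq_bigr => x _; rewrite big_bool.
rewrite -card_fpairing; apply: eq_card => p; rewrite !inE.
apply/andP/forallP => [[/forallP h1 /forallP h2] h|h].
  have := h1 h; have := h2 h; rewrite /= [h \in _]inE; case: ifP => //= hv hc /and4P[q1 q2 q3 q4].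
  by rewrite inE q1 q3 q4 xpair_eqE q2 hc.
split; apply/forallP => h'; have := h h'; rewrite [h' \in _]inE; case: ifP => //= hv.
  by rewrite inE xpair_eqE => /and4P[-> /andP[-> _] -> ->].
by rewrite inE xpair_eqE => /and4P[_ /andP[_ ->] _ _].
Qed.

Lemma sum_lt_ord (j : 'I_N.+1) : (\sum_(i < N) ((i < j)%N : nat))%N = j.
Proof.
have hj : (j <= N)%N by rewrite -ltnS.
rewrite -(big_mkord xpredT (fun i => ((i < j)%N : nat))) (@big_cat_nat _ _ _ j) //=.
rewrite [X in (_ + X)%N]big_nat_cond [X in (_ + X)%N]big1 ?addn0; last first.
  by move=> i /andP[/andP[h _] _]; rewrite ltnNge h.
rewrite big_nat_cond (eq_bigr (fun=> 1%N)) => [|i /andP[/andP[_ ->]] //].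
by rewrite -big_nat_cond sum_nat_const_nat subn0 muln1.
Qed.

Lemma card_valid : #|[pred l : link | valid_link m l]| = (\sum_(e : Ed) (m e : nat))%N.
Proof.
rewrite -sum1_card big_mkcond /= -(pair_bigA _ (fun e i => if valid_link m (e, i) then 1 else 0)%N) /=.
by apply: eq_bigr => e _; rewrite -[RHS]sum_lt_ord; apply: eq_bigr => i _; rewrite /valid_link /=; case: ifP.
Qed.

Lemma card_halves_at x : #|[set h in halves | h.2 == x]| =
  (if inner x then \sum_(e | inc e x) (m e : nat) else 0)%N.
Proof.
rewrite -sum1_card big_mkcond /=.
rewrite (eq_bigr (fun h : hlink => if (inc h.1.1 h.2 && valid_link m h.1) && (inner h.2 && (h.2 == x)) then 1 else 0)%N); last first.
  by move=> h _; rewrite !inE /valid_hl !andbA.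
rewrite -(pair_bigA _ (fun l y => if (inc l.1 y && valid_link m l) && (inner y && (y == x)) then 1 else 0)%N) /=.
rewrite (eq_bigr (fun l : link => if [&& inc l.1 x, valid_link m l & inner x] then 1 else 0)%N); last first.
  move=> l _; rewrite (bigD1 x) //= eqxx andbT -andbA big1 ?addn0 // => y /negbTE ->.
  by rewrite !andbF.
case: (inner x); last by rewrite big1 // => l _; rewrite !andbF.
rewrite -(pair_bigA _ (fun e i => if [&& inc e x, valid_link m (e, i) & true] then 1 else 0)%N) /= big_mkcond /=.
rewrite [RHS]big_mkcond; apply: eq_bigr => e _; case: (inc e x); last by rewrite big1.
by rewrite -[RHS]sum_lt_ord; apply: eq_bigr => i _; rewrite /valid_link /= andbT; case: ifP.
Qed.

Lemma cnt_sum x : (cnt (x, true) + cnt (x, false))%N =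
  (if inner x then \sum_(e | inc e x) (m e : nat) else 0)%N.
Proof.
rewrite -card_halves_at -(cardsID [set h : hlink | c h.1] [set h in halves | h.2 == x]).
congr (_ + _)%N; apply: eq_card => h; rewrite !inE xpair_eqE;
  by case: (c h.1); rewrite ?andbF ?andbT.
Qed.

Lemma nsiteE x : inner x -> nsite inc m x = (cnt (x, true) + cnt (x, false))./2.
Proof. by move=> h; rewrite cnt_sum h. Qed.

Lemma cnt_le x : (cnt (x, true) + cnt (x, false) <= #|Ed| * N)%N.
Proof.
rewrite cnt_sum; case: ifP => // _; apply: (@leq_trans (\sum_(e : Ed) N)); last by rewrite sum_nat_const.
by rewrite big_mkcond; apply: leq_sum => e _; case: ifP => // _; rewrite -ltnS.
Qed.

Lemma prod_halves (F : link -> T -> R) :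
  \prod_(h in halves) F h.1 h.2 =
  \prod_(l | valid_link m l) (F l (src l.1) * (if inner (tgt l.1) then F l (tgt l.1) else 1)).
Proof.
rewrite big_mkcond /= (eq_bigr (fun h : hlink => if valid_hl inner inc m (h.1, h.2) then F h.1 h.2 else 1)); last first.
  by move=> [l x] _; rewrite inE.
rewrite -(pair_bigA _ (fun l x => if valid_hl inner inc m (l, x) then F l x else 1)) /= [RHS]big_mkcond /=.
apply: eq_bigr => l _; rewrite /valid_hl /=; case: (valid_link m l); last first.
  by rewrite big1 // => x _; rewrite andbF.
rewrite (bigD1 (src l.1)) //= incE eqxx inner_src /=; congr (_ * _).
rewrite (bigD1 (tgt l.1)) /=; last by rewrite eq_sym src_tgt.
rewrite incE eqxx orbT /= big1 ?Rmult_1_r // => x /andP[/negbTE h1 /negbTE h2].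
by rewrite incE h1 h2.
Qed.

End Counting.

Section Observable.
Variables (o : T) (ob : bool).
Hypothesis inner_o : inner o.

(* [ob = true] selects the observable [n~_o / (n_o + 1)], [ob = false] the partition
   function. *)
Definition site_factor (m : cfg Ed N) (c : coloring) (x : T) : R :=
  if ob && (x == o) then (INR (cnt m c (x, true)) - INR (cnt m c (x, false))) /
                        (2 * (INR (cnt m c (x, true) + cnt m c (x, false))./2 + 1)) else 1.

Definition wire_obs (m : cfg Ed N) (p : pairing) : R :=
  if ob then INR (ntilde inner inc m p o) / (INR (nsite inc m o) + 1) else 1.

Section FixedPairing.
Variables (m : cfg Ed N) (p : pairing).
Hypothesis hp : is_pairing inner inc m p.
Let good (c : coloring) := compatible inner inc m p c && boundary_true inner inc m c.
Let nc := n_comp (lrel p) (closed_valid inner inc m p).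

Lemma INR_card_good : INR (2 ^ nc) = \sum_(c : coloring | good c) 1.
Proof. by rewrite sumR_const Rmult_1_r -(card_good hp) cardsE. Qed.

Definition color_sign (b : bool) : R := if b then 1 else -1.

Lemma cnt_diff c x : INR (cnt m c (x, true)) - INR (cnt m c (x, false)) =
  \sum_(h | (h \in halves m) && (h.2 == x)) color_sign (c h.1).
Proof.
have e b : INR (cnt m c (x, b)) = \sum_(h | (h \in halves m) && (h.2 == x)) (if c h.1 == b then 1 else 0).
  rewrite -big_mkcondr sumR_const Rmult_1_r /cnt; congr INR; apply: eq_card => h.
  by rewrite !inE xpair_eqE andbA [RHS]unfold_in inE.
by rewrite !e -sumR_sub; apply: eq_bigr => h _; rewrite /color_sign; case: (c h.1) => /=; ring.
Qed.

Lemma good_open c l : good c -> valid_link m l -> open_link inner inc m p l -> c l.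
Proof.
rewrite /good (good_coloring hp) => /comp_coloringP[_ h] hv ho; apply: h.
by rewrite /closed_valid hv ho.
Qed.

(** Flipping the color of the closed loop through [l] is an involution of the good colorings that
    reverses the sign. *)
Lemma sum_sign_closed l : closed_valid inner inc m p l -> \sum_(c : coloring | good c) color_sign (c l) = 0.
Proof.
move=> hl; pose fl (c : coloring) : coloring := [ffun l' => if connect (lrel p) l l' then ~~ c l' else c l'].
have cs := sym_connect_sym (lrel_sym p).
have flK : involutive fl.
  by move=> c; apply/ffunP => l'; rewrite !ffunE; case: (connect _ _ _); rewrite ?negbK.
have ccl l1 l2 : lrel p l1 l2 -> connect (lrel p) l l1 = connect (lrel p) l l2.
  by move=> h; rewrite (same_connect_r cs (connect1 h)).
have clo := closed_closed hp.
have gfl c : good (fl c) = good c.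
  have one d : good d -> good (fl d).
    rewrite /good !(good_coloring hp) => /comp_coloringP[h1 h2]; apply/comp_coloringP; split.
      by move=> l1 l2 hl1 h12; rewrite !ffunE (ccl _ _ h12) (h1 _ _ hl1 h12).
    move=> l1 hl1; rewrite ffunE; case: ifP => hc; last exact: h2.
    by have := closed_connect clo hc; rewrite /in_mem /= hl (negbTE hl1).
  by apply/idP/idP => [/one|]; [rewrite flK | exact: one].
have e : \sum_(c : coloring | good c) color_sign (c l) = - \sum_(c : coloring | good c) color_sign (c l).
  rewrite {1}(reindex_inj (inv_inj flK)) /= sumR_opp; apply: eq_big => [c|c _]; first exact: gfl.
  by rewrite ffunE connect0 /color_sign; case: (c l) => /=; lra.
lra.
Qed.

Lemma ntilde_card : (2 * ntilde inner inc m p o)%N =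
  #|[set h | (h \in halves m) && (h.2 == o) & open_link inner inc m p h.1]|.
Proof.
set A := [set h | _ & _].
have hA : #|[pred h : hlink | [&& valid_hl inner inc m h, h.2 == o & open_link inner inc m p h.1]]| = #|A|.
  by apply: eq_card => h; rewrite !inE andbA.
have even : ~~ odd #|A|.
  rewrite (@card_involution _ A p) ?mul2n ?odd_double // => h; rewrite !inE => /andP[/andP[h1 h2] h3].
  have [q1 q2 q3 q4] := pairing_in hp h1; rewrite q1 q2 h2 q3 q4; split=> //=.
  by rewrite -(open_link_connect _ _ _ (connect1 (lrel_pair p h))).
by rewrite /ntilde hA mul2n even_halfK.
Qed.

(** In the color difference at [o], ends on closed loops average to 0 and ends on open loops always
    count 1, which leaves [2 * ntilde]. *)
Lemma obs_colors : wire_obs m p * INR (2 ^ nc) = \sum_(c : coloring | good c) site_factor m c o.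
Proof.
rewrite /wire_obs /site_factor eqxx andbT; case: ob; last by rewrite Rmult_1_l INR_card_good.
have hn c : (cnt m c (o, true) + cnt m c (o, false))./2 = nsite inc m o by rewrite (nsiteE m c).
set d := INR (nsite inc m o) + 1.
have d0 : 0 < d by have := pos_INR (nsite inc m o); rewrite /d; lra.
rewrite (eq_bigr (fun c : coloring => \sum_(h | (h \in halves m) && (h.2 == o)) color_sign (c h.1) * / (2 * d))); last first.
  by move=> c _; rewrite hn cnt_diff -/d /Rdiv sumR_mulr.
rewrite exchange_big /= (bigID (fun h : hlink => open_link inner inc m p h.1)) /=.
rewrite [X in _ = _ + X]big1 => [|h /andP[/andP[]]]; last first.
  rewrite inE => hv _ ho; rewrite -sumR_mulr sum_sign_closed ?Rmult_0_l //.
  by rewrite /closed_valid ho andbT; case/and3P: hv.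
rewrite (eq_bigr (fun=> INR (2 ^ nc) * / (2 * d))) => [|h /andP[/andP[]]]; last first.
  rewrite inE => hv _ ho; rewrite INR_card_good sumR_mulr; apply: eq_bigr => c hc.
  by rewrite (good_open hc) //; case/and3P: hv.
rewrite sumR_const (_ : #|_| = (2 * ntilde inner inc m p o)%N); last first.
  by rewrite ntilde_card; apply: eq_card => h; rewrite [RHS]in_set.
by rewrite mult_INR [INR 2]/=; field; lra.
Qed.

Hypothesis hm : even_cfg inner inc m.

(** Distributes the powers of 2: one per link turns [J] into [2 * J], [2 ^ nc] counts the good
    colorings, and [2 ^ nsite] belongs to the spin average at each site. *)
Lemma loops_count : (nloops m p + \sum_(x | inner x) nsite inc m x = #|[pred l : link | valid_link m l]| + nc)%N.
Proof.
have h := loops_identity incE src_tgt inner_src hp.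
rewrite (nloops_split inner inc m p) -/nc.
have eA : #|[set h : hlink | valid_hl inner inc m h]| = (2 * \sum_(x | inner x) nsite inc m x)%N.
  rewrite -sum1_card (partition_big (fun h : hlink => h.2) inner) /=; last first.
    by move=> h'; rewrite inE => /and3P[].
  rewrite big_distrr; apply: eq_bigr => x hx /=.
  rewrite mul2n /nsite even_halfK; last by have := forallP hm x; rewrite hx.
  have := card_halves_at m x; rewrite hx => <-; rewrite sum1_card.
  by apply: eq_card => h2; rewrite [LHS]unfold_in !inE.
by move: h; rewrite eA -mulnDr => /eqP; rewrite eqn_pmul2l // => /eqP <-; rewrite addnAC.
Qed.

End FixedPairing.

Variables (n : nat) (J : R).
Hypothesis hn : (#|Ed| * N + 2 <= n)%N.
Notation conf := {ffun T -> 'I_n.+1}.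

Definition site_fun m c x (u : 'I_n.+1) : R :=
  if inner x then cos (ang1 u) ^ cnt m c (x, true) * sin (ang1 u) ^ cnt m c (x, false) *
    (if ob && (x == o) then cos (2 * ang1 u) else 1) else 1.

Definition site_avg m c x : R := \sum_(u : 'I_n.+1) site_fun m c x u * / INR n.+1.

(** By [hn] there is no aliasing: a site has at most [#|Ed| * N] half-links, and the observable adds
    2 to the degree. *)
Lemma site_avgE m c x : site_avg m c x = INR (dfact (cnt m c (x, true)) * dfact (cnt m c (x, false))) *
  (if inner x then / (2 ^ nsite inc m x * INR (fact (nsite inc m x))) else 1) * site_factor m c x.
Proof.
have n0 : INR n.+1 <> 0 by exact: INR_nS_neq0.
rewrite /site_avg -sumR_mulr /site_fun; case: (boolP (inner x)) => hx; last first.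
  have := cnt_sum m c x; rewrite (negbTE hx) => /eqP; rewrite addn_eq0 => /andP[/eqP -> /eqP ->].
  rewrite /site_factor (_ : x == o = false) ?andbF; last by apply: contraNF hx => /eqP ->.
  by rewrite sumR_const card_ord muln1 /=; field.
set a := cnt m c (x, true); set b := cnt m c (x, false).
have hab : (a + b + 2 <= n)%N by apply: leq_trans hn; rewrite leq_add2r; exact: cnt_le.
have n2 : (2 <= n)%N by apply: leq_trans hab; rewrite leq_addl.
have hM := moment_dfact n2 (leq_trans (leq_addr 2 _) hab).
rewrite (nsiteE m c hx) -/a -/b.
have p0 : 2 ^ (a + b)./2 <> 0 by apply: pow_nonzero; lra.
have f0 := INR_fact_neq_0 (a + b)./2.
have eM : moment n a b * / INR n.+1 = INR (dfact a * dfact b) * / (2 ^ (a + b)./2 * INR (fact (a + b)./2)).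
  apply: (Rmult_eq_reg_r (INR n.+1 * (2 ^ (a + b)./2 * INR (fact (a + b)./2)))).
    have -> : moment n a b * / INR n.+1 * (INR n.+1 * (2 ^ (a + b)./2 * INR (fact (a + b)./2))) =
      moment n a b * (2 ^ (a + b)./2 * INR (fact (a + b)./2)) by field.
    by rewrite hM; field.
  by apply: Rmult_integral_contrapositive_currified => //; apply: Rmult_integral_contrapositive_currified.
rewrite -eM /site_factor; case: ifP => _; last first.
  by rewrite Rmult_1_r; congr (_ * _); apply: eq_bigr => u _; rewrite Rmult_1_r.
by rewrite (moment_cos2 hab) -/a -/b; ring.
Qed.

Lemma prod_fac m c : \prod_(x : T) site_factor m c x = site_factor m c o.
Proof.
rewrite (bigD1 o) //= big1 ?Rmult_1_r // => x hx.
by rewrite /site_factor (negbTE hx) andbF.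
Qed.

Let J_weight (m : cfg Ed N) : R := \prod_(e : Ed) (J ^ (m e) / INR (fact (m e))).

(** Each pairing is expanded into its good colorings. Exchanging the sums leaves, for a coloring,
    the number of compatible pairings, a product over sites that [site_avgE] identifies with spin
    averages. *)
Lemma pairing_sum m : even_cfg inner inc m ->
  \sum_(p : pairing | is_pairing inner inc m p)
     wire_obs m p * weight inner inc 2 (fun=> J) (fun k => / INR (fact k)) m p =
  J_weight m * 2 ^ #|[pred l : link | valid_link m l]| *
    \sum_(c : coloring | boundary_true inner inc m c) \prod_(x : T) site_avg m c x.
Proof.
move=> hm; set V := #|_|.
set Pi := \prod_(x : T) (if inner x then / (2 ^ nsite inc m x * INR (fact (nsite inc m x))) else 1).
transitivity (\sum_(p : pairing | is_pairing inner inc m p)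
   \sum_(c : coloring | compatible inner inc m p c && boundary_true inner inc m c) J_weight m * 2 ^ V * Pi * site_factor m c o).
  apply: eq_bigr => p hp; rewrite -sumR_mull -(obs_colors hp) /weight -/(J_weight m).
  have hl := loops_count hp hm; rewrite -/V in hl.
  have e1 : 2 ^ nloops m p * \prod_(x | inner x) 2 ^ nsite inc m x = 2 ^ V * INR (2 ^ n_comp (lrel p) (closed_valid inner inc m p)).
    by rewrite -pow_sum -pow_add plusE hl -plusE pow_add INR_expn.
  have e2 : \prod_(x | inner x) / INR (fact (nsite inc m x)) = (\prod_(x | inner x) 2 ^ nsite inc m x) * Pi.
    rewrite /Pi -big_mkcond -big_split; apply: eq_bigr => x _ /=; field.
    by split; [exact: INR_fact_neq_0 | apply: pow_nonzero; lra].
  rewrite e2.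
  have -> : wire_obs m p * (2 ^ nloops m p * J_weight m * ((\prod_(x | inner x) 2 ^ nsite inc m x) * Pi)) =
     wire_obs m p * J_weight m * Pi * (2 ^ nloops m p * \prod_(x | inner x) 2 ^ nsite inc m x) by ring.
  by rewrite e1; ring.
rewrite (exchange_big_dep (boundary_true inner inc m)) /=; last by move=> p c _ /andP[].
rewrite sumR_mull; apply: eq_bigr => c hc.
rewrite (eq_bigl (fun p : pairing => is_pairing inner inc m p && compatible inner inc m p c)) => [|p]; last by rewrite hc andbT.
rewrite sumR_const.
have -> : #|[pred p : pairing | is_pairing inner inc m p && compatible inner inc m p c]| =
   (\prod_(x : T) (dfact (cnt m c (x, true)) * dfact (cnt m c (x, false))))%N.
  by rewrite -card_pairings cardsE.
rewrite (eq_bigr _ (fun x _ => site_avgE m c x)) INR_prod !big_split /= prod_fac -/Pi.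
ring.
Qed.

Lemma not_even_zero m c : ~~ even_cfg inner inc m -> \prod_(x : T) site_avg m c x = 0.
Proof.
rewrite negb_forall => /existsP[x]; rewrite negb_imply negbK => /andP[hx ho].
rewrite (bigD1 x) //= site_avgE dfact_oddM ?Rmult_0_l //; last by rewrite cnt_sum hx.
Qed.

Definition spin_obs (k : conf) : R := if ob then cos (2 * ang inner k o) else 1.

Lemma prod_site_fun m c (k : conf) : \prod_(x : T) site_fun m c x (k x) =
  spin_obs k * \prod_(h in halves m) (if c h.1 then cos (ang inner k h.2) else sin (ang inner k h.2)).
Proof.
rewrite (partition_big (fun h : hlink => (h.2, c h.1)) predT) //=.
rewrite (eq_bigr (fun y : T * bool => (if y.2 then cos (ang inner k y.1) else sin (ang inner k y.1)) ^ cnt m c (y.1, y.2))); last first.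
  move=> [x b] _ /=; rewrite (eq_bigr (fun=> if b then cos (ang inner k x) else sin (ang inner k x))).
    by rewrite prodR_const /cnt; congr (_ ^ _); apply: eq_card => h; rewrite [RHS]inE.
  by move=> h /andP[_ /eqP[-> ->]].
rewrite -(pair_bigA _ (fun x b => (if b then cos (ang inner k x) else sin (ang inner k x)) ^ cnt m c (x, b))) /=.
have -> : spin_obs k = \prod_(x : T) (if ob && (x == o) then cos (2 * ang inner k x) else 1).
  rewrite (bigD1 o) //= eqxx andbT big1 => [|x /negbTE ->]; last by rewrite andbF.
  by rewrite Rmult_1_r.
rewrite -big_split; apply: eq_bigr => x _; rewrite big_bool /site_fun /= /ang.
case: (boolP (inner x)) => hx; first by ring.
have := cnt_sum m c x; rewrite (negbTE hx) => /eqP; rewrite addn_eq0 => /andP[/eqP -> /eqP ->].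
rewrite (_ : x == o = false) ?andbF /=; first ring.
by apply: contraNF hx => /eqP ->.
Qed.

(** Links are colored independently, and the two colors of a link add up to the cosine of the angle
    difference. On a boundary link the missing color would contribute [sin 0]. *)
Lemma sum_colorings m (k : conf) :
  \sum_(c : coloring | boundary_true inner inc m c)
    \prod_(h in halves m) (if c h.1 then cos (ang inner k h.2) else sin (ang inner k h.2)) =
  \prod_(l : link) (if valid_link m l then cos (ang inner k (src l.1) - ang inner k (tgt l.1)) else 1).
Proof.
pose F (l : link) (b : bool) : R := if valid_link m l then
  (if b then cos (ang inner k (src l.1)) * cos (ang inner k (tgt l.1)) else sin (ang inner k (src l.1)) * sin (ang inner k (tgt l.1)))
  else (if b then 1 else 0).
transitivity (\prod_(l : link) \sum_(b : bool) F l b); last first.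
  apply: eq_bigr => l _; rewrite big_bool /F; case: ifP => _ /=; last ring.
  by rewrite cos_minus.
rewrite bigA_distr_bigA /= big_mkcond; apply: eq_bigr => c _; case: ifP => hb.
  rewrite (prod_halves m (fun l x => if c l then cos (ang inner k x) else sin (ang inner k x))) big_mkcond.
  apply: eq_bigr => l _; rewrite /F; have := forallP hb l; case: ifP => hv /=; last by move=> ->.
  case: (boolP (inner (tgt l.1))) => ht; first by case: (c l).
  have -> : bdry_link inner inc l by apply/existsP; exists (tgt l.1); rewrite incE eqxx orbT ht.
  by move=> /= ->; rewrite /ang (negbTE ht) cos_0.
move/negbT: hb; rewrite negb_forall => /existsP[l]; rewrite negb_imply => /andP[hl hc].
rewrite (bigD1 l) //= /F (negbTE hc); case: ifP hl => hv /= hl; last by rewrite Rmult_0_l.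
have /negbTE ht : ~~ inner (tgt l.1).
  case/existsP: hl => y; rewrite incE => /andP[/orP[] /eqP ->] //.
  by rewrite inner_src.
by rewrite {2}/ang ht sin_0; ring.
Qed.

Lemma prod_links m (F : Ed -> R) :
  \prod_(l : link) (if valid_link m l then F l.1 else 1) = \prod_(e : Ed) F e ^ (m e).
Proof.
rewrite -(pair_bigA _ (fun e i => if valid_link m (e, i) then F e else 1)) /=.
apply: eq_bigr => e _; rewrite -(sum_lt_ord (m e)) pow_sum; apply: eq_bigr => i _.
by rewrite /valid_link /=; case: ifP => _ /=; rewrite ?Rmult_1_r.
Qed.

Lemma colors_to_spins m :
  \sum_(c : coloring | boundary_true inner inc m c) \prod_(x : T) site_avg m c x =
  (\sum_(k : conf) spin_obs k * \prod_(e : Ed) cos (ang inner k (src e) - ang inner k (tgt e)) ^ (m e)) *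
  / INR #|{: conf}|.
Proof.
rewrite (eq_bigr (fun c : coloring => (\sum_(k : conf) spin_obs k *
   \prod_(h in halves m) (if c h.1 then cos (ang inner k h.2) else sin (ang inner k h.2))) * / INR #|{: conf}|)); last first.
  move=> c _; rewrite /site_avg bigA_distr_bigA /= sumR_mulr; apply: eq_bigr => k _.
  rewrite big_split /= prod_site_fun prodR_const; congr (_ * _).
  by rewrite card_ffun card_ord INR_expn pow_inv; congr (/ (_ ^ _)); apply: eq_card.
rewrite -sumR_mulr exchange_big /=; congr (_ * _); apply: eq_bigr => k _.
rewrite -sumR_mull sum_colorings.
by rewrite (prod_links m (fun e => cos (ang inner k (src e) - ang inner k (tgt e)))).
Qed.

Lemma E1_big (x : R) (M : nat) : E1 x M = \sum_(i < M.+1) / INR (fact i) * x ^ i.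
Proof.
rewrite /E1; elim: M => [|M IH]; first by rewrite big_ord_recl big_ord0 Rplus_0_r.
by rewrite big_ord_recr /= -IH.
Qed.

Theorem wire_spin :
  wsum inner inc 2 (fun=> J) (fun k => / INR (fact k)) wire_obs =
  (\sum_(k : conf) spin_obs k *
     \prod_(e : Ed) E1 (2 * J * cos (ang inner k (src e) - ang inner k (tgt e))) N) / INR #|{: conf}|.
Proof.
rewrite /wsum; transitivity (\sum_(m : cfg Ed N) J_weight m * 2 ^ #|[pred l : link | valid_link m l]| *
    \sum_(c : coloring | boundary_true inner inc m c) \prod_(x : T) site_avg m c x).
  rewrite [LHS]big_mkcond; apply: eq_bigr => m _; case: ifP => hm; first exact: pairing_sum.
  rewrite (eq_bigr (fun=> 0)) => [|c _]; last by apply: not_even_zero; rewrite hm.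
  by rewrite sumR_const; ring.
rewrite /Rdiv sumR_mulr.
rewrite (eq_bigr (fun m : cfg Ed N => \sum_(k : conf) spin_obs k *
   (\prod_(e : Ed) (/ INR (fact (m e)) * (2 * J * cos (ang inner k (src e) - ang inner k (tgt e))) ^ (m e))) * / INR #|{: conf}|)); last first.
  move=> m _; rewrite colors_to_spins card_valid pow_sum -Rmult_assoc sumR_mull sumR_mulr; apply: eq_bigr => k _.
  congr (_ * _).
  rewrite (_ : forall u v w, u * v * (spin_obs k * w) = spin_obs k * (u * v * w)); [|by move=> *; ring].
  congr (_ * _); rewrite /J_weight -!big_split; apply: eq_bigr => e _ /=.
  by rewrite !Rpow_mult_distr; field; exact: INR_fact_neq_0.
rewrite exchange_big /=; apply: eq_bigr => k _.
rewrite -sumR_mulr -sumR_mull; congr (_ * _ * _).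
rewrite (eq_bigr _ (fun e _ => E1_big _ N)) bigA_distr_bigA /=.
by apply: eq_bigr.
Qed.

End Observable.
End Assembly.

(** * The infinite-volume limit *)

Section Limits.

(** Ginibre's inequality is available for odd [n + 1] only; infinitely many [n] suffice to pass to
    the limit. *)
Lemma Un_cv_le_odd (u v : nat -> R) (l m : R) (N : nat) :
  (forall n, (N <= n)%N -> odd n.+1 -> u n <= v n) -> Un_cv u l -> Un_cv v m -> l <= m.
Proof.
move=> huv hu hv; case: (Rle_or_lt l m) => // hlt.
have he : 0 < (l - m) / 2 by lra.
have [N1 h1] := hu _ he; have [N2 h2] := hv _ he.
pose n := (2 * (N + N1 + N2))%N.
have on : odd n.+1 by rewrite oddS /n mul2n odd_double.
have hn : (N <= n)%N by rewrite /n; lia.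
have hn1 : (n >= N1)%coq_nat by rewrite /n; lia.
have hn2 : (n >= N2)%coq_nat by rewrite /n; lia.
have := huv n hn on; have := h1 n hn1; have := h2 n hn2.
by rewrite /R_dist => /Rabs_def2 [? ?] /Rabs_def2 [? ?]; lra.
Qed.

Lemma E1_tail (x r : R) (N j : nat) : Rabs x <= r -> Rabs (E1 x (N + j) - E1 x N) <= E1 r (N + j) - E1 r N.
Proof.
move=> hx; elim: j => [|j IH]; first by rewrite addn0 !Rminus_diag_eq // Rabs_R0; lra.
rewrite addnS /E1 !tech5 -/(E1 x (N + j)) -/(E1 r (N + j)).
set t := / INR (fact (N + j).+1) * x ^ (N + j).+1; set t' := / INR (fact (N + j).+1) * r ^ (N + j).+1.
have ht : Rabs t <= t'.
  have hf : 0 < / INR (fact (N + j).+1) by apply: Rinv_0_lt_compat; exact: INR_fact_lt_0.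
  rewrite /t Rabs_mult (Rabs_pos_eq (/ _)); last lra.
  apply: Rmult_le_compat_l; first lra.
  by rewrite -RPow_abs; apply: pow_incr; split=> //; exact: Rabs_pos.
rewrite -/(E1 x N) -/(E1 r N).
have -> : E1 x (N + j) + t - E1 x N = (E1 x (N + j) - E1 x N) + t by ring.
by have := Rabs_triang (E1 x (N + j) - E1 x N) t; lra.
Qed.

Lemma Un_cv_shiftn (u : nat -> R) (l : R) (N : nat) : Un_cv u l -> Un_cv (fun j => u (N + j)%N) l.
Proof.
move=> h e he; have [M hM] := h e he; exists M => j hj; apply: hM.
by apply/leP; apply: leq_trans (leq_addl N j); apply/leP.
Qed.

Lemma E1_uniform (r eps : R) : 0 < eps -> exists N0, forall N, (N0 <= N)%N -> forall x, Rabs x <= r ->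
  Rabs (E1 x N - exp x) <= eps.
Proof.
move=> he; have [N0 hN0] := E1_cvg r eps he; exists N0 => N hN x hx.
have hr := hN0 N (leP hN); rewrite /R_dist in hr.
have h1 : Rabs (E1 x N - exp x) <= Rabs (E1 r N - exp r); last lra.
have cx := Un_cv_shiftn N (E1_cvg x); have cr := Un_cv_shiftn N (E1_cvg r).
have up : exp x - E1 x N <= exp r - E1 r N.
  apply: (@Un_cv_le (fun j => E1 x (N + j) - E1 x N) (fun j => E1 r (N + j) - E1 r N)).
  - by move=> j; have := E1_tail N j hx; have := Rle_abs (E1 x (N + j) - E1 x N); lra.
  - by apply: CV_minus => //; exact: Un_cv_const.
  - by apply: CV_minus => //; exact: Un_cv_const.
have lo : - (exp r - E1 r N) <= exp x - E1 x N.
  apply: (@Un_cv_le (fun j => - (E1 r (N + j) - E1 r N)) (fun j => E1 x (N + j) - E1 x N)).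
  - by move=> j; have := E1_tail N j hx; have := Rle_abs (- (E1 x (N + j) - E1 x N)); rewrite Rabs_Ropp; lra.
  - by apply: CV_opp; apply: CV_minus => //; exact: Un_cv_const.
  - by apply: CV_minus => //; exact: Un_cv_const.
rewrite !(Rabs_minus_sym (E1 _ _)); apply: Rabs_le.
by have := Rle_abs (exp r - E1 r N); lra.
Qed.

(** Uniformity in the arguments is essential: the bound is averaged over spin configurations whose
    number grows with [n]. *)
Lemma prod_E1_uniform (I : Type) (s : seq I) (r eps : R) : 0 < eps ->
  exists N0, forall N, (N0 <= N)%N -> forall x : I -> R, (forall i, Rabs (x i) <= r) ->
  Rabs (\prod_(i <- s) E1 (x i) N - \prod_(i <- s) exp (x i)) <= eps.
Proof.
elim: s eps => [|i s IH] eps he.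
  by exists 0%N => N _ x _; rewrite !big_nil Rminus_diag_eq // Rabs_R0; lra.
pose K := exp r + exp r ^ size s + 1.
have er := exp_pos r; have es : 0 < exp r ^ size s by apply: pow_lt.
have K0 : 0 < K by rewrite /K; lra.
have e1 : 0 < eps / (2 * K) by apply: Rdiv_lt_0_compat; lra.
have e2 : 0 < Rmin 1 (eps / (2 * K)) by apply: Rmin_pos; lra.
have [N1 h1] := E1_uniform r e1; have [N2 h2] := IH _ e2.
exists (maxn N1 N2) => N; rewrite geq_max => /andP[n1 n2] x hx; rewrite !big_cons.
have {h1} := h1 N n1 (x i) (hx i); have {h2} := h2 N n2 x hx.
set a := E1 (x i) N; set a' := exp (x i); set b := \prod_(j <- s) E1 _ _; set b' := \prod_(j <- s) exp _.
move=> hb ha.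
have a'K : 0 < a' <= K.
  split; first exact: exp_pos.
  have : a' <= exp r by apply: exp_le; have := hx i; have := Rle_abs (x i); lra.
  by rewrite /K; lra.
have b'0 : 0 < b' <= exp r ^ size s.
  split; first by apply: prodR_gt0 => j _; exact: exp_pos.
  rewrite /b'; elim: (s) => [|j s' IH'] /=; first by rewrite big_nil; lra.
  rewrite big_cons; apply: Rmult_le_compat; [exact/Rlt_le/exp_pos | | | exact: IH'].
    by apply: prodR_ge0 => l _; exact/Rlt_le/exp_pos.
  by apply: exp_le; have := hx j; have := Rle_abs (x j); lra.
have bK : Rabs b <= K.
  have -> : b = (b - b') + b' by ring.
  apply: (Rle_trans _ _ _ (Rabs_triang _ _)); rewrite (Rabs_pos_eq b'); last lra.
  by move: hb b'0; have := Rmin_l 1 (eps / (2 * K)); have : K = exp r + exp r ^ size s + 1 by []; lra.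
have hb2 : Rabs (b - b') <= eps / (2 * K) by have := Rmin_r 1 (eps / (2 * K)); lra.
have -> : a * b - a' * b' = (a - a') * b + a' * (b - b') by ring.
apply: (Rle_trans _ _ _ (Rabs_triang _ _)); rewrite !Rabs_mult (Rabs_pos_eq a'); last lra.
have t1 : Rabs (a - a') * Rabs b <= eps / (2 * K) * K by apply: Rmult_le_compat => //; exact: Rabs_pos.
have t2 : a' * Rabs (b - b') <= K * (eps / (2 * K)) by apply: Rmult_le_compat; try lra; exact: Rabs_pos.
have e3 : eps / (2 * K) * K = eps / 2 by field; lra.
lra.
Qed.

(** The wire sums [B] are Cauchy because any two of them are compared with the same [z n], [n]
    large; the clock means then inherit the limit. *)
Lemma common_limit (B z : nat -> R) :
  (forall eps, 0 < eps -> exists N0, forall N, (N0 <= N)%N -> exists n0, forall n, (n0 <= n)%N -> Rabs (B N - z n) <= eps) ->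
  exists l, Un_cv B l /\ Un_cv z l.
Proof.
move=> h.
have cauchy : Cauchy_crit B.
  move=> e he; have e4 : 0 < e / 4 by lra.
  have [N0 hN0] := h _ e4; exists N0 => N M /leP hN /leP hM.
  have [n1 h1] := hN0 N hN; have [n2 h2] := hN0 M hM.
  have := h1 _ (leq_maxl n1 n2); have := h2 _ (leq_maxr n1 n2); rewrite /R_dist.
  set u := z _ => q2 q1; have -> : B N - B M = (B N - u) - (B M - u) by ring.
  by have := Rabs_triang (B N - u) (- (B M - u)); rewrite Rabs_Ropp -/(_ - (B M - u)); lra.
have [l hl] := R_complete B cauchy; exists l; split=> // e he.
have e4 : 0 < e / 4 by lra.
have [N0 hN0] := h _ e4; have [N1 hN1] := hl _ e4.
have [n0 hn0] := hN0 _ (leq_maxl N0 N1); exists n0 => n /leP hn.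
have q1 := hn0 n hn; have q2 := hN1 _ (leP (leq_maxr N0 N1)).
rewrite /R_dist in q2 *; set b := B _ in q1 q2; have -> : z n - l = (b - l) - (b - z n) by ring.
by have := Rabs_triang (b - l) (- (b - z n)); rewrite Rabs_Ropp -/(_ - (b - z n)); lra.
Qed.

Lemma Un_cv_div_INR (x C : R) : Un_cv (fun n => x + C / INR n.+1) x.
Proof.
move=> e he; have [N hN] := INR_unbounded (Rabs C / e); exists N => n /leP hn.
have n0 : 0 < INR n.+1 by apply/lt_0_INR/ltP.
rewrite /R_dist (_ : _ - x = C / INR n.+1); last by ring.
rewrite /Rdiv Rabs_mult (Rabs_pos_eq (/ _)); last exact/Rlt_le/Rinv_0_lt_compat.
apply: (Rmult_lt_reg_r (INR n.+1)) => //; rewrite Rmult_assoc Rinv_l ?Rmult_1_r; last lra.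
have hNn : INR N <= INR n.+1 by apply: le_INR; apply/leP; exact: leqW.
have : Rabs C < INR N * e.
  by apply: (Rmult_lt_reg_r (/ e)); [exact: Rinv_0_lt_compat | rewrite Rmult_assoc Rinv_r; lra].
by have := Rmult_le_compat_r e _ _ (Rlt_le _ _ he) hNn; lra.
Qed.
End Limits.

Section BoxLimit.
Variables (d L : nat) (J : R).
Hypothesis J0 : 0 <= J.

Lemma adjxx (x : Pt d L) : adj x x = false.
Proof. by rewrite adj_sum big1 // => i _; rewrite subnn. Qed.

Lemma edge_ends : exists s t : EdgeB d L -> Pt d L, forall e,
  [/\ val e = [set s e; t e], adj (s e) (t e) & inner_box (s e)].
Proof.
have [f hf] : exists f : EdgeB d L -> Pt d L * Pt d L, forall e,
    [/\ val e = [set (f e).1; (f e).2], adj (f e).1 (f e).2 & inner_box (f e).1].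
  apply: (@fin_all_exists (EdgeB d L) (fun=> (Pt d L * Pt d L)%type)
    (fun e u => [/\ val e = [set u.1; u.2], adj u.1 u.2 & inner_box u.1])) => e.
  have /existsP[x /existsP[y /and3P[/eqP h1 h2 h3]]] := valP e.
  by exists (x, y).
by exists (fun e => (f e).1), (fun e => (f e).2).
Qed.

Lemma sum_edges (s t : EdgeB d L -> Pt d L) (F : Pt d L -> Pt d L -> R) :
  (forall e, [/\ val e = [set s e; t e], adj (s e) (t e) & inner_box (s e)]) ->
  (forall x y, F x y = F y x) ->
  \sum_(u : Pt d L * Pt d L | inner_box u.1 || inner_box u.2) (if adj u.1 u.2 then F u.1 u.2 else 0) =
  \sum_(e : EdgeB d L) 2 * F (s e) (t e).
Proof.
move=> hst Fsym; rewrite -big_mkcondr /=.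
rewrite (eq_bigr (fun u : Pt d L * Pt d L => \sum_(e : EdgeB d L | val e == [set u.1; u.2]) F u.1 u.2)); last first.
  move=> [x y] /andP[/= hi ha].
  have he : is_edge [set x; y].
    apply/existsP; case/orP: hi => hi; [exists x | exists y]; apply/existsP; [exists y | exists x].
      by rewrite eqxx ha hi.
    by rewrite setUC eqxx adjC ha hi.
  rewrite (big_pred1 (exist _ [set x; y] he : EdgeB d L)) //.

rewrite (exchange_big_dep predT) //=; apply: eq_bigr => e _.
have [h1 h2 h3] := hst e; set x := s e in h1 h2 h3 *; set y := t e in h1 h2 *.
have xy : x != y by apply: contraTneq h2 => ->; rewrite adjxx.
rewrite (eq_bigl (fun u => (u == (x, y)) || (u == (y, x)))) => [|[u v] /=].
  rewrite (bigD1 (x, y)) ?eqxx //= (bigD1 (y, x)) /=; last first.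
    by rewrite eqxx orbT /= xpair_eqE negb_and eq_sym xy.
  rewrite big1 => [|w /andP[/andP[/orP[] ->]]]; rewrite ?andbF /= ?Rplus_0_r //=.
  by rewrite (Fsym y x); ring.
rewrite h1 !xpair_eqE; apply/andP/orP => [[_ /eqP e1]|[/andP[/eqP -> /eqP ->]|/andP[/eqP -> /eqP ->]]].
- have : u \in [set x; y] by rewrite e1 set21.
  have : v \in [set x; y] by rewrite e1 set22.
  have hx : x \in [set u; v] by rewrite -e1 set21.
  have hy : y \in [set u; v] by rewrite -e1 set22.
  move: hx hy; rewrite !inE => hx hy /orP[] /eqP hv /orP[] /eqP hu; subst u v.
  + by move: hy; rewrite orbb eq_sym (negbTE xy).
  + by right; rewrite !eqxx.
  + by left; rewrite !eqxx.
  + by move: hx; rewrite orbb (negbTE xy).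
- by rewrite h2 h3.
- by rewrite adjC h2 h3 orbT setUC eqxx.
Qed.

Lemma box_limit : exists E, is_expect d L J E /\ Un_cv (fun n => clock_magnetization n d L J) E.
Proof.
have [s [t hst]] := edge_ends.
have incE e x : incB e x = (x == s e) || (x == t e).
  by have [h _ _] := hst e; rewrite /incB h !inE.
have src_tgt e : s e != t e.
  by have [_ h _] := hst e; apply: contraTneq h => ->; rewrite adjxx.
have inner_src e : inner_box (s e) by have [_ _ h] := hst e.
have inner_o : inner_box (origin d L).
  by apply/innerP => i; rewrite ffunE inordK; have := double_coq L => dL; [apply/andP; split => //; apply/ltP | apply/ltP]; lia.
pose D := @inner_box d L.
pose x n (k : {ffun Pt d L -> 'I_n.+1}) (e : EdgeB d L) : R := 2 * J * cos (ang D k (s e) - ang D k (t e)).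
have xr n k e : Rabs (@x n k e) <= 2 * J.
  rewrite /x Rabs_mult (Rabs_pos_eq (2 * J)); last lra.
  have : Rabs (cos (ang D k (s e) - ang D k (t e))) <= 1 by apply: Rabs_le; exact: COS_bound.
  by have := Rabs_pos (cos (ang D k (s e) - ang D k (t e))); nra.
have wtE n (k : {ffun Pt d L -> 'I_n.+1}) : wt D (boxb J) (fun=> 0) k = \prod_(e : EdgeB d L) exp (x n k e).
  rewrite /wt -exp_sum; congr exp; rewrite /energy /boxb.
  rewrite (eq_bigr (fun u : Pt d L * Pt d L => if adj u.1 u.2 then J * cos (ang D k u.1 - ang D k u.2) else 0)); last first.
    by move=> u _; case: ifP => _; rewrite ?Rmult_0_l ?Rplus_0_r.
  etransitivity; first apply: (sum_edges (F := fun x y => J * cos (ang D k x - ang D k y)) hst).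
    by move=> u v; rewrite -cos_neg; congr (_ * cos _); ring.
  by apply: eq_bigr => e _; rewrite /x; ring.
pose z (ob : bool) n := (\sum_(k : {ffun Pt d L -> 'I_n.+1}) spin_obs D (origin d L) ob k * wt D (boxb J) (fun=> 0) k) / INR #|{: {ffun Pt d L -> 'I_n.+1}}|.
have Np n : 0 < INR #|{: {ffun Pt d L -> 'I_n.+1}}|.
  by apply: lt_0_INR; apply/ltP/card_gt0P; exists [ffun=> ord0].
have lim ob : exists l, Un_cv (fun N => @box_sum d L N J (wire_obs D (@incB d L) (origin d L) ob)) l /\ Un_cv (z ob) l.
  apply: common_limit => eps he.
  have [N0 hN0] := prod_E1_uniform (index_enum (EdgeB d L)) (2 * J) he.
  exists N0 => N hN; exists (#|{: EdgeB d L}| * N + 2)%N => n hn.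
  rewrite /box_sum (wire_spin incE src_tgt inner_src ob inner_o J hn) /z /Rdiv -Rmult_minus_distr_r -sumR_sub.
  rewrite Rabs_mult (Rabs_pos_eq (/ _)); last exact/Rlt_le/Rinv_0_lt_compat.
  apply: (Rmult_le_reg_r (INR #|{: {ffun Pt d L -> 'I_n.+1}}|)) => //.
  rewrite Rmult_assoc Rinv_l ?Rmult_1_r; last by apply: Rgt_not_eq.
  rewrite (Rmult_comm eps) -sumR_const; apply: (Rle_trans _ _ _ (sumR_abs _ _ _)); apply: sumR_le => k _.
  rewrite -Rmult_minus_distr_l Rabs_mult wtE.
  have h1 : Rabs (spin_obs D (origin d L) ob k) <= 1.
    by rewrite /spin_obs; case: ob; apply: Rabs_le; [exact: COS_bound | lra].
  have h2 := hN0 N hN (x n k) (xr n k).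
  by rewrite -(Rmult_1_l eps); apply: Rmult_le_compat => //; exact: Rabs_pos.
have [A [hA zA]] := lim true; have [Z [hZ zZ]] := lim false.
have eZ n : z false n = pfun n D (boxb J) (fun=> 0) / INR #|{: {ffun Pt d L -> 'I_n.+1}}|.
  by congr (_ / _); apply: eq_bigr => k _; rewrite /spin_obs Rmult_1_l.
have Zp : 0 < Z.
  apply: (Rlt_le_trans _ (exp (- \sum_(e : Pt d L * Pt d L) Rabs (boxb J e)))); first exact: exp_pos.
  apply: (@Un_cv_le (fun=> exp (- \sum_(e : Pt d L * Pt d L) Rabs (boxb J e))) (z false)) => //; last exact: Un_cv_const.
  move=> n; rewrite eZ; apply: (Rmult_le_reg_r (INR #|{: {ffun Pt d L -> 'I_n.+1}}|)) => //.
  rewrite /Rdiv Rmult_assoc Rinv_l ?Rmult_1_r; last by apply: Rgt_not_eq.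
  by rewrite Rmult_comm; exact: pfun_lower.
exists (A / Z); split; first by exists Z, A.
have cM n : clock_magnetization n d L J = z true n * / z false n.
  have quot (a p c : R) : 0 < p -> 0 < c -> a / p = a / c * / (p / c) by move=> p0 c0; field; lra.
  by rewrite eZ /z; apply: quot; [exact: pfun_gt0 | exact: Np].
apply: (Un_cv_ext (fun n => z true n * / z false n)) => [n|]; first by rewrite cM.
apply: CV_mult => //.
have zpos n : z false n <> 0.
  by rewrite eZ; apply: Rgt_not_eq; apply: Rdiv_lt_0_compat => //; exact: pfun_gt0.
move=> e he; pose e' := Rmin (Z / 2) (e * Z * Z / 4).
have e'0 : 0 < e'.
  by apply: Rmin_pos; [lra | apply: Rdiv_lt_0_compat; [apply: Rmult_lt_0_compat => //; nra | lra]].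
have [M hM] := zZ e' e'0; exists M => n hn; have := hM n hn; rewrite /R_dist.
have := Rmin_l (Z / 2) (e * Z * Z / 4); have := Rmin_r (Z / 2) (e * Z * Z / 4); rewrite -/e'.
move: (z false n) (zpos n) => u u0 q1 q2 q3.
have [q4 q5] := Rabs_def2 _ _ q3.
have uZ : Z / 2 < u by lra.
rewrite (_ : / u - / Z = - (u - Z) * / (u * Z)); last by field; lra.
have p0 : 0 < u * Z by nra.
rewrite Rabs_mult Rabs_Ropp (Rabs_pos_eq (/ _)); last exact/Rlt_le/Rinv_0_lt_compat.
apply: (Rmult_lt_reg_r (u * Z)) => //; rewrite Rmult_assoc Rinv_l ?Rmult_1_r; last lra.
have : Z / 2 * Z < u * Z by apply: Rmult_lt_compat_r.
by nra.
Qed.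
End BoxLimit.

Section Magnetization.

(** Total by choice; the value is meaningful for convergent sequences. *)
Definition Un_lim (u : nat -> R) : R := epsilon (inhabits 0) (Un_cv u).

Lemma Un_limP (u : nat -> R) l : Un_cv u l -> Un_cv u (Un_lim u).
Proof. by move=> h; apply: epsilon_spec; exists l. Qed.

Definition box_magnetization (d : nat) (J : R) (L : nat) : R := Un_lim (fun n => clock_magnetization n d L J).
Definition magnetization (d : nat) (J : R) : R := Un_lim (box_magnetization d J).

Lemma box_magnetization_cv d L J : 0 <= J -> Un_cv (fun n => clock_magnetization n d L J) (box_magnetization d J L).
Proof. by move=> J0; have [E [_ h]] := box_limit d L J0; exact: Un_limP h. Qed.

Lemma box_magnetization_expect d L J : 0 <= J -> is_expect d L J (box_magnetization d J L).
Proof.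
move=> J0; have [E [hE h]] := box_limit d L J0.
by rewrite (UL_sequence _ _ _ (box_magnetization_cv d L J0) h).
Qed.

Lemma box_magnetization_ge0 d L J : 0 <= J -> 0 <= box_magnetization d J L.
Proof.
move=> J0; apply: (@Un_cv_le_odd (fun=> 0) _ _ _ 0%N _ (Un_cv_const 0) (box_magnetization_cv d L J0)) => n _ on.
exact: clock_magnetization_ge0.
Qed.

Lemma box_magnetization_anti d J L L' : 0 <= J -> (L <= L')%N -> box_magnetization d J L' <= box_magnetization d J L.
Proof.
move=> J0 hL; apply: (@Un_cv_le_odd _ _ _ _ 0%N _ (box_magnetization_cv d L' J0) (box_magnetization_cv d L J0)) => n _ on.
exact: clock_magnetization_anti.
Qed.

Lemma magnetization_cv d J : 0 <= J -> Un_cv (box_magnetization d J) (magnetization d J).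
Proof.
move=> J0; have dec : Un_decreasing (box_magnetization d J) by move=> L; apply: box_magnetization_anti.
have lb : has_lb (box_magnetization d J).
  by exists 0 => _ [L ->]; rewrite /opp_seq; have := box_magnetization_ge0 d L J0; lra.
by have [l hl] := decreasing_cv _ dec lb; exact: Un_limP hl.
Qed.

Lemma magnetization_ge0 d J : 0 <= J -> 0 <= magnetization d J.
Proof.
by move=> J0; apply: (Un_cv_le _ (Un_cv_const 0) (magnetization_cv d J0)) => L; exact: box_magnetization_ge0.
Qed.

Lemma magnetization_monod d J : 0 <= J -> magnetization d J <= magnetization d.+1 J.
Proof.
move=> J0; apply: (Un_cv_le _ (magnetization_cv d J0) (magnetization_cv d.+1 J0)) => L.
apply: (@Un_cv_le_odd _ _ _ _ 0%N _ (box_magnetization_cv d L J0) (box_magnetization_cv d.+1 L J0)) => n _ on.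
exact: clock_magnetization_monod.
Qed.

Lemma magnetization_monoJ d J J' : 0 <= J <= J' -> magnetization d J <= magnetization d J'.
Proof.
move=> hJ; have J0 : 0 <= J by lra.
have J0' : 0 <= J' by lra.
apply: (Un_cv_le _ (magnetization_cv d J0) (magnetization_cv d J0')) => L.
apply: (@Un_cv_le_odd _ _ _ _ 0%N _ (box_magnetization_cv d L J0) (box_magnetization_cv d L J0')) => n _ on.
exact: clock_magnetization_monoJ.
Qed.

Lemma magnetization_high_temperature d J : 0 <= J -> INR (2 * d) * J < 1 -> magnetization d J = 0.
Proof.
move=> J0 h1; apply: Rle_antisym; last exact: magnetization_ge0.
set r := INR (2 * d) * J in h1.
have r0 : 0 <= r by apply: Rmult_le_pos => //; exact: pos_INR.
have cv0 : Un_cv (fun L => r ^ L.+1) 0.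
  have r1 : Rabs r < 1 by rewrite Rabs_pos_eq.
  by move=> e he; have [N hN] := pow_lt_1_zero r r1 e he; exists N => L hL; rewrite /R_dist Rminus_0_r; apply: hN; lia.
apply: (Un_cv_le _ (magnetization_cv d J0) cv0) => L.
have [C C0 hC] := clock_magnetization_high_temperature L J0 (Rlt_le _ _ h1).
apply: (@Un_cv_le_odd _ _ _ _ 8%N _ (box_magnetization_cv d L J0) (Un_cv_div_INR _ C)) => n hn on.
by apply: hC => //; lia.
Qed.

Lemma magnetization_two_dimensions J : 0 <= J -> magnetization 2 J = 0.
Proof.
move=> J0; apply: Rle_antisym; last exact: magnetization_ge0.
pose K := 16 * PI ^ 2 * J.
have K0 : 0 <= K by apply: Rmult_le_pos => //; have := pow2_ge_0 PI; lra.
have cv0 : Un_cv (fun L => K / harm L.+1) 0.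
  move=> e he; have [N hN] := INR_unbounded (exp (K / e + 1)); exists N => L hL.
  have hl : K / e + 1 < harm L.+1.
    apply: Rlt_le_trans (harm_ln _); rewrite -(ln_exp (K / e + 1)).
    apply: ln_increasing; first exact: exp_pos.
    by apply: (Rlt_le_trans _ _ _ hN); apply: le_INR; lia.
  have Ke : 0 <= K / e by apply: Rmult_le_pos => //; exact/Rlt_le/Rinv_0_lt_compat.
  have h0 : 0 < harm L.+1 by lra.
  rewrite /R_dist Rminus_0_r Rabs_pos_eq; last by apply: Rmult_le_pos => //; exact/Rlt_le/Rinv_0_lt_compat.
  apply: (Rmult_lt_reg_r (harm L.+1)) => //; rewrite /Rdiv Rmult_assoc Rinv_l ?Rmult_1_r; last lra.
  have -> : K = e * (K / e) by field; lra.
  by apply: Rmult_lt_compat_l => //; lra.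
apply: (Un_cv_le _ (magnetization_cv 2 J0) cv0) => L.
have [C C0 hC] := clock_magnetization_two_dimensions L J0.
by apply: (@Un_cv_le_odd _ _ _ _ 0%N _ (box_magnetization_cv 2 L J0) (Un_cv_div_INR _ C)) => n _ on; exact: hC.
Qed.

Lemma magnetization_low_temperature d : (3 <= d)%N -> exists J, 0 <= J /\ / 2 <= magnetization d J.
Proof.
have [J [J0 [N hN]]] := clock_magnetization_three_dimensions; move=> hd; exists J; split=> //.
elim: d hd => // d IH; rewrite leq_eqVlt => /orP[/eqP <-|/IH]; last first.
  by have := magnetization_monod d J0; lra.
apply: (Un_cv_le _ (Un_cv_const (/ 2)) (magnetization_cv 3 J0)) => L.
apply: (@Un_cv_le_odd _ _ _ _ N _ (Un_cv_const (/ 2)) (box_magnetization_cv 3 L J0)) => n hn on.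
(* For [0 <= M <= 1], the bound [1 <= 2 * M ^ 2] implies [M >= 1/2]. *)
by have := hN n L hn on; have := clock_magnetization_ge0 3 L on J0; have := clock_magnetization_le1 n 3 L J; nra.
Qed.

(** [Jc] is the supremum of the nonnegative couplings with zero magnetization, which contain 0, are
    bounded by the low temperature result, and form an interval by monotonicity. *)
Lemma magnetization_threshold d : (3 <= d)%N -> exists Jc,
  (forall J, Jc < J -> 0 < magnetization d J) /\
  (forall J, 0 <= J -> J < Jc -> magnetization d J = 0).
Proof.
move=> hd; have [J1 [J10 h1]] := magnetization_low_temperature hd.
pose S J := 0 <= J /\ magnetization d J = 0.
have S0 : S 0 by split; [lra | apply: magnetization_high_temperature; lra].
have bS : bound S.
  exists J1 => J [J0 hJ]; case: (Rle_or_lt J J1) => // hlt.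
  by have : magnetization d J1 <= magnetization d J; [apply: magnetization_monoJ | ]; lra.
have [Jc [ub lub]] := completeness S bS (ex_intro _ 0 S0).
exists Jc; split=> J.
  move=> hJ; have J0 : 0 <= J by have := ub 0 S0; lra.
  case: (Rle_lt_or_eq_dec _ _ (magnetization_ge0 d J0)) => // e.
  by have : J <= Jc; [apply: ub | lra].
move=> J0 hJ; apply: Rle_antisym; last exact: magnetization_ge0.
have [[J' [[J0' hJ'] hlt]]|hn] := classic (exists J', S J' /\ J < J').
  by rewrite -hJ'; apply: magnetization_monoJ; lra.
have : Jc <= J; last lra.
apply: lub => J' SJ'; case: (Rle_or_lt J' J) => // hlt.
by case: hn; exists J'.
Qed.

(** From [ln (1 + x) <= x] and [2 ^ (- 3/2) <= 1] one gets [J < 1 / (2 d) ^ 2], which is below the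
    threshold [1 / (2 d)] of the path expansion. *)
Lemma threshold_lt (d : nat) (J : R) : (0 < d)%N ->
  J < Rpower 2 (- (3 / 2)) * ln (1 + / INR (2 * d) ^ 2) -> INR (2 * d) * J < 1.
Proof.
move=> hd hJ; set D := INR (2 * d) in hJ *.
have D1 : 1 <= D by apply: (le_INR 1); lia.
have i0 : 0 < / D ^ 2 by apply: Rinv_0_lt_compat; nra.
have hl : 0 <= ln (1 + / D ^ 2) <= / D ^ 2.
  split; first by rewrite -ln_1; apply/Rlt_le/ln_increasing; lra.
  case: (Rle_or_lt (ln (1 + / D ^ 2)) (/ D ^ 2)) => // /exp_increasing; rewrite exp_ln; last lra.
  by have := exp_ineq1_le (/ D ^ 2); lra.
have hp : Rpower 2 (- (3 / 2)) <= 1.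
  by rewrite -(Rpower_O 2); [apply: Rle_Rpower | ]; lra.
have p0 : 0 < Rpower 2 (- (3 / 2)) by exact: exp_pos.
have hJ2 : J < / D ^ 2 by nra.
have : D * J < D * / D ^ 2 by apply: Rmult_lt_compat_l; lra.
have -> : D * / D ^ 2 = / D by field; lra.
have : / D <= / 1 by apply: Rinv_le_contravar; lra.
by rewrite Rinv_1; lra.
Qed.
End Magnetization.
Local Close Scope bigR_scope.
Local Close Scope R_scope.

Theorem theorem5p1 :
  exists mt : nat -> R -> R,
    (* the limit exists *)
    (forall (d : nat) (J : R), (1 <= d)%nat -> (0 <= J)%R ->
       exists E : nat -> R,
         (forall L : nat, is_expect d L J (E L)) /\ Un_cv E (mt d J)) /\
    (* (a) monotonicity in d and J *)
    (forall (d : nat) (J : R), (1 <= d)%nat -> (0 <= J)%R ->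
       (mt d J <= mt d.+1 J)%R) /\
    (forall (d : nat) (J J' : R), (1 <= d)%nat -> (0 <= J)%R -> (J <= J')%R ->
       (mt d J <= mt d J')%R) /\
    (* (b) high temperature *)
    (forall (d : nat) (J : R), (1 <= d)%nat -> (0 <= J)%R ->
       (J < Rpower 2 (- (3 / 2)) * ln (1 + / pow (INR (2 * d)) 2))%R ->
       mt d J = 0%R) /\
    (* (c) d = 1, 2 *)
    (forall (d : nat) (J : R), (d = 1 \/ d = 2)%coq_nat -> (0 <= J)%R ->
       mt d J = 0%R) /\
    (* (d) phase transition for d >= 3 *)
    (forall d : nat, (3 <= d)%nat ->
       exists Jc : R,
         (forall J : R, (Jc < J)%R -> (0 < mt d J)%R) /\
         (forall J : R, (0 <= J)%R -> (J < Jc)%R -> mt d J = 0%R)).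
Proof.
exists magnetization; split; [|split; [|split; [|split; [|split]]]].
- move=> d J _ J0; exists (box_magnetization d J); split; last exact: magnetization_cv.
  by move=> L; exact: box_magnetization_expect.
- by move=> d J _; exact: magnetization_monod.
- by move=> d J J' _ J0 JJ'; apply: magnetization_monoJ.
- by move=> d J hd J0 hJ; apply: magnetization_high_temperature => //; exact: threshold_lt.
- move=> d J [] -> J0; last exact: magnetization_two_dimensions.
  (* Dimension one is dominated by dimension two. *)
  apply: Rle_antisym; last exact: magnetization_ge0.
  by rewrite -(magnetization_two_dimensions J0); exact: magnetization_monod.
- exact: magnetization_threshold.
Qed.
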